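(* Let $n\geq 2$ and let $B(\cdot)$ be a standard Brownian motion in $\mathbb{R}^n$. Let $K=\operatorname{Conv}(\{B(t):0\leq t\leq 1\})$. Then almost surely $K$ is smooth, i.e. for every boundary point $x\in\partial K$ the supporting hyperplane to $K$ at $x$ is unique.
   Context: $\operatorname{Conv}$ denotes the convex hull. A point $x\in\partial K$ of a convex set $K$ is called singular if the supporting hyperplane to $K$ at $x$ is not unique; $K$ is smooth if none of its boundary points are singular. *)

(* Defs.v *)
From HB Require Import structures.
From mathcomp Require Import all_boot all_order all_algebra.
From mathcomp Require Import all_classical all_reals all_analysis.
Set Implicit Arguments. Unset Strict Implicit. Unset Printing Implicit Defensive.
Import Order.TTheory GRing.Theory Num.Theory.
Import numFieldNormedType.Exports.
Local Open Scope classical_set_scope.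
Local Open Scope ring_scope.

Definition dotv (R : realType) (n : nat) (u v : 'rV[R]_n) : R :=
  \sum_(i < n) u ord0 i * v ord0 i.

Definition conv_hull (R : realType) (n : nat) (S : set 'rV[R]_n) : set 'rV[R]_n :=
  [set x | exists (k : nat) (p : 'I_k -> 'rV[R]_n) (w : 'I_k -> R),
     [/\ forall i, S (p i), forall i, 0 <= w i, \sum_(i < k) w i = 1
       & x = \sum_(i < k) w i *: p i]].

Definition boundary (R : realType) (n : nat) (K : set 'rV[R]_n) : set 'rV[R]_n :=
  closure K `\` interior K.

Definition supporting_hyperplane (R : realType) (n : nat)
  (K : set 'rV[R]_n) (x : 'rV[R]_n) (H : set 'rV[R]_n) : Prop :=
  exists u : 'rV[R]_n, [/\ u != 0,
    H = [set y | dotv u y = dotv u x]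
  & forall y, K y -> dotv u y <= dotv u x].

Definition smooth_convex (R : realType) (n : nat) (K : set 'rV[R]_n) : Prop :=
  forall x, boundary K x ->
  forall H1 H2, supporting_hyperplane K x H1 -> supporting_hyperplane K x H2 ->
  H1 = H2.

(* B is a standard Brownian motion in R^n on the probability space (Omega, P):
   B_0 = 0, all paths continuous on [0, +oo), coordinates measurable, and for
   every time grid 0 = t_0 < t_1 < ... < t_k the n*k coordinate increments
   B^i(t_{j+1}) - B^i(t_j) are mutually independent with law N(0, t_{j+1} - t_j)
   (normal_prob takes mean and standard deviation). *)
Definition standard_brownian_motion (R : realType) (n : nat)
  (d : measure_display) (Omega : measurableType d) (P : probability Omega R)
  (B : R -> Omega -> 'rV[R]_n) : Prop :=
  [/\ forall w, B 0 w = 0,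
      forall w, {within [set t : R | 0 <= t], continuous (fun t => B t w)},
      forall t (i : 'I_n), 0 <= t -> measurable_fun setT (fun w => B t w ord0 i)
    & forall (k : nat) (t : nat -> R), t 0%N = 0 ->
      (forall j, (j < k)%N -> t j < t j.+1) ->
      forall A : 'I_n -> nat -> set R, (forall i j, measurable (A i j)) ->
      P [set w | forall (i : 'I_n) (j : nat), (j < k)%N ->
                   A i j (B (t j.+1) w ord0 i - B (t j) w ord0 i)]
      = (\prod_(i < n) \prod_(j < k)
           normal_prob 0 (Num.sqrt (t j.+1 - t j)) (A i j))%E].

(* Main.v *)
Require Import Defs.
From HB Require Import structures.
From mathcomp Require Import all_boot all_order all_algebra.
From mathcomp Require Import all_classical all_reals all_analysis.
From mathcomp Require Import measurable_realfun.
From mathcomp Require Import ring lra.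
Set Implicit Arguments. Unset Strict Implicit. Unset Printing Implicit Defensive.
Import Order.TTheory GRing.Theory Num.Theory.
Import numFieldNormedType.Exports.
Local Open Scope classical_set_scope.
Local Open Scope ring_scope.

(* Two distinct supporting hyperplanes at one point yield a time t and two linearly
   independent unit vectors u, v such that the whole path seen from B t stays in the
   wedge {y | u.y <= 0, v.y <= 0}: take for t a maximiser of (u + v).B.  This wedge is
   strictly smaller than a half-space, so a random walk started within distance r of
   its apex stays near it up to time of order 1 with probability O(r^(1+d)) for some d > 0.
   This is obtained from an explicit Lyapunov function instead of the harmonic function
   of the wedge.  On the dyadic grid of mesh 2^-m, apart from finitely many m the path
   is within r = C z^m of its grid values, where z is slightly larger than 2^-1/2.
   A time t as above thus makes the walks run forward and backward from a neighbouring
   grid time stay near the wedge.  These two events are independent, so the expected number of such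
   grid times is O(2^m r^(2(1+d))), which is summable, and Borel-Cantelli applies.
   At t = 0 or t = 1 a single walk suffices.  The directions u, v are replaced
   by nearby rational ones to leave a countable union of null sets. *)

(** Exponent 1 is critical. For a half-space each walk would survive with probability of order r,
    and at r about 2^(-m/2) the product 2^m r^2 does not decay; it cannot, since every direction has
    a maximiser. The gain d > 0 is thus what decides, and it also pays for taking z above 2^(-1/2),
    which the control of the path between grid times requires. The walk has unbounded Gaussian steps
    and may jump across the edge of the wedge. What is used is an inequality for V(y + g) valid for
    all g, polynomial in g with coefficients depending on y alone; its mean follows from moments of
    order 1, 2 and 4 and from the independence of a step from the past. Restricted to survival, the
    mean of V drops at each step by a constant times the step variance times the survival
    probability. As V >= 0 and V(0) = O(r^(1+d)), summing over a number of steps of order 2^m bounds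
    that probability without stopping times. The uniform drop is obtained under |y| <= M, which
    boundedness of the path on [0, 1] supplies. *)

(** * Elementary inequalities and the deterministic one-step bound *)

(** By difference of squares, [s' - (s + p)] times [s' + s + p] is [tau ^+ 2 - p ^+ 2], and the
    second factor is at most [2 * (s + tau)]. A lower bound is wanted because the square root enters
    the Lyapunov function with a negative sign. *)
Lemma sqrt_second_order (R : realType) (s s' p tau : R) :
  0 < s -> 0 <= s' -> `|p| <= tau -> s' ^+ 2 = s ^+ 2 + 2 * s * p + tau ^+ 2 ->
  s + p + (tau ^+ 2 - p ^+ 2) / (2 * s) - tau ^+ 3 / (2 * s ^+ 2) <= s'.
Proof.
move=> s0 s'0; rewrite ler_norml => /andP[p1 p2] es'.
have tau0 : 0 <= tau by lra.
have s'le : s' <= s + tau by rewrite -(ler_pXn2r (ltn0Sn 1)) ?nnegrE; nra.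
set q := tau ^+ 2 - p ^+ 2.
have q0 : 0 <= q by rewrite /q; nra.
have qt : q <= tau ^+ 2 by rewrite /q; nra.
have pe : - s' <= s + p <= s'.
  rewrite -ler_norml -(ler_pXn2r (ltn0Sn 1)) ?nnegrE// real_normK ?num_real//.
  by move: q0; rewrite /q; nra.
case/andP: pe => pe1 pe2.
have H : q / (2 * (s + tau)) <= s' - (s + p).
  rewrite ler_pdivrMr; last by nra.
  have -> : q = (s' - (s + p)) * (s' + (s + p)) by rewrite /q; nra.
  rewrite ler_wpM2l//; lra.
have H2 : q / (2 * s) - tau ^+ 3 / (2 * s ^+ 2) <= q / (2 * (s + tau)).
  rewrite -subr_ge0.
  have -> : q / (2 * (s + tau)) - (q / (2 * s) - tau ^+ 3 / (2 * s ^+ 2)) =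
     (tau * (tau ^+ 2 * (s + tau) - q * s)) / (2 * s ^+ 2 * (s + tau)).
    by field; rewrite !gt_eqF //; nra.
  rewrite divr_ge0//; last by rewrite mulr_ge0//; nra.
  by rewrite mulr_ge0//; nra.
lra.
Qed.

(** Weighted arithmetic-geometric mean inequality for [x] and 1, obtained from the tangent line of
    the exponential at [d * ln x]. *)
Lemma powR_bernoulli (R : realType) (x d : R) : 0 < x -> 0 <= d <= 1 ->
  x `^ d <= 1 + d * (x - 1).
Proof.
move=> x0 /andP[d0 d1].
rewrite /powR gt_eqF//; set L := ln x.
have xE : x = expR (d * L) * expR ((1 - d) * L).
  by rewrite -expRD -mulrDl subrKC mul1r lnK// posrE.
have oneE : 1 = expR (d * L) * expR (- (d * L)).
  by rewrite -expRD subrr expR0.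
have e1 := expR_ge1Dx ((1 - d) * L).
have e2 := expR_ge1Dx (- (d * L)).
have -> : 1 + d * (x - 1) = d * x + (1 - d) * 1 by ring.
have := expR_gt0 (d * L); set E := expR (d * L) in xE oneE * => E0.
set F := expR ((1 - d) * L) in e1 xE; set G := expR (- (d * L)) in e2 oneE.
rewrite {2}oneE xE.
have -> : d * (E * F) + (1 - d) * (E * G) = E * (d * F + (1 - d) * G) by ring.
rewrite ler_peMr//; nra.
Qed.

(** Writing m^(1+d) = w^d m (m/w)^d and applying the Bernoulli bound to (m/w)^d gives exactly the
    right-hand side. There is no Taylor remainder, so [m] may be far from [w], or zero. *)
Lemma powR_second_order (R : realType) (m w d : R) : 0 <= m -> 0 < w -> 0 <= d <= 1 ->
  m `^ (1 + d) <=
  w `^ (1 + d) + w `^ d * ((1 + d) * (m - w) + d * (m - w) ^+ 2 / w).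
Proof.
move=> m0 w0 /andP[d0 d1].
have d1n0 : 1 + d != 0 by rewrite gt_eqF//; lra.
have wE : w `^ (1 + d) = w * w `^ d.
  by rewrite powRD ?powRr1 ?ltW// (gt_eqF w0) implybT.
have -> : w `^ (1 + d) + w `^ d * ((1 + d) * (m - w) + d * (m - w) ^+ 2 / w) =
  w `^ d * (m * (1 + d * (m / w - 1))).
  by rewrite wE; field; rewrite gt_eqF.
have [->|mn0] := eqVneq m 0; first by rewrite powR0// mul0r mulr0.
have {mn0}m0 : 0 < m by rewrite lt_neqAle eq_sym mn0.
have -> : m `^ (1 + d) = w `^ d * (m * (m / w) `^ d).
  rewrite powRD ?(gt_eqF m0) ?implybT// powRr1 ?ltW//.
  by rewrite mulrCA -powRM ?divr_ge0 ?ltW// mulrCA mulfV ?mulr1// gt_eqF.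
rewrite ler_wpM2l ?powR_ge0// ler_wpM2l ?(ltW m0)//.
by apply: powR_bernoulli; rewrite ?divr_gt0// d0.
Qed.

(** Trades a cubic Taylor error for even powers, whose Gaussian moments are at hand; the two terms
    balance at the scale [sg] of one step. *)
Lemma cube_le_sqr_quartic (R : realType) (sg x : R) : 0 < sg -> 0 <= x ->
  x ^+ 3 <= (sg * x ^+ 2 + x ^+ 4 / sg) / 2.
Proof.
move=> sg0 x0; rewrite -subr_ge0.
have -> : (sg * x ^+ 2 + x ^+ 4 / sg) / 2 - x ^+ 3 =
  x ^+ 2 * (sg - x) ^+ 2 / (2 * sg) by field; rewrite gt_eqF.
apply: divr_ge0; first exact: mulr_ge0 (sqr_ge0 _) (sqr_ge0 _).
by rewrite mulr_ge0// ltW.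
Qed.

Lemma sqr_le_of_norm (R : realType) (x t : R) : `|x| <= t -> x ^+ 2 <= t ^+ 2.
Proof.
move=> h; rewrite -[X in X <= _]real_normK ?num_real//.
by rewrite ler_pXn2r ?nnegrE//; apply: le_trans h.
Qed.

(** Triangle inequality phrased through squares, so that it applies to the smoothed lengths [s] and
    [rho] as well. *)
Lemma norm_step (R : realType) (s s' sp tau : R) :
  0 < s -> 0 <= s' -> `|sp| <= s * tau -> 0 <= tau ->
  s' ^+ 2 = s ^+ 2 + 2 * sp + tau ^+ 2 -> `|s' - s| <= tau.
Proof.
move=> s0 s'0 + tau0 e; rewrite !ler_norml => /andP[p1 p2].
apply/andP; split; last first.
  by rewrite lerBlDr -(ler_pXn2r (ltn0Sn 1)) ?nnegrE; nra.
have [?|ts] := leP s tau; first lra.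
suff : s - tau <= s' by lra.
by rewrite -(ler_pXn2r (ltn0Sn 1)) ?nnegrE; nra.
Qed.

Lemma cauchy_schwarz2 (R : realType) (a b x y : R) :
  (a * x + b * y) ^+ 2 <= (a ^+ 2 + b ^+ 2) * (x ^+ 2 + y ^+ 2).
Proof. by have := sqr_ge0 (a * y - b * x); nra. Qed.

(** Here [a], [b] stand for u.y, v.y, while [al], [be], [ze] stand for u.g, v.g, y.g and [t] for
    |g|; [s], [rho], [w] are the pieces of the Lyapunov function at y, primed at y + g, and [p] is
    the derivative of s along g. The concavity of -s / 2 yields the negative term in
    [al ^+ 2 + be ^+ 2 - p ^+ 2]. Every error carries the same factor 1/s, so that this term can
    absorb it. *)
Lemma lyapunov_step (R : realType)
  (k d sg r a b al be ze t s s' rho rho' w : R)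
  (w' := w - (al + be) - (s' - s) / 2 + k * (rho' - rho))
  (p := (a * al + b * be) / s) :
  0 < k -> 0 <= d <= 1 -> k <= 1 -> 0 < sg ->
  0 < r -> 0 <= t -> r <= s -> 0 <= s' -> 0 <= rho' ->
  s <= 3 * rho -> k * s / 6 <= w ->
  `|al| <= 2 * t -> `|be| <= 2 * t -> `|ze| <= rho * t ->
  a ^+ 2 + b ^+ 2 <= s ^+ 2 ->
  s' ^+ 2 = s ^+ 2 + 2 * (a * al + b * be) + (al ^+ 2 + be ^+ 2) ->
  rho' ^+ 2 = rho ^+ 2 + 2 * ze + t ^+ 2 ->
  (Num.max w' 0) `^ (1 + d) <= w `^ (1 + d) + w `^ d * (
    (1 + d) * (- (al + be) - p / 2 + k * ze / rho)
  + s^-1 * (- (1 + d) * (al ^+ 2 + be ^+ 2 - p ^+ 2) / 4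
     + (3 * k + 294 * d / k) * t ^+ 2
     + 2 * (1 + 172 * (6 / k) ^+ 2) * (sg / r) * (t ^+ 2 + 8 * t ^+ 4 / sg ^+ 2))).
Proof.
move=> k0 d01 k1 sg0 r0 t0 rs s'0 rho'0 srho sw als bes zes abs2 s'E rho'E.
pose err := (sg * t ^+ 2 + 8 * t ^+ 4 / sg).
have s0 : 0 < s by exact: lt_le_trans rs.
have rho0 : 0 < rho by lra.
have w0 : 0 < w by apply: lt_le_trans sw; rewrite divr_gt0// mulr_gt0.
have spE : a * al + b * be = s * p by rewrite /p; field; rewrite gt_eqF.
pose tau := Num.sqrt (al ^+ 2 + be ^+ 2).
have tau2 : tau ^+ 2 = al ^+ 2 + be ^+ 2.
  by rewrite sqr_sqrtr// addr_ge0 ?sqr_ge0.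
have al2 := sqr_le_of_norm als; have be2 := sqr_le_of_norm bes.
have tau0 : 0 <= tau by exact: sqrtr_ge0.
have taule : tau <= 3 * t.
  by rewrite -(ler_pXn2r (ltn0Sn 1)) ?nnegrE ?mulr_ge0// tau2; nra.
have ptau : `|p| <= tau.
  rewrite -(ler_pXn2r (ltn0Sn 1)) ?nnegrE// real_normK ?num_real// tau2 /p exprMn.
  rewrite exprVn ler_pdivrMr ?exprn_gt0//.
  apply: (le_trans (cauchy_schwarz2 _ _ _ _)).
  by rewrite mulrC ler_wpM2l// addr_ge0 ?sqr_ge0.
have s_step : `|s' - s| <= tau.
  apply: (norm_step s0 s'0 _ tau0); last by rewrite s'E tau2.
  by rewrite spE normrM gtr0_norm// ler_wpM2l// ltW.
have rho_step : `|rho' - rho| <= t by exact: (norm_step rho0 rho'0 zes t0).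
(* 7 covers 4 from [al + be], 3/2 from half of [s' - s] (as [tau <= 3 * t]), and 1 from the [rho]
   term. *)
have w_step : `|w' - w| <= 7 * t.
  move: s_step rho_step; rewrite !ler_norml => /andP[? ?] /andP[? ?].
  move: als bes; rewrite !ler_norml => /andP[? ?] /andP[? ?].
  by rewrite /w'; apply/andP; split; nra.
have w_step2 : w' - w <= - (al + be) - p / 2 + k * ze / rho
  + s^-1 * (- (al ^+ 2 + be ^+ 2 - p ^+ 2) / 4 + 3 / 2 * k * t ^+ 2)
  + err / s ^+ 2.
  have e : s' ^+ 2 = s ^+ 2 + 2 * s * p + tau ^+ 2.
    by rewrite s'E spE tau2 mulrA.
  have := sqrt_second_order s0 s'0 ptau e; rewrite tau2.
  have rr : rho' - rho <= ze / rho + 3 / 2 * t ^+ 2 / s.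
    have h : rho' <= rho + ze / rho + t ^+ 2 / (2 * rho).
      have -> : rho + ze / rho + t ^+ 2 / (2 * rho) =
        (rho ^+ 2 + rho' ^+ 2) / (2 * rho).
        by rewrite rho'E; field; rewrite gt_eqF.
      rewrite ler_pdivlMr; last by rewrite mulr_gt0.
      by have := sqr_ge0 (rho - rho'); nra.
    have : t ^+ 2 / (2 * rho) <= 3 / 2 * t ^+ 2 / s.
      rewrite ler_pdivlMr// mulrAC ler_pdivrMr ?mulr_gt0//.
      by have := sqr_ge0 t; nra.
    lra.
  have ct : tau ^+ 3 / (2 * s ^+ 2) <= 2 * (err / s ^+ 2).
    have -> : tau ^+ 3 / (2 * s ^+ 2) = (tau ^+ 3 / 2) / s ^+ 2.
      by field; rewrite gt_eqF.
    rewrite [leRHS]mulrA ler_wpM2r ?invr_ge0 ?exprn_ge0 ?(ltW s0)//.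
    have h := cube_le_sqr_quartic sg0 tau0.
    have t2 : tau ^+ 2 <= 8 * t ^+ 2 by rewrite tau2; lra.
    have t4 : tau ^+ 4 / sg <= 64 * (t ^+ 4 / sg).
      rewrite mulrA ler_wpM2r ?invr_ge0 ?(ltW sg0)//.
      have -> : tau ^+ 4 = tau ^+ 2 * tau ^+ 2 by ring.
      have -> : t ^+ 4 = t ^+ 2 * t ^+ 2 by ring.
      by have := sqr_ge0 tau; have := sqr_ge0 t; nra.
    by rewrite /err -mulrA; nra.
  have krr : k * (rho' - rho) <= k * (ze / rho) + s^-1 * (3 / 2 * k * t ^+ 2).
    apply: (le_trans (ler_wpM2l (ltW k0) rr)).
    by rewrite mulrDr lerD2l [X in _ <= X](_ : _ = k * (3 / 2 * t ^+ 2 / s))//; ring.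
  rewrite /w' -[k * ze / rho]mulrA.
  have -> : s^-1 * (- (al ^+ 2 + be ^+ 2 - p ^+ 2) / 4 + 3 / 2 * k * t ^+ 2) =
    - ((al ^+ 2 + be ^+ 2 - p ^+ 2) / (2 * s)) / 2 + s^-1 * (3 / 2 * k * t ^+ 2).
    by field; rewrite gt_eqF.
  lra.
set m := Num.max w' 0.
have m0 : 0 <= m by rewrite /m le_max lexx orbT.
apply: (le_trans (powR_second_order m0 w0 d01)).
rewrite lerD2l ler_wpM2l ?powR_ge0//.
have /andP[d0 d1] := d01.
move: w_step; rewrite ler_norml => /andP[ws1 ws2].
have mw2 : (m - w) ^+ 2 <= (7 * t) ^+ 2.
  clear -ws1 ws2 w0.
  apply: sqr_le_of_norm; rewrite ler_norml /m.
  by case: (leP w' 0) => ?; apply/andP; split; lra.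
have tq0 : 0 <= t ^+ 4 / sg by rewrite divr_ge0 ?exprn_ge0// ltW.
have ts0 : 0 <= sg * t ^+ 2 by rewrite mulr_ge0 ?sqr_ge0// ltW.
have werr0 : 0 <= err by rewrite /err -mulrA; lra.
(* The cost of truncating at 0: if [w' <= 0] then [7 * t >= w >= k * s / 6], so the truncated
   amount, at most [7 * t], is dominated by a cubic error. The constant 172 is 343 / 2 rounded up,
   from (7 t)^3 and the halving in [cube_le_sqr_quartic]. *)
have m1 : m - w <= w' - w + 172 * (6 / k) ^+ 2 * (err / s ^+ 2).
  have h0 : 0 <= 172 * (6 / k) ^+ 2 * (err / s ^+ 2).
    apply: mulr_ge0; first exact: mulr_ge0 (ler0n _ _) (sqr_ge0 _).
    exact: divr_ge0 werr0 (sqr_ge0 _).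
  rewrite /m; case: (leP w' 0) => h; last lra.
  suff : 7 * t <= 172 * (6 / k) ^+ 2 * (err / s ^+ 2) by lra.
  have tw : w <= 7 * t by lra.
  have -> : 172 * (6 / k) ^+ 2 * (err / s ^+ 2) = 172 * err / (k * s / 6) ^+ 2.
    by field; rewrite !gt_eqF.
  rewrite ler_pdivlMr; last by rewrite exprn_gt0// divr_gt0// mulr_gt0.
  apply: (@le_trans _ _ (7 * t * (7 * t) ^+ 2)).
    rewrite ler_wpM2l ?mulr_ge0// ler_pXn2r ?nnegrE ?mulr_ge0 ?invr_ge0 ?(ltW k0) ?(ltW s0)//.
    exact: le_trans tw.
  have -> : 7 * t * (7 * t) ^+ 2 = 343 * t ^+ 3 by ring.
  by have := cube_le_sqr_quartic sg0 t0; rewrite /err -mulrA; lra.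
(* 294 = 6 * 49: the square of [7 * t] divided by [w >= k * s / 6]. *)
have dw : d * (m - w) ^+ 2 / w <= s^-1 * (294 * d / k * t ^+ 2).
  rewrite ler_pdivrMr//.
  apply: (le_trans (ler_wpM2l d0 mw2)).
  have -> : d * (7 * t) ^+ 2 = s^-1 * (294 * d / k * t ^+ 2) * (k * s / 6).
    by field; rewrite !gt_eqF.
  apply: ler_wpM2l sw; apply: mulr_ge0; first by rewrite invr_ge0 ltW.
  apply: mulr_ge0 (sqr_ge0 _); apply: divr_ge0 (ltW k0).
  exact: mulr_ge0 (ler0n _ _) d0.
move: w_step2.
set lin := - (al + be) - p / 2 + k * ze / rho.
set Q := al ^+ 2 + be ^+ 2 - p ^+ 2 => h2.
pose F := (sg / r) * (t ^+ 2 + 8 * t ^+ 4 / sg ^+ 2).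
have errE : err / s ^+ 2 <= s^-1 * F.
  have -> : s^-1 * F = err / (s * r).
    by rewrite /F /err; field; rewrite !gt_eqF.
  rewrite ler_wpM2l// lef_pV2 ?posrE ?exprn_gt0 ?mulr_gt0//.
  by rewrite expr2 ler_wpM2l// ltW.
have F0 : 0 <= s^-1 * F.
  apply: le_trans errE; exact: divr_ge0 werr0 (sqr_ge0 _).
set C1 := 1 + 172 * (6 / k) ^+ 2.
have C10 : 1 <= C1.
  by rewrite /C1 lerDl; exact: mulr_ge0 (ler0n _ _) (sqr_ge0 _).
have m2 : m - w <= lin + s^-1 * (- Q / 4 + 3 / 2 * k * t ^+ 2) + C1 * (s^-1 * F).
  have : C1 * (err / s ^+ 2) <= C1 * (s^-1 * F) by rewrite ler_wpM2l//; lra.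
  by move: m1 h2; rewrite {1}/C1 mulrDl mul1r; lra.
have d10 : 0 <= 1 + d by lra.
have m3 := ler_wpM2l d10 m2.
have k2 : (1 + d) * (s^-1 * (3 / 2 * k * t ^+ 2)) <= s^-1 * (3 * k * t ^+ 2).
  rewrite mulrCA ler_wpM2l ?invr_ge0 ?(ltW s0)//.
  have : 0 <= k * t ^+ 2 by rewrite mulr_ge0 ?sqr_ge0 ?ltW.
  rewrite -!(mulrA _ k); set X := k * t ^+ 2 => X0; clear -X0 d0 d1; nra.
have k3 : (1 + d) * (C1 * (s^-1 * F)) <= s^-1 * (2 * C1 * F).
  have -> : s^-1 * (2 * C1 * F) = 2 * (C1 * (s^-1 * F)) by ring.
  apply: ler_wpM2r; last by rewrite -[2]/(1 + 1) lerD2l.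
  by apply: mulr_ge0 F0; apply: le_trans C10.
have -> : 2 * C1 * (sg / r) * (t ^+ 2 + 8 * t ^+ 4 / sg ^+ 2) = 2 * C1 * F.
  by rewrite /F [RHS]mulrA.
rewrite -/lin -/Q.
have e3 : (1 + d) * (lin + s^-1 * (- Q / 4 + 3 / 2 * k * t ^+ 2) + C1 * (s^-1 * F)) =
  (1 + d) * lin + s^-1 * (- (1 + d) * Q / 4) + (1 + d) * (s^-1 * (3 / 2 * k * t ^+ 2))
  + (1 + d) * (C1 * (s^-1 * F)) by ring.
have e4 : s^-1 * (- (1 + d) * Q / 4 + (3 * k + 294 * d / k) * t ^+ 2 + 2 * C1 * F) =
  s^-1 * (- (1 + d) * Q / 4) + s^-1 * (3 * k * t ^+ 2) + s^-1 * (294 * d / k * t ^+ 2)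
  + s^-1 * (2 * C1 * F) by rewrite (mulrDl _ _ (t ^+ 2)) !(mulrDr s^-1) !addrA.
rewrite e4; apply: (le_trans (lerD m3 dw)); rewrite e3 -!addrA !lerD2l !addrA.
apply: (le_trans (lerD (lerD k2 k3) (lexx _))).
by rewrite -!addrA lerD2l addrC.
Qed.

(** * The Euclidean inner product *)

Section dotv_theory.
Context {R : realType} {n : nat}.
Implicit Types x y u v : 'rV[R]_n.

Lemma dotvDr u x y : dotv u (x + y) = dotv u x + dotv u y.
Proof. by rewrite /dotv -big_split/=; apply: eq_bigr => i _; rewrite mxE mulrDr. Qed.

Lemma dotvZr u a x : dotv u (a *: x) = a * dotv u x.
Proof. by rewrite /dotv big_distrr/=; apply: eq_bigr => i _; rewrite mxE mulrCA. Qed.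

Lemma dotvC x y : dotv x y = dotv y x.
Proof. by rewrite /dotv; apply: eq_bigr => i _; rewrite mulrC. Qed.

Lemma dotvNr u x : dotv u (- x) = - dotv u x.
Proof. by rewrite -scaleN1r dotvZr mulN1r. Qed.

Lemma dotvBr u x y : dotv u (x - y) = dotv u x - dotv u y.
Proof. by rewrite dotvDr dotvNr. Qed.

Lemma dotvDl u v x : dotv (u + v) x = dotv u x + dotv v x.
Proof. by rewrite !(dotvC _ x) dotvDr. Qed.

Lemma dotvZl a u x : dotv (a *: u) x = a * dotv u x.
Proof. by rewrite !(dotvC _ x) dotvZr. Qed.

Lemma dotvBl u v x : dotv (u - v) x = dotv u x - dotv v x.
Proof. by rewrite !(dotvC _ x) dotvBr. Qed.

Lemma dotv0r u : dotv u 0 = 0.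
Proof. by rewrite -(scale0r 0) dotvZr mul0r. Qed.

Lemma dotv_ge0 x : 0 <= dotv x x.
Proof. by apply: sumr_ge0 => i _; rewrite -expr2 sqr_ge0. Qed.

Lemma dotv_eq0 x : (dotv x x == 0) = (x == 0).
Proof.
apply/eqP/eqP => [h|->]; last by rewrite dotv0r.
apply/rowP => i; rewrite !mxE; apply/eqP.
have := h; rewrite /dotv => /psumr_eq0P => /(_ _ i isT) e.
by rewrite -sqrf_eq0 expr2 e// => j _; rewrite -expr2 sqr_ge0.
Qed.

Lemma dotv_cauchy_schwarz x y : dotv x y ^+ 2 <= dotv x x * dotv y y.
Proof.
have [->|y0] := eqVneq y 0; first by rewrite !dotv0r expr0n mulr0.
have yy : 0 < dotv y y by rewrite lt_neqAle eq_sym dotv_eq0 y0 dotv_ge0.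
have := dotv_ge0 (dotv y y *: x - dotv x y *: y).
rewrite dotvBr !dotvBl !dotvZr !dotvZl (dotvC y x).
set a := dotv x x; set b := dotv x y; set c := dotv y y in yy *.
rewrite [X in 0 <= X](_ : _ = c * (a * c - b ^+ 2)); last by ring.
by rewrite pmulr_rge0// subr_ge0.
Qed.

Lemma dotv_norm x y : `|dotv x y| <= Num.sqrt (dotv x x) * Num.sqrt (dotv y y).
Proof.
rewrite -(ler_pXn2r (ltn0Sn 1)) ?nnegrE ?mulr_ge0 ?sqrtr_ge0//.
rewrite real_normK ?num_real// exprMn !sqr_sqrtr ?dotv_ge0//.
exact: dotv_cauchy_schwarz.
Qed.

Lemma dotv_norm_le x y (c : R) : 0 <= c -> dotv x x <= c ^+ 2 ->
  `|dotv x y| <= c * Num.sqrt (dotv y y).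
Proof.
move=> c0 xc; apply: (le_trans (dotv_norm x y)); apply: ler_wpM2r; first exact: sqrtr_ge0.
by rewrite -[leRHS](ger0_norm c0) -sqrtr_sqr ler_wsqrtr.
Qed.

(** Cauchy-Schwarz against the all-ones vector; it reduces |g|^4 to fourth moments of single
    coordinates. *)
Lemma sqr_dotv_le_quartic x : dotv x x ^+ 2 <= n%:R * \sum_i x ord0 i ^+ 4.
Proof.
pose one : 'rV[R]_n := const_mx 1.
pose xx : 'rV[R]_n := \row_i x ord0 i ^+ 2.
have := dotv_cauchy_schwarz one xx.
have -> : dotv one xx = dotv x x.
  by apply: eq_bigr => i _; rewrite !mxE mul1r expr2.
have -> : dotv one one = n%:R.
  rewrite /dotv (eq_bigr (fun=> 1)) ?sumr_const ?card_ord// => i _.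
  by rewrite !mxE mulr1.
suff -> : dotv xx xx = \sum_i x ord0 i ^+ 4 by [].
by apply: eq_bigr => i _; rewrite !mxE -exprD.
Qed.

End dotv_theory.

(** * The Lyapunov function of the wedge and its drift *)

Section lyapunov_function.
Context {R : realType} {n : nat}.
Implicit Types y g u v : 'rV[R]_n.

(* Where u.y <= 0 and v.y <= 0, lyap is, up to smoothing at scale r, the power 1 + d of
   -(u.y + v.y) - |(u.y, v.y)| / 2 + k |y|.  The concave middle term has a Laplacian of
   order -1 / s, which pays for the power and for k |y|; the latter, together with the
   weight 52 / k of r, keeps the base positive near the wedge. *)
Definition lyap_s u v (r : R) y := Num.sqrt (dotv u y ^+ 2 + dotv v y ^+ 2 + r ^+ 2).
Definition lyap_rho (k r : R) y := Num.sqrt (dotv y y + (52 / k * r) ^+ 2).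
Definition lyap_w u v (k r : R) y :=
  - (dotv u y + dotv v y) - lyap_s u v r y / 2 + k * lyap_rho k r y.
Definition lyap u v (k d r : R) y := Num.max (lyap_w u v k r y) 0 `^ (1 + d).

(** The wedge opened by an angle, which absorbs the change to rational directions, and shifted,
    which absorbs the distance from the path to its grid value. *)
Definition near_wedge u v (eta h : R) y :=
  dotv u y <= eta * Num.sqrt (dotv y y) + h /\
  dotv v y <= eta * Num.sqrt (dotv y y) + h.

Lemma lyap_s_sqr u v r y :
  lyap_s u v r y ^+ 2 = dotv u y ^+ 2 + dotv v y ^+ 2 + r ^+ 2.
Proof. by rewrite sqr_sqrtr// !addr_ge0 ?sqr_ge0. Qed.

Lemma lyap_rho_sqr k r y : lyap_rho k r y ^+ 2 = dotv y y + (52 / k * r) ^+ 2.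
Proof. by rewrite sqr_sqrtr// addr_ge0 ?sqr_ge0 ?dotv_ge0. Qed.

Lemma lyap_s_ge u v r y : 0 <= r -> r <= lyap_s u v r y.
Proof.
move=> r0; rewrite -(ler_pXn2r (ltn0Sn 1)) ?nnegrE ?sqrtr_ge0// lyap_s_sqr.
by rewrite lerDr addr_ge0 ?sqr_ge0.
Qed.

Lemma lyap_rho_ge_norm k r y : Num.sqrt (dotv y y) <= lyap_rho k r y.
Proof. by rewrite ler_wsqrtr// lerDl sqr_ge0. Qed.

Lemma lyap_rho_ge k r y : 0 < k -> 0 <= r -> 52 / k * r <= lyap_rho k r y.
Proof.
move=> k0 r0; rewrite -(ler_pXn2r (ltn0Sn 1)) ?nnegrE ?sqrtr_ge0//.
  by rewrite lyap_rho_sqr lerDr dotv_ge0.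
by apply: mulr_ge0 => //; apply: divr_ge0 => //; exact: ltW.
Qed.

Lemma lyap_ge0 u v k d r y : 0 <= lyap u v k d r y.
Proof. exact: powR_ge0. Qed.

Lemma lyap0_le u v k d r : 0 < k -> 0 <= d -> 0 <= r ->
  lyap u v k d r 0 <= (52 * r) `^ (1 + d).
Proof.
move=> k0 d0 r0; apply: ge0_ler_powR; rewrite ?nnegrE ?le_max ?lexx ?orbT//.
- lra.
- exact: mulr_ge0.
rewrite ge_max mulr_ge0// andbT /lyap_w /lyap_rho !dotv0r !add0r oppr0 add0r sqrtr_sqr.
have -> : k * `|52 / k * r| = 52 * r.
  rewrite ger0_norm; first by field; rewrite gt_eqF.
  by apply: mulr_ge0 => //; apply: divr_ge0 => //; exact: ltW.
by rewrite gerDr oppr_le0 divr_ge0// sqrtr_ge0.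
Qed.

Variables (u v : 'rV[R]_n).
Hypotheses (u2 : dotv u u <= 2 ^+ 2) (v2 : dotv v v <= 2 ^+ 2).

Lemma lyap_s_le_rho k r y : 0 < k -> k <= 1 -> 0 <= r ->
  lyap_s u v r y <= 3 * lyap_rho k r y.
Proof.
move=> k0 k1 r0.
rewrite -(ler_pXn2r (ltn0Sn 1)) ?nnegrE ?mulr_ge0 ?sqrtr_ge0//.
rewrite exprMn lyap_s_sqr lyap_rho_sqr.
have := sqr_le_of_norm (dotv_norm_le y (ler0n _ _) u2).
have := sqr_le_of_norm (dotv_norm_le y (ler0n _ _) v2).
rewrite exprMn sqr_sqrtr ?dotv_ge0//.
have : r ^+ 2 <= (52 / k * r) ^+ 2.
  rewrite ler_pXn2r ?nnegrE//; last first.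
    by apply: mulr_ge0 => //; apply: divr_ge0 => //; exact: ltW.
  by rewrite ler_peMl// ler_pdivlMr//; apply: (le_trans (y := 1)); rewrite ?mul1r ?ler1n.
have := dotv_ge0 y; have := sqr_ge0 r; lra.
Qed.

(** If h bounds u.y and v.y, then s <= -(u.y + v.y) + 4h + r, whence w >= k rho - 4h - r. With h <=
    k rho / 16 + 3r this is at least (3/4) k rho - 13 r, and rho >= (52 / k) r with 52 = 4 * 13
    leaves k rho / 2. *)
Lemma lyap_w_ge k r y : 0 < k -> k <= 1 -> 0 <= r ->
  near_wedge u v (k / 16) (3 * r) y -> k * lyap_rho k r y / 2 <= lyap_w u v k r y.
Proof.
move=> k0 k1 r0 [hu hv].
have rhoN := lyap_rho_ge_norm k r y.
have rhor : r <= k * lyap_rho k r y / 52.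
  rewrite ler_pdivlMr// -ler_pdivrMl//.
  by rewrite (_ : k^-1 * (r * 52) = 52 / k * r) ?lyap_rho_ge//; ring.
set h := k / 16 * Num.sqrt (dotv y y) + 3 * r in hu hv.
have N0 : 0 <= Num.sqrt (dotv y y) by exact: sqrtr_ge0.
have h0 : 0 <= h.
  by apply: addr_ge0; apply: mulr_ge0 => //; apply: divr_ge0 => //; exact: ltW.
have hle : h <= k * lyap_rho k r y / 16 + 3 * r.
  rewrite lerD2r mulrAC ler_pM2r ?invr_gt0//.
  by rewrite ler_pM2l.
have sle : lyap_s u v r y <= - (dotv u y + dotv v y) + 4 * h + r.
  have au : `|dotv u y| <= - dotv u y + 2 * h by rewrite ler_norml; lra.
  have av : `|dotv v y| <= - dotv v y + 2 * h by rewrite ler_norml; lra.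
  apply: (@le_trans _ _ (`|dotv u y| + `|dotv v y| + r)); last lra.
  rewrite -(ler_pXn2r (ltn0Sn 1)) ?nnegrE ?sqrtr_ge0 ?addr_ge0//.
  rewrite lyap_s_sqr.
  rewrite -(real_normK (num_real (dotv u y))) -(real_normK (num_real (dotv v y))).
  have := normr_ge0 (dotv u y); have := normr_ge0 (dotv v y).
  move: `|dotv u y| `|dotv v y| => A B A0 B0.
  have := mulr_ge0 A0 B0; have := mulr_ge0 A0 r0; have := mulr_ge0 B0 r0; nra.
have s0 : 0 <= lyap_s u v r y by exact: sqrtr_ge0.
rewrite /lyap_w; lra.
Qed.

Section coefficients.
Variables (k d r sg : R) (y : 'rV[R]_n).
Let s := lyap_s u v r y.
Let w := lyap_w u v k r y.
Let C := 1 + 172 * (6 / k) ^+ 2.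

(** Gradient of [lyap_s]. Accordingly [lyap_lin] is the gradient of [lyap] where its base is
    positive; [lyap_quad] holds the concave second-order part together with the quadratic error
    terms, and [lyap_quartic] the remaining error. *)
Definition lyap_p (i : 'I_n) := (dotv u y * u ord0 i + dotv v y * v ord0 i) / s.

Definition lyap_lin (i : 'I_n) := w `^ d *
  ((1 + d) * (- (u ord0 i + v ord0 i) - lyap_p i / 2 + k * y ord0 i / lyap_rho k r y)).

Definition lyap_quad (i j : 'I_n) := w `^ d * (s^-1 *
  (- (1 + d) * (u ord0 i * u ord0 j + v ord0 i * v ord0 j - lyap_p i * lyap_p j) / 4
  + (3 * k + 294 * d / k + 2 * C * (sg / r)) * (i == j)%:R)).

Definition lyap_quartic := w `^ d * (s^-1 *
  (2 * C * (sg / r) * (8 * n%:R / sg ^+ 2))).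

End coefficients.

(** The coefficients depend on [y] only, so once [g] is independent of [y] the expectation can be
    taken term by term. *)
Lemma lyap_increment k d r sg y g :
  0 < k -> 0 <= d <= 1 -> k <= 1 -> 0 < sg -> 0 < r ->
  near_wedge u v (k / 16) (3 * r) y ->
  lyap u v k d r (y + g) <= lyap u v k d r y
  + \sum_i lyap_lin k d r y i * g ord0 i
  + \sum_i \sum_j lyap_quad k d r sg y i j * (g ord0 i * g ord0 j)
  + \sum_i lyap_quartic k d r sg y * g ord0 i ^+ 4.
Proof.
move=> k0 d01 k1 sg0 r0 yD.
have r0' := ltW r0.
pose s := lyap_s u v r y; pose s' := lyap_s u v r (y + g).
pose rho := lyap_rho k r y; pose rho' := lyap_rho k r (y + g).
have rs : r <= s by exact: lyap_s_ge.
have s0 : 0 < s by exact: lt_le_trans rs.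
have srho : s <= 3 * rho by exact: lyap_s_le_rho.
have sw : k * s / 6 <= lyap_w u v k r y.
  apply: le_trans (lyap_w_ge k0 k1 r0' yD).
  have : k * s <= k * (3 * rho) by rewrite ler_pM2l.
  rewrite -/rho; lra.
have w0 : 0 < lyap_w u v k r y.
  by apply: lt_le_trans sw; apply: divr_gt0 => //; exact: mulr_gt0.
pose t := Num.sqrt (dotv g g).
have t0 : 0 <= t by exact: sqrtr_ge0.
have t2 : t ^+ 2 = dotv g g by rewrite sqr_sqrtr ?dotv_ge0.
have ug := dotv_norm_le g (ler0n _ _) u2; have vg := dotv_norm_le g (ler0n _ _) v2.
have yg : `|dotv y g| <= rho * t.
  apply: (le_trans (dotv_norm y g)).
  by apply: ler_wpM2r => //; exact: lyap_rho_ge_norm.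
have ab2 : dotv u y ^+ 2 + dotv v y ^+ 2 <= s ^+ 2.
  by rewrite lyap_s_sqr lerDl sqr_ge0.
have s'E : s' ^+ 2 = s ^+ 2 + 2 * (dotv u y * dotv u g + dotv v y * dotv v g) +
    (dotv u g ^+ 2 + dotv v g ^+ 2).
  by rewrite !lyap_s_sqr !dotvDr; ring.
have rho'E : rho' ^+ 2 = rho ^+ 2 + 2 * dotv y g + t ^+ 2.
  by rewrite !lyap_rho_sqr t2 dotvDr !dotvDl (dotvC g y); ring.
have s'0 : 0 <= s' by exact: sqrtr_ge0.
have rho'0 : 0 <= rho' by exact: sqrtr_ge0.
have := lyapunov_step k0 d01 k1 sg0 r0 t0 rs s'0 rho'0 srho sw ug vg yg ab2 s'E rho'E.
have -> : lyap_w u v k r y - (dotv u g + dotv v g) - (s' - s) / 2 + k * (rho' - rho)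
  = lyap_w u v k r (y + g).
  by rewrite /lyap_w !dotvDr -/s -/s' -/rho -/rho'; ring.
have -> : lyap_w u v k r y `^ (1 + d) = lyap u v k d r y.
  by rewrite /lyap max_l// ltW.
move=> /le_trans; apply; rewrite -!addrA lerD2l !addrA.
set W := lyap_w u v k r y `^ d.
have W0 : 0 <= W by exact: powR_ge0.
set C := 1 + 172 * (6 / k) ^+ 2.
have C0 : 0 <= C by apply: addr_ge0 => //; exact: mulr_ge0 (ler0n _ _) (sqr_ge0 _).
have pE : (dotv u y * dotv u g + dotv v y * dotv v g) / s =
    \sum_i lyap_p r y i * g ord0 i.
  rewrite /dotv !big_distrr -big_split big_distrl/=; apply: eq_bigr => i _.
  by rewrite /lyap_p -/(dotv u y) -/(dotv v y) -/s; ring.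
set p := _ / s in pE *.
have linE : \sum_i lyap_lin k d r y i * g ord0 i =
    W * ((1 + d) * (- (dotv u g + dotv v g) - p / 2 + k * dotv y g / rho)).
  rewrite pE /dotv -big_split/= -sumrN big_distrl/= -sumrN -big_split/=.
  rewrite big_distrr big_distrl/= -big_split/= big_distrr/= big_distrr/=.
  by apply: eq_bigr => i _; rewrite /lyap_lin -/W -/rho; ring.
have quadE : \sum_i \sum_j lyap_quad k d r sg y i j * (g ord0 i * g ord0 j) =
   W * (s^-1 * (- (1 + d) * (dotv u g ^+ 2 + dotv v g ^+ 2 - p ^+ 2) / 4
     + (3 * k + 294 * d / k + 2 * C * (sg / r)) * t ^+ 2)).
  have dE (f : 'I_n -> R) : (\sum_i f i) ^+ 2 = \sum_i \sum_j f i * f j.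
    by rewrite expr2 big_distrlr.
  rewrite t2 pE {1 2}/dotv !dE -big_split/= -sumrB.
  rewrite big_distrr big_distrl/= /dotv big_distrr/= -big_split/=.
  rewrite big_distrr big_distrr/=; apply: eq_bigr => i _.
  rewrite -big_split/= -sumrB big_distrr big_distrl/=.
  transitivity (W * (s^-1 * (\sum_(j < n) (- (1 + d) * (u ord0 i * g ord0 i *
    (u ord0 j * g ord0 j) + v ord0 i * g ord0 i * (v ord0 j * g ord0 j) -
    lyap_p r y i * g ord0 i * (lyap_p r y j * g ord0 j)) / 4 +
    (3 * k + 294 * d / k + 2 * C * (sg / r)) * ((i == j)%:R * (g ord0 i * g ord0 j)))))).
    rewrite big_distrr big_distrr/=; apply: eq_bigr => j _.
    by rewrite /lyap_quad -/W -/s -/C; ring.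
  congr (_ * (_ * _)); rewrite big_split/= -big_distrr/=; congr (_ + _ * _).
  rewrite (bigD1 i)//= eqxx mul1r big1 ?addr0// => j ji.
  by rewrite eq_sym (negbTE ji) mul0r.
have quartE : W * (s^-1 * (2 * C * (sg / r) * (8 * t ^+ 4 / sg ^+ 2))) <=
    \sum_i lyap_quartic k d r sg y * g ord0 i ^+ 4.
  rewrite -big_distrr/= /lyap_quartic -/W -/s -/C -!mulrA.
  have sq0 : 0 <= s^-1 by rewrite invr_ge0 ltW.
  do 2 apply: ler_wpM2l => //; apply: ler_wpM2l => //; apply: ler_wpM2l => //.
  apply: ler_wpM2l; first exact: ltW.
  apply: ler_wpM2l; first by rewrite invr_ge0.
  apply: ler_wpM2l => //.
  have -> : t * (t * (t * (t / sg ^+ 2))) = sg ^- 2 * t ^+ 4 by ring.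
  rewrite [leRHS]mulrCA; apply: ler_wpM2l.
    by rewrite invr_ge0 sqr_ge0.
  have -> : t ^+ 4 = dotv g g ^+ 2 by rewrite -t2 -exprM.
  exact: sqr_dotv_le_quartic.
rewrite linE quadE; apply: le_trans (lerD (lexx _) quartE).
rewrite le_eqVlt; apply/orP; left; apply/eqP.
have regroup (W' L si A1 B C2 t2' E : R) : W' * (L + si * (A1 + B * t2' + C2 * (t2' + E))) =
  W' * L + W' * (si * (A1 + (B + C2) * t2')) + W' * (si * (C2 * E)) by ring.
exact: regroup.
Qed.

(** The left side is at most the largest eigenvalue of the Gram matrix of [u] and [v], that is, its
    trace minus its least eigenvalue, and diagonal dominance bounds the latter below by [c0]. This
    is where the independence of the two directions becomes strict concavity. *)
Lemma lyap_p_sqr_le c0 r y : 0 < r ->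
  c0 <= dotv u u - `|dotv u v| -> c0 <= dotv v v - `|dotv u v| ->
  \sum_i lyap_p r y i * lyap_p r y i <= dotv u u + dotv v v - c0.
Proof.
move=> r0 cu cv.
set a := dotv u y; set b := dotv v y; set s := lyap_s u v r y.
have s0 : 0 < s by apply: (lt_le_trans r0); exact: lyap_s_ge (ltW r0).
have -> : \sum_i lyap_p r y i * lyap_p r y i =
    (a ^+ 2 * dotv u u + b ^+ 2 * dotv v v + 2 * a * b * dotv u v) / s ^+ 2.
  have key (x z : R) : \sum_i (x * u ord0 i + z * v ord0 i) / s *
      ((x * u ord0 i + z * v ord0 i) / s) =
      (x ^+ 2 * dotv u u + z ^+ 2 * dotv v v + 2 * x * z * dotv u v) / s ^+ 2.
    rewrite /dotv !big_distrr -!big_split big_distrl/=; apply: eq_bigr => i _.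
    by field; rewrite gt_eqF.
  exact: key.
rewrite ler_pdivrMr ?exprn_gt0//.
have uu := dotv_ge0 u; have vv := dotv_ge0 v.
have ab : 2 * a * b * dotv u v <= (a ^+ 2 + b ^+ 2) * `|dotv u v|.
  apply: (le_trans (ler_norm _)); rewrite normrM; apply: ler_wpM2r => //.
  rewrite ler_norml; have := sqr_ge0 (a + b); have := sqr_ge0 (a - b).
  by move=> h1 h2; apply/andP; split; nra.
have s2 : a ^+ 2 + b ^+ 2 <= s ^+ 2 by rewrite lyap_s_sqr lerDl sqr_ge0.
have g0 := normr_ge0 (dotv u v).
have h : 0 <= dotv u u + dotv v v - c0 by lra.
apply: le_trans (ler_wpM2l h s2).
have := sqr_ge0 a; have := sqr_ge0 b; move: ab cu cv.
move: (dotv u u) (dotv v v) `|dotv u v| (2 * a * b * dotv u v) => U V G X.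
by rewrite !mulrDl; move: (a ^+ 2) (b ^+ 2) => A B; nra.
Qed.

(** For a step with independent centred coordinates of variance [vr] and fourth moment [m4], only
    the diagonal of the quadratic part survives in the mean. Of the concavity gain [c0 / 4], one
    [c0 / 16] pays for [k] and [d], another for the third- and fourth-order errors; [c0 / 8] is
    left. *)
Lemma lyap_trace_le c0 k d r sg y vr m4 K4 (N : R) (C := 1 + 172 * (6 / k) ^+ 2) :
  0 < k -> 0 <= d <= 1 -> 0 < sg -> 0 < r -> 0 <= c0 ->
  c0 <= dotv u u - `|dotv u v| -> c0 <= dotv v v - `|dotv u v| ->
  N = n%:R -> N * (3 * k + 294 * d / k) <= c0 / 16 ->
  C * (sg / r) * (2 * N + 128 * N ^+ 2 * K4) <= c0 / 16 ->
  0 <= m4 -> m4 <= K4 * sg ^+ 4 -> sg ^+ 2 <= 8 * vr ->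
  vr * (\sum_i lyap_quad k d r sg y i i) + N * (lyap_quartic k d r sg y * m4) <=
  - (c0 / 8 * vr * (lyap_w u v k r y `^ d / lyap_s u v r y)).
Proof.
move=> k0 d01 sg0 r0 c00 cu cv NE h1 h2 m40 m4le sgle.
have ple := lyap_p_sqr_le y r0 cu cv.
set s := lyap_s u v r y; set W := _ `^ d.
have W0 : 0 <= W by exact: powR_ge0.
have s0 : 0 < s by apply: (lt_le_trans r0); exact: lyap_s_ge (ltW r0).
have sg20 : 0 < sg ^+ 2 by exact: exprn_gt0.
have vr0 : 0 <= vr by lra.
have C0 : 0 <= C by apply: addr_ge0 => //; exact: mulr_ge0 (ler0n _ _) (sqr_ge0 _).
have N0 : 0 <= N by rewrite NE.
have e1 : \sum_i lyap_quad k d r sg y i i = W * (s^-1 *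
  (- (1 + d) * (dotv u u + dotv v v - \sum_i lyap_p r y i * lyap_p r y i) / 4
  + N * (3 * k + 294 * d / k + 2 * C * (sg / r)))).
  rewrite {1 2}/dotv -big_split/= -sumrB big_distrr big_distrl/=.
  have -> : N * (3 * k + 294 * d / k + 2 * C * (sg / r)) =
    \sum_(i < n) (3 * k + 294 * d / k + 2 * C * (sg / r)).
    by rewrite sumr_const card_ord NE mulr_natl.
  rewrite -big_split/= !big_distrr/=; apply: eq_bigr => i _.
  by rewrite /lyap_quad eqxx mulr1.
set P := \sum_i _ in ple e1.
rewrite e1 /lyap_quartic -/W -/s -/C -NE.
set F := sg / r in h2 *.
have F0 : 0 <= F by apply: divr_ge0; exact: ltW.
have q1 : m4 / sg ^+ 2 <= 8 * K4 * vr.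
  rewrite ler_pdivrMr//; apply: (le_trans m4le).
  have -> : K4 * sg ^+ 4 = K4 * sg ^+ 2 * sg ^+ 2 by ring.
  apply: ler_wpM2r; first exact: ltW.
  have K40 : 0 <= K4.
    have : 0 <= K4 * sg ^+ 4 by exact: le_trans m4le.
    by rewrite pmulr_lge0// exprn_gt0.
  have -> : 8 * K4 * vr = K4 * (8 * vr) by ring.
  exact: ler_wpM2l.
have d0 : 0 <= d by case/andP: d01.
have -> : vr * (W * (s^-1 * (- (1 + d) * (dotv u u + dotv v v - P) / 4
    + N * (3 * k + 294 * d / k + 2 * C * F)))) +
  N * (W * (s^-1 * (2 * C * F * (8 * N / sg ^+ 2))) * m4) =
  (W / s) * (vr * (- (1 + d) * (dotv u u + dotv v v - P) / 4) +
    vr * (N * (3 * k + 294 * d / k)) + (C * F) * (2 * N * vr + 16 * N ^+ 2 * (m4 / sg ^+ 2))).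
  by ring.
have -> : - (c0 / 8 * vr * (W / s)) = (W / s) * (- (c0 / 8 * vr)) by ring.
apply: ler_wpM2l; first by apply: divr_ge0 => //; exact: ltW.
have a1 : vr * (- (1 + d) * (dotv u u + dotv v v - P) / 4) <= vr * (- (c0 / 4)).
  apply: ler_wpM2l => //.
  have hp : c0 <= dotv u u + dotv v v - P by lra.
  have : (1 + d) * (dotv u u + dotv v v - P) >= c0.
    apply: (le_trans hp); rewrite ler_peMl; lra.
  lra.
have a2 := ler_wpM2l vr0 h1.
have a3 : C * F * (2 * N * vr + 16 * N ^+ 2 * (m4 / sg ^+ 2)) <= vr * (c0 / 16).
  apply: le_trans (ler_wpM2l vr0 h2).
  have -> : vr * (C * F * (2 * N + 128 * N ^+ 2 * K4)) =
    C * F * (2 * N * vr + 16 * N ^+ 2 * (8 * K4 * vr)) by ring.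
  apply: ler_wpM2l; first exact: mulr_ge0.
  apply: lerD => //; apply: ler_wpM2l => //.
  exact: mulr_ge0 (ler0n _ _) (sqr_ge0 _).
lra.
Qed.

(** Makes the drift uniform. Since w >= k s / 6, either k s / 6 >= 1, so that w^d >= 1 and 1/s >=
    1/S, or (k s / 6)^d >= k s / 6, so that the quotient is at least k / 6. *)
Lemma lyap_ratio_ge k d r S y : 0 < k -> k <= 1 -> 0 <= d <= 1 -> 0 < r ->
  near_wedge u v (k / 16) (3 * r) y -> lyap_s u v r y <= S ->
  Num.min (k / 6) S^-1 <= lyap_w u v k r y `^ d / lyap_s u v r y.
Proof.
move=> k0 k1 /andP[d0 d1] r0 yD sS.
set s := lyap_s u v r y in sS *.
have s0 : 0 < s by apply: (lt_le_trans r0); exact: lyap_s_ge (ltW r0).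
have S0 : 0 < S by exact: lt_le_trans sS.
have sw : k * s / 6 <= lyap_w u v k r y.
  apply: le_trans (lyap_w_ge k0 k1 (ltW r0) yD).
  have : k * s <= k * (3 * lyap_rho k r y).
    by rewrite ler_pM2l//; apply: lyap_s_le_rho => //; exact: ltW.
  lra.
set w := lyap_w u v k r y in sw *.
have x0 : 0 < k * s / 6 by apply: divr_gt0 => //; exact: mulr_gt0.
rewrite ler_pdivlMr//.
have h : (k * s / 6) `^ d <= w `^ d.
  by apply: ge0_ler_powR; rewrite ?nnegrE//; [exact: ltW|exact: le_trans (ltW x0) _].
apply: le_trans h.
have [x1|x1] := leP 1 (k * s / 6).
  apply: (@le_trans _ _ 1).
    apply: (@le_trans _ _ (S^-1 * s)).
      by apply: ler_wpM2r; [exact: ltW|rewrite ge_min lexx orbT].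
    by rewrite mulrC ler_pdivrMr// mul1r.
  by have := ler_powR x1 d0; rewrite powRr0.
apply: (@le_trans _ _ (k * s / 6)).
  rewrite mulrAC; apply: ler_wpM2r; [exact: ltW|by rewrite ge_min lexx].
by apply: ger1_powR => //; rewrite x0 ltW.
Qed.

End lyapunov_function.

(** * Independence of sigma-algebras and expectations of products *)

Section independence.
Context {R : realType} {d} {T : measurableType d} (P : probability T R).

(** The measurable sets that satisfy the product formula against [F] form a Dynkin system. *)
Lemma indep_dynkin (G : set (set T)) (F : set T) :
  setI_closed G -> G `<=` measurable -> measurable F ->
  (forall E, G E -> P (E `&` F) = (P E * P F)%E) ->
  forall E, <<s G >> E -> P (E `&` F) = (P E * P F)%E.
Proof.
move=> GI Gm mF GF E; rewrite -setI_closed_g_dynkin_g_sigma_algebra//.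
suff H : <<d G >> `<=` [set E | measurable E /\ P (E `&` F) = (P E * P F)%E].
  by move=> /H[].
have finP A : measurable A -> P A \is a fin_num by exact: fin_num_measure.
apply: smallest_sub; last by move=> A GA; split; [exact: Gm|exact: GF].
split=> /=.
- by split=> //; rewrite setTI probability_setT mul1e.
- move=> A [mA AF]; split; first exact: measurableC.
  rewrite probability_setC// muleBl ?finP//.
  by rewrite mul1e -AF setIC -setDE measureD// 1?setIC// ltey_eq finP.
- move=> A tA mA; split; first by apply: bigcup_measurable => k _; exact: (mA k).1.
  rewrite setI_bigcupl measure_bigcup//=; last 2 first.
    + by move=> i _; apply: measurableI => //; exact: (mA i).1.
    + exact: trivIset_setIr.
  rewrite measure_bigcup//=; last by move=> i _; exact: (mA i).1.
  under eq_eseriesr do rewrite (mA _).2 muleC.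
  by rewrite -(fineK (finP F mF)) nneseriesZl// muleC.
Qed.

Lemma indep_g_sigma (G1 G2 : set (set T)) :
  setI_closed G1 -> setI_closed G2 -> G1 `<=` measurable -> G2 `<=` measurable ->
  (forall E F, G1 E -> G2 F -> P (E `&` F) = (P E * P F)%E) ->
  forall E F, <<s G1 >> E -> <<s G2 >> F -> P (E `&` F) = (P E * P F)%E.
Proof.
move=> G1I G2I G1m G2m G12 E F sE sF.
have mE : measurable E.
  by move: sE; apply: smallest_sub => //; exact: sigma_algebra_measurable.
rewrite setIC muleC; apply: (indep_dynkin G2I) sF => // {}F G2F.
rewrite setIC muleC; apply: (indep_dynkin G1I) sE => //; first exact: G2m.
by move=> E' G1E; exact: G12.
Qed.

Section families.
Context {I : finType} (X : I -> T -> R) (mu : I -> set R -> \bar R).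
Hypothesis muT : forall i, mu i setT = 1%E.
Hypothesis mX : forall i, measurable_fun setT (X i).
Hypothesis XE : forall A : I -> set R, (forall i, measurable (A i)) ->
  P [set w | forall i, A i (X i w)] = (\prod_i mu i (A i))%E.

(** A pi-system generating the sigma-algebra of the variables [X i] with [i] in [J]. *)
Definition cylinders (J : pred I) : set (set T) :=
  [set E | exists2 A : I -> set R, (forall i, measurable (A i)) &
    E = [set w | forall i, J i -> A i (X i w)]].

Lemma setI_closed_cylinders J : setI_closed (cylinders J).
Proof.
move=> _ _ [A mA ->] [B mB ->]; exists (fun i => A i `&` B i).
  by move=> i; exact: measurableI.
apply/seteqP; split=> w /=.
  by move=> [wA wB] i Ji; split; [exact: wA|exact: wB].
by move=> h; split=> i Ji; have [] := h i Ji.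
Qed.

Lemma cylinders_measurable J : cylinders J `<=` measurable.
Proof.
move=> _ [A mA ->].
rewrite (_ : [set w | _] = \bigcap_(i in [set i | J i]) (X i @^-1` A i)); last first.
  by apply/seteqP; split=> w /=.
apply: fin_bigcap_measurable; first exact: finite_finset.
by move=> i _; rewrite -[X in measurable X]setTI; exact: mX.
Qed.

Lemma cylinderE (J : pred I) (A : I -> set R) : (forall i, measurable (A i)) ->
  P [set w | forall i, J i -> A i (X i w)] = (\prod_(i | J i) mu i (A i))%E.
Proof.
move=> mA; pose A' i := if J i then A i else setT.
rewrite (_ : [set w | _] = [set w | forall i, A' i (X i w)]); last first.
  apply/seteqP; split=> w /= h i; last by move=> Ji; have := h i; rewrite /A' Ji.
  by rewrite /A'; case: ifPn => // /h.
rewrite XE; last by move=> i; rewrite /A'; case: ifP.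
rewrite big_mkcond [RHS]big_mkcond/=; apply: eq_bigr => i _.
by rewrite /A'; case: ifP => // _; rewrite muT.
Qed.

Lemma indep_cylinders (J1 J2 : pred I) : (forall i, J1 i -> ~~ J2 i) ->
  forall E F, <<s cylinders J1 >> E -> <<s cylinders J2 >> F ->
  P (E `&` F) = (P E * P F)%E.
Proof.
move=> J12; apply: indep_g_sigma; try exact: setI_closed_cylinders;
  try exact: cylinders_measurable.
move=> _ _ [A mA ->] [B mB ->].
pose C i := if J1 i then A i else B i.
rewrite (_ : _ `&` _ = [set w | forall i, J1 i || J2 i -> C i (X i w)]); last first.
  apply/seteqP; split=> w /=.
    move=> [hA hB] i; rewrite /C; case: ifPn => [/hA//|_ /= /hB//].
  move=> h; split=> i Ji.
    by have := h i; rewrite /C Ji => /(_ isT).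
  have := h i; rewrite /C Ji orbT; case: ifPn => [/J12|_ /(_ isT)//].
  by rewrite Ji.
rewrite !cylinderE//; last by move=> i; rewrite /C; case: ifP.
rewrite (bigID J1)/=; congr (_ * _)%E.
  apply: eq_big => [i|i /andP[_ J1i]]; first by case: (J1 i); rewrite ?andbF.
  by rewrite /C J1i.
apply: eq_big => [i|i /andP[_ J1i]]; last by rewrite /C (negbTE J1i).
by have := J12 i; case: (J1 i) => //=; rewrite ?andbT ?andbF// => /(_ isT)/negbTE.
Qed.

Lemma sub_cylinders (J1 J2 : pred I) : {subset J1 <= J2} ->
  <<s cylinders J1 >> `<=` <<s cylinders J2 >>.
Proof.
move=> J12; apply: smallest_sub; first exact: smallest_sigma_algebra.
move=> _ [A mA ->]; apply: sub_sigma_algebra.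
exists (fun i => if J1 i then A i else setT); first by move=> i; case: ifP.
apply/seteqP; split=> w /= h i Ji; first by case: ifPn => // /h.
by have := h i (J12 _ Ji); rewrite Ji.
Qed.

Lemma measurable_cylinder_coord (J : pred I) i : J i ->
  measurable_fun setT (X i : g_sigma_algebraType (cylinders J) -> R).
Proof.
move=> Ji _ B mB; apply: sub_sigma_algebra; rewrite setTI.
exists (fun j => if j == i then B else setT); first by move=> j; case: ifP.
apply/seteqP; split=> w /=.
  by move=> wB j _; case: eqP => // ->.
by move=> /(_ i Ji); rewrite eqxx.
Qed.

Lemma g_sigma_cylinders_measurable J : <<s cylinders J >> `<=` measurable.
Proof.
move=> E; apply: smallest_sub; first exact: sigma_algebra_measurable.
exact: cylinders_measurable.
Qed.

Lemma measurable_fun_cylinders (J : pred I) (f : T -> R) :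
  measurable_fun setT (f : g_sigma_algebraType (cylinders J) -> R) ->
  measurable_fun setT f.
Proof.
move=> mf _ B mB; apply: (@g_sigma_cylinders_measurable J).
exact: (mf measurableT B mB).
Qed.

End families.

Section expectation_product.
Variables (f h : {RV P >-> R}).
Hypothesis fh : forall A B, measurable A -> measurable B ->
  P (f @^-1` A `&` h @^-1` B) = (P (f @^-1` A) * P (h @^-1` B))%E.
Hypothesis intf : P.-integrable setT (EFin \o f).
Hypothesis inth : P.-integrable setT (EFin \o h).

Let m1 : probability R R := distribution P f.
Let m2 : probability R R := distribution P h.
Let pair w := (f w, h w).

Let mpair : measurable_fun setT pair.
Proof. exact: measurable_fun_pair. Qed.

HB.instance Definition _ := isMeasurableFun.Build _ _ T (R * R)%type pair mpair.

(** Rectangles factor by [fh], so uniqueness of the product measure identifies the law of the pair;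
    Fubini then factors the mean of the product. *)
Let jointE A : measurable A -> (m1 \x m2)%E A = distribution P pair A.
Proof. by move=> mA; apply: product_measure_unique. Qed.

Let F : R * R -> R := fun z => z.1 * z.2.

Let mF : measurable_fun setT F.
Proof. exact: measurable_funM. Qed.

Let abs_lty (g : {RV P >-> R}) : P.-integrable setT (EFin \o g) ->
  (\int[distribution P g]_x `|x|%:E < +oo)%E.
Proof.
move=> /integrableP[_ ig]; rewrite ge0_integral_distribution//.
by apply/measurable_EFinP; exact: normr_measurable.
Qed.

Let int_id (g : {RV P >-> R}) : P.-integrable setT (EFin \o g) ->
  (distribution P g).-integrable setT (EFin : R -> \bar R).
Proof.
move=> /abs_lty ig; apply/integrableP; split; first exact/measurable_EFinP.
by move: ig; under eq_integral do rewrite -abse_EFin.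
Qed.

Let int_F : (m1 \x m2)%E.-integrable setT (EFin \o F).
Proof.
apply/integrable12ltyP; first exact/measurable_EFinP.
have eqx x : (\int[m2]_y `|(EFin \o F) (x, y)| = `|x|%:E * \int[m2]_y `|y|%:E)%E.
  rewrite -ge0_integralZl//; last first.
    by apply/measurable_EFinP; exact: normr_measurable.
  by apply: eq_integral => y _; rewrite /F/= normrM EFinM.
under eq_integral do rewrite eqx.
have fm2 : (\int[m2]_y `|y|%:E)%E \is a fin_num.
  rewrite ge0_fin_numE; first exact: abs_lty.
  by apply: integral_ge0 => y _; rewrite lee_fin.
rewrite -(fineK fm2) ge0_integralZr//; try (by move=> y _; rewrite lee_fin); first last.
- by rewrite lee_fin fine_ge0// integral_ge0// => y _; rewrite lee_fin.
- by apply/measurable_EFinP; exact: normr_measurable.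
- rewrite fineK// lte_mul_pinfty ?abs_lty//; first by apply: integral_ge0 => y _; rewrite lee_fin.
  rewrite ge0_fin_numE ?abs_lty//; first by apply: integral_ge0 => y _; rewrite lee_fin.
Qed.

Lemma integrable_indep_mul : P.-integrable setT (EFin \o (f \* h)).
Proof.
apply/integrableP; split.
  by apply/measurable_EFinP; exact: measurable_funM.
have /integrableP[_] := int_F.
rewrite (eq_measure_integral (distribution P pair)); last first.
  by move=> A mA _; exact: jointE.
by rewrite ge0_integral_distribution//; apply: measurableT_comp => //; exact/measurable_EFinP.
Qed.

Lemma Rintegral_indep_mul :
  \int[P]_w (f w * h w) = \int[P]_w f w * \int[P]_w h w.
Proof.
have E (g : {RV P >-> R}) : P.-integrable setT (EFin \o g) ->
    \int[distribution P g]_x x = \int[P]_w g w.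
  by move=> ig; rewrite /Rintegral integral_distribution.
rewrite -(E f)// -(E h)//.
transitivity (fine (\int[m1 \x m2]_z (EFin \o F) z)).
  rewrite (eq_measure_integral (distribution P pair)); last first.
    by move=> A mA _; exact: jointE.
  rewrite integral_distribution//; first exact/measurable_EFinP.
  exact: integrable_indep_mul.
rewrite -integral12_prod_meas1// /fubini_F/=.
under eq_integral => x _.
  under eq_integral do rewrite /F/= EFinM.
  rewrite integralZl//; last exact: int_id.
  over.
have fin2 : (\int[m2]_y y%:E)%E \is a fin_num.
  by apply: integrable_fin_num => //; exact: int_id.
rewrite -(fineK fin2) integralZr//; last exact: int_id.
by rewrite fineM//; apply: integrable_fin_num => //; exact: int_id.
Qed.

End expectation_product.

End independence.

(** * Moments of the centred normal law *)

Section normal_moments.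
Context {R : realType}.
Notation mu := (@lebesgue_measure R).
Implicit Types (s : R).

Let pdf s x : \bar R := (normal_pdf 0 s x)%:E.

Let mpdf s : measurable_fun setT (pdf s).
Proof. by apply/measurable_EFinP; exact: measurable_normal_pdf. Qed.

Let pdf0 s x : (0 <= pdf s x)%E.
Proof. by rewrite lee_fin normal_pdf_ge0. Qed.

Let integral_normal_indic s (E : set R) : measurable E ->
  (\int[normal_prob 0 s]_x (\1_E x)%:E = \int[mu]_x ((\1_E x)%:E * pdf s x))%E.
Proof.
move=> mE; rewrite integral_indic//= setIT /normal_prob integral_mkcond.
apply: eq_integral => x _; rewrite patchE indicE.
by case: ifPn => _; rewrite ?mul1e ?mul0e.
Qed.

Import HBNNSimple.

Let integral_normal_nnsfun s (f : {nnsfun R >-> R}) :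
  (\int[normal_prob 0 s]_x (f x)%:E = \int[mu]_x ((f x)%:E * pdf s x))%E.
Proof.
have mfr r : measurable (f @^-1` [set r]) by [].
under [LHS]eq_integral do rewrite fimfunE -fsumEFin//.
rewrite [LHS]ge0_integral_fsum//; last 2 first.
  - by move=> r; apply/measurable_EFinP; apply: measurable_funM; [exact: measurable_cst|apply: measurable_indic; exact: mfr].
  - by move=> n x _; rewrite EFinM nnfun_muleindic_ge0.
under [RHS]eq_integral.
  move=> x xD; rewrite fimfunE -fsumEFin// ge0_mule_fsuml; last first.
    by move=> r; rewrite EFinM nnfun_muleindic_ge0.
  over.
rewrite [RHS]ge0_integral_fsum//; last 2 first.
  - move=> r; apply: emeasurable_funM; last exact: mpdf.
    by apply/measurable_EFinP; apply: measurable_funM; [exact: measurable_cst|apply: measurable_indic; exact: mfr].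
  - by move=> n x _; rewrite mule_ge0// EFinM nnfun_muleindic_ge0.
apply: eq_fsbigr => r rf.
have r0 : 0 <= r by have /[!inE] -[x _ <-] := rf.
under eq_integral do rewrite EFinM.
under [RHS]eq_integral do rewrite EFinM -muleA.
have mi : measurable_fun setT (fun x => (\1_(f @^-1` [set r]) x)%:E : \bar R).
  by apply/measurable_EFinP; apply: measurable_indic; exact: mfr.
rewrite !ge0_integralZl//.
- by rewrite integral_normal_indic.
- by apply: emeasurable_funM; [exact: mi|exact: mpdf].
- by move=> x _; rewrite mule_ge0// lee_fin.
Qed.

(** Passage from indicators to simple functions to monotone limits; it reduces integrals against the
    normal law to Lebesgue integrals with a density. *)
Lemma ge0_integral_normal_prob s (f : R -> \bar R) :
  measurable_fun setT f -> (forall x, 0 <= f x)%E ->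
  (\int[normal_prob 0 s]_x f x = \int[mu]_x (f x * (normal_pdf 0 s x)%:E))%E.
Proof.
move=> mf f0.
pose f_ := nnsfun_approx measurableT mf.
have mf_ n : measurable_fun setT (fun x => (f_ n x)%:E : \bar R).
  by apply/measurable_EFinP; exact: measurable_funP.
have ndf m n x : (m <= n)%N -> f_ m x <= f_ n x.
  by move=> /(nd_nnsfun_approx measurableT mf)/lefP; apply.
transitivity (lim (\int[normal_prob 0 s]_x (f_ n x)%:E @[n --> \oo])%E).
  rewrite -monotone_convergence//=.
  - apply: eq_integral => ? /[!inE] xD; apply/esym/cvg_lim => //=.
    exact: cvg_nnsfun_approx.
  - by move=> n ? _; rewrite lee_fin.
  - by move=> ? _ ? ? mn; rewrite lee_fin; exact: ndf mn.
rewrite [X in _ = X](_ : _ = lim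
    (\int[mu]_x ((f_ n x)%:E * pdf s x) @[n --> \oo])%E); last first.
  rewrite -monotone_convergence//=.
  - apply: eq_integral => x _; apply/esym/cvg_lim => //.
    apply: cvgeZr => //; exact: cvg_nnsfun_approx.
  - by move=> n; apply: emeasurable_funM; [exact: mf_|exact: mpdf].
  - by move=> n x _; rewrite mule_ge0// lee_fin.
  - move=> x _ a b mn; rewrite lee_wpmul2r// lee_fin; exact: ndf mn.
by apply: congr_lim; apply/funext => n /=; exact: integral_normal_nnsfun.
Qed.

(** Multiplying the density of N(0, s^2) by exp(x^2 / (4 s^2)) gives sqrt 2 times the density of
    N(0, 2 s^2), which has mass one. Moment bounds follow without computing any moment. *)
Lemma normal_prob_ge0_le s (f g : R -> R) (c : R) :
  measurable_fun setT f -> (forall x, 0 <= f x) -> 0 <= c -> 0 < s ->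
  (forall x, f x <= c * expR (x ^+ 2 / (s ^+ 2 * 4))) ->
  (\int[normal_prob 0 s]_x (f x)%:E <= (c * Num.sqrt 2)%:E)%E.
Proof.
move=> mf f0 c0 s0 fle.
rewrite ge0_integral_normal_prob//; last exact/measurable_EFinP.
pose s2 := Num.sqrt 2 * s.
have sq2 : Num.sqrt 2 ^+ 2 = 2 :> R by rewrite sqr_sqrtr.
have s20 : 0 < s2 by rewrite mulr_gt0// sqrtr_gt0.
have key x : expR (x ^+ 2 / (s ^+ 2 * 4)) * normal_pdf 0 s x =
    Num.sqrt 2 * normal_pdf 0 s2 x.
  rewrite !normal_pdfE ?gt_eqF// /normal_peak /normal_fun !subr0.
  have -> : Num.sqrt (s2 ^+ 2 * pi *+ 2) = Num.sqrt 2 * Num.sqrt (s ^+ 2 * pi *+ 2).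
    rewrite -sqrtrM//; congr Num.sqrt; by rewrite /s2 exprMn sq2; ring.
  rewrite [in RHS]invfM mulrCA -expRD [in RHS]mulrA [in RHS]mulrA mulfV ?mul1r; last first.
    by rewrite gt_eqF// sqrtr_gt0.
  congr (_ * expR _).
  rewrite /s2 exprMn sq2 -(mulr_natr (s ^+ 2)) -(mulr_natr (2 * s ^+ 2)).
  by field; rewrite gt_eqF.
apply: (@le_trans _ _ (\int[mu]_x ((c * Num.sqrt 2)%:E * (normal_pdf 0 s2 x)%:E))%E).
  apply: ge0_le_integral => //.
  - by move=> x _; rewrite mule_ge0 ?lee_fin// normal_pdf_ge0.
  - by apply: emeasurable_funM; [exact/measurable_EFinP|exact: mpdf].
  - by apply: emeasurable_funM; [exact: measurable_cst|exact: mpdf].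
  - move=> x _; rewrite -!EFinM lee_fin -mulrA -key mulrA.
    by apply: ler_wpM2r; [exact: normal_pdf_ge0|exact: fle].
rewrite integralZl//; last exact: integrable_normal_pdf.
by rewrite integral_normal_pdf mule1.
Qed.

Definition normal_moment_cst (q : nat) : R := q`!%:R * 4 ^+ q * Num.sqrt 2.

Lemma normal_moment_cst_ge0 q : 0 <= normal_moment_cst q.
Proof. by rewrite !mulr_ge0// exprn_ge0. Qed.

(** The exponential bound y^q <= q! e^y at y = x^2 / (4 s^2). *)
Lemma normal_even_moment_le s q : 0 < s ->
  (\int[normal_prob 0 s]_x (x ^+ q.*2)%:E <= (normal_moment_cst q * s ^+ q.*2)%:E)%E.
Proof.
move=> s0; rewrite /normal_moment_cst mulrAC.
apply: normal_prob_ge0_le => //.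
- by move=> x; rewrite -mul2n exprM exprn_ge0// sqr_ge0.
- by rewrite !mulr_ge0 ?exprn_ge0// ltW.
move=> x; set y := x ^+ 2 / (s ^+ 2 * 4).
have y0 : 0 <= y by apply: divr_ge0; [exact: sqr_ge0|apply: mulr_ge0 => //; exact: sqr_ge0].
have -> : x ^+ q.*2 = y ^+ q * (4 ^+ q * s ^+ q.*2).
  rewrite -mul2n !exprM -!exprMn; congr (_ ^+ _).
  by rewrite /y; field; rewrite gt_eqF.
rewrite [leRHS](_ : _ = (q`!%:R * expR y) * (4 ^+ q * s ^+ q.*2)); last by ring.
apply: ler_wpM2r; first by rewrite mulr_ge0 ?exprn_ge0// ltW.
case: q => [|q]; first by rewrite expr0 fact0 mul1r; apply: le_trans (expR_ge1Dx y); lra.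
have := expR_ge1Dxn q y0.
have f0 : 0 < (q.+1)`!%:R :> R by rewrite ltr0n fact_gt0.
move=> h; rewrite mulrC -ler_pdivrMr//; apply: le_trans h; lra.
Qed.

Lemma ge0_integral_lebesgueN (f : R -> \bar R) :
  measurable_fun setT f -> (forall x, 0 <= f x)%E ->
  (\int[mu]_x f x = \int[mu]_x f (- x)%R)%E.
Proof.
move=> mf f0.
transitivity (\int[mu]_(x in (-%R : _ -> measurableTypeR R) @^-1` setT) (f \o -%R) x)%E; last first.
  by rewrite preimage_setT.
rewrite -ge0_integral_pushforward//.
by apply: eq_measure_integral => //= A mA _; exact/esym/lebesgue_measureN.
Qed.

Lemma integrable_normal_id s : 0 < s ->
  (normal_prob 0 s).-integrable setT (EFin : R -> \bar R).
Proof.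
move=> s0; apply/integrableP; split; first exact: EFin_measurable.
apply: (@le_lt_trans _ _ (\int[normal_prob 0 s]_x (1 + x ^+ 2)%:E)%E).
  apply: ge0_le_integral => //.
  - apply: measurableT_comp => //; exact: EFin_measurable.
  - apply/measurable_EFinP; apply: measurable_funD; first exact: measurable_cst.
    exact: exprn_measurable.
  - move=> x _; rewrite /= lee_fin ler_norml.
    by have := sqr_ge0 (x + 1); have := sqr_ge0 (x - 1); nra.
under eq_integral do rewrite EFinD.
rewrite ge0_integralD//; last 2 first.
- by move=> x _; rewrite lee_fin sqr_ge0.
- by apply/measurable_EFinP; exact: exprn_measurable.
apply: lte_add_pinfty.
  by rewrite integral_cst//= mul1e; apply: le_lt_trans (probability_le1 _ _) (ltry _).
exact: le_lt_trans (normal_even_moment_le 1 s0) (ltry _).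
Qed.

(** Reflection exchanges the positive and negative parts and fixes the density. *)
Lemma integral_normal_id s : 0 < s -> (\int[normal_prob 0 s]_x x%:E)%E = 0%E.
Proof.
move=> s0; have := integrable_normal_id s0 => ii.
have fp := integrable_pos_fin_num measurableT ii.
rewrite integralE.
suff -> : (\int[normal_prob 0 s]_x (EFin : R -> \bar R)^\- x =
   \int[normal_prob 0 s]_x (EFin : R -> \bar R)^\+ x)%E by rewrite subee.
have mE : measurable_fun setT (EFin : R -> \bar R) by exact: EFin_measurable.
rewrite ge0_integral_normal_prob//; last exact: measurable_funeneg.
rewrite [RHS]ge0_integral_normal_prob//; last exact: measurable_funepos.
rewrite ge0_integral_lebesgueN.
- apply: eq_integral => x _; rewrite !(funeposE, funenegE) EFinN oppeK.
  congr (_ * _%:E)%E; rewrite /normal_pdf gt_eqF//.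
  by rewrite /normal_fun !subr0 sqrrN.
- by apply: emeasurable_funM; [exact: measurable_funeneg|exact: mpdf].
- by move=> x; rewrite mule_ge0// lee_fin normal_pdf_ge0.
Qed.

(** The density is at most 1 / (2 s), so [-s/2, s/2] carries at most half of the mass, and outside
    it x^2 >= s^2 / 4. The order of magnitude of the variance is all that the drift needs. *)
Lemma normal_sqr_ge s : 0 < s ->
  ((s ^+ 2 / 8)%:E <= \int[normal_prob 0 s]_x (x ^+ 2)%:E)%E.
Proof.
move=> s0; pose A : set R := `[- (s / 2), s / 2]%classic.
have mA : measurable A by exact: measurable_itv.
have PA : (normal_prob 0 s A <= (1 / 2)%:E)%E.
  apply: (@le_trans _ _ (\int[mu]_(x in A) ((2 * s)^-1)%:E)%E).
    apply: ge0_le_integral => //.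
    - by move=> x _; exact: pdf0.
    - by apply: measurable_funTS; exact: mpdf.
    - move=> x _; rewrite lee_fin; apply: (le_trans (normal_pdf_ub _ _ _)).
        by rewrite gt_eqF.
      rewrite /normal_peak lef_pV2 ?posrE ?sqrtr_gt0 ?mulr_gt0//; last first.
        by rewrite mulrn_wgt0// mulr_gt0 ?exprn_gt0// pi_gt0.
      have -> : 2 * s = Num.sqrt ((2 * s) ^+ 2) by rewrite sqrtr_sqr gtr0_norm ?mulr_gt0.
      apply: ler_wsqrtr; have := pi_ge2 R; have := exprn_gt0 2 s0; nra.
  rewrite integral_cst//.
  have muA : mu A = s%:E.
    rewrite /A lebesgue_measure_itv/= lte_fin ifT; last lra.
    by rewrite -EFinD; congr EFin; lra.
  rewrite [X in (_ * X <= _)%E](_ : _ = s%:E); last exact: muA.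
  rewrite -EFinM lee_fin; rewrite le_eqVlt; apply/orP; left; apply/eqP.
  by field; rewrite gt_eqF.
have PcA : ((1 / 2)%:E <= normal_prob 0 s (~` A))%E.
  rewrite probability_setC// leeBrDr ?fin_num_measure//.
  by apply: (le_trans (leeD (lexx _) PA)); rewrite -EFinD lee_fin; lra.
apply: (@le_trans _ _ (\int[normal_prob 0 s]_(x in ~` A) (s ^+ 2 / 4)%:E)%E).
  rewrite integral_cst; last exact: measurableC.
  apply: (@le_trans _ _ ((s ^+ 2 / 4)%:E * (1 / 2)%:E)%E).
    by rewrite -EFinM lee_fin; lra.
  by apply: lee_wpmul2l => //; rewrite lee_fin divr_ge0 ?sqr_ge0.
have mx : measurable_fun setT (fun x : R => (x ^+ 2)%:E : \bar R).
  by apply/measurable_EFinP; exact: exprn_measurable.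
apply: (@le_trans _ _ (\int[normal_prob 0 s]_(x in ~` A) (x ^+ 2)%:E)%E).
  apply: ge0_le_integral => //.
  - exact: measurableC.
  - by move=> x _; rewrite lee_fin divr_ge0 ?sqr_ge0.
  - by apply: measurable_funTS.
  - move=> x; rewrite /A /= in_itv/= => /negP; rewrite negb_and -!ltNge lee_fin => /orP[h|h]; nra.
by apply: ge0_subset_integral => //; [exact: measurableC|move=> x _; rewrite lee_fin sqr_ge0].
Qed.

End normal_moments.

Section normal_variable.
Context {R : realType} {d} {T : measurableType d} (P : probability T R).
Variables (s : R) (X : T -> R).
Hypotheses (s0 : 0 < s) (mX : measurable_fun setT X).
Hypothesis lawX : forall A : set R, measurable A -> P (X @^-1` A) = normal_prob 0 s A.

Let X' : T -> measurableTypeR R := X.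

HB.instance Definition _ := isMeasurableFun.Build _ _ T (measurableTypeR R) X' mX.

Let XRV : {RV P >-> measurableTypeR R} := X'.

Lemma ge0_integral_normal_law (f : R -> \bar R) :
  measurable_fun setT f -> (forall x, 0 <= f x)%E ->
  (\int[P]_w f (X w) = \int[normal_prob 0 s]_x f x)%E.
Proof.
move=> mf f0; rewrite -(ge0_integral_distribution XRV mf f0).
by apply: (eq_measure_integral (normal_prob 0 s)) => A mA _; exact: lawX.
Qed.

Lemma integral_normal_law_id : (\int[P]_w (X w)%:E = 0)%E.
Proof.
rewrite -(integral_normal_id s0) integralE [RHS]integralE.
have mE : measurable_fun setT (EFin : R -> \bar R) by exact: EFin_measurable.
congr (_ - _)%E.
  rewrite -[RHS](ge0_integral_normal_law (measurable_funepos mE) (funepos_ge0 _)).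
  by apply: eq_integral => w _; rewrite !funeposE.
rewrite -[RHS](ge0_integral_normal_law (measurable_funeneg mE) (funeneg_ge0 _)).
by apply: eq_integral => w _; rewrite !funenegE.
Qed.

Lemma normal_even_ge0 (x : R) q : 0 <= x ^+ q.*2.
Proof. by rewrite -mul2n exprM exprn_ge0// sqr_ge0. Qed.

Lemma integral_normal_law_even q :
  (\int[P]_w (X w ^+ q.*2)%:E = \int[normal_prob 0 s]_x (x ^+ q.*2)%:E)%E.
Proof.
apply: (ge0_integral_normal_law (f := fun x => (x ^+ q.*2)%:E)).
- by apply/measurable_EFinP; exact: exprn_measurable.
- by move=> x; rewrite lee_fin normal_even_ge0.
Qed.

Lemma integrable_normal_law_even q : P.-integrable setT (EFin \o (fun w => X w ^+ q.*2)).
Proof.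
apply/integrableP; split.
  by apply/measurable_EFinP; exact: measurable_funX.
under eq_integral do rewrite /= ger0_norm ?normal_even_ge0//.
rewrite integral_normal_law_even.
exact: le_lt_trans (normal_even_moment_le q s0) (ltry _).
Qed.

Lemma integrable_normal_law_id : P.-integrable setT (EFin \o X).
Proof.
apply/integrableP; split; first exact/measurable_EFinP.
have /integrableP[_] := integrable_normal_id s0.
rewrite -(ge0_integral_normal_law (f := fun x => `|x%:E|%E))//.
by apply: measurableT_comp => //; exact: EFin_measurable.
Qed.

Lemma Rintegral_normal_law_id : \int[P]_w X w = 0.
Proof. by rewrite /Rintegral integral_normal_law_id. Qed.

Lemma Rintegral_normal_law_even_le q :
  \int[P]_w (X w ^+ q.*2) <= normal_moment_cst q * s ^+ q.*2.
Proof.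
rewrite -lee_fin /Rintegral fineK; last exact: integrable_fin_num (integrable_normal_law_even q).
by rewrite integral_normal_law_even; exact: normal_even_moment_le.
Qed.

Lemma Rintegral_normal_law_sqrE : \int[P]_w (X w ^+ 2) =
  fine (\int[normal_prob 0 s]_x (x ^+ 2)%:E)%E.
Proof. by rewrite /Rintegral (integral_normal_law_even 1). Qed.

Lemma Rintegral_normal_law_quarticE : \int[P]_w (X w ^+ 4) =
  fine (\int[normal_prob 0 s]_x (x ^+ 4)%:E)%E.
Proof. by rewrite /Rintegral (integral_normal_law_even 2). Qed.

End normal_variable.

(** * Bounded measurable functions and means *)

Section bounded_measurable.
Context {R : realType} {d} {T : measurableType d}.
Implicit Types (A : set T) (f g : T -> R).

(** Measurability is global while the bound is asked on [A] alone: the coefficients of the expansion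
    are controlled on the survival event only, and multiplying by its indicator makes them
    integrable. *)
Definition bmeas A f := measurable_fun setT f /\ exists K, forall w, A w -> `|f w| <= K.

Lemma bmeas_cst A (c : R) : bmeas A (fun=> c).
Proof. by split; [exact: measurable_cst|exists `|c|]. Qed.

Lemma bmeasD A f g : bmeas A f -> bmeas A g -> bmeas A (fun w => f w + g w).
Proof.
move=> [mf [K fK]] [mg [L gL]]; split; first exact: measurable_funD.
exists (K + L) => w Aw; apply: (le_trans (ler_normD _ _)).
by apply: lerD; [exact: fK|exact: gL].
Qed.

Lemma bmeasM A f g : bmeas A f -> bmeas A g -> bmeas A (fun w => f w * g w).
Proof.
move=> [mf [K fK]] [mg [L gL]]; split; first exact: measurable_funM.
exists (K * L) => w Aw; rewrite normrM.
by apply: ler_pM => //; [exact: fK|exact: gL].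
Qed.

Lemma bmeasN A f : bmeas A f -> bmeas A (fun w => - f w).
Proof.
move=> bf; have := bmeasM (bmeas_cst A (-1)) bf.
by under eq_fun do rewrite mulN1r.
Qed.

Lemma bmeas_sum A (J : finType) (F : J -> T -> R) :
  (forall j, bmeas A (F j)) -> bmeas A (fun w => \sum_j F j w).
Proof.
move=> bF; elim: (index_enum J) => [|j js ih].
  by under eq_fun do rewrite big_nil; exact: bmeas_cst.
by under eq_fun do rewrite big_cons; exact: bmeasD.
Qed.

Lemma bmeas_sqrt A f : bmeas A f -> bmeas A (fun w => Num.sqrt (f w)).
Proof.
move=> [mf [K fK]]; split.
  apply: (measurableT_comp (f := Num.sqrt : R -> R)) => //.
  by apply: continuous_measurable_fun; exact: sqrt_continuous.
exists (Num.sqrt K) => w Aw; rewrite ger0_norm ?sqrtr_ge0//.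
by apply: ler_wsqrtr; apply: (le_trans (ler_norm _)); exact: fK.
Qed.

Lemma bmeas_powR A f (p : R) : 0 <= p -> bmeas A f -> (forall w, A w -> 0 <= f w) ->
  bmeas A (fun w => f w `^ p).
Proof.
move=> p0 [mf [K fK]] f0; split.
  by apply: (measurableT_comp (measurable_powR p)).
exists (K `^ p) => w Aw; rewrite ger0_norm ?powR_ge0//.
have fK' : f w <= K by apply: (le_trans (ler_norm _)); exact: fK.
have fw := f0 w Aw.
by apply: ge0_ler_powR => //; rewrite nnegrE//; exact: le_trans fK'.
Qed.

Lemma bmeas_max A f (c : R) : bmeas A f -> bmeas A (fun w => Num.max (f w) c).
Proof.
move=> [mf [K fK]]; split; first by apply: measurable_maxr => //; exact: measurable_cst.
exists (K + `|c|) => w Aw; case: (leP (f w) c) => _.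
  by rewrite lerDr; apply: le_trans (fK w Aw).
by apply: (le_trans (fK w Aw)); rewrite lerDl.
Qed.

Lemma bmeas_inv A f (r : R) : 0 < r -> (forall w, r <= f w) -> bmeas A f ->
  bmeas A (fun w => (f w)^-1).
Proof.
move=> r0 rf [mf _]; split; last first.
  exists r^-1 => w _; have f0 : 0 < f w by exact: lt_le_trans (rf w).
  by rewrite ger0_norm ?invr_ge0 ?(ltW f0)// lef_pV2.
have -> : (fun w => (f w)^-1) = (fun w => f w `^ (-1)).
  by apply/funext => w; rewrite powR_inv1//; apply: le_trans (rf w); exact: ltW.
by apply: (measurableT_comp (measurable_powR _)).
Qed.

Lemma bmeas_indic A f (B : set T) : B `<=` A -> measurable B -> bmeas A f ->
  bmeas setT (fun w => \1_B w * f w).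
Proof.
move=> BA mB [mf [K fK]]; split.
  by apply: measurable_funM => //; exact: measurable_indic.
exists (Num.max 0 K) => w _; rewrite indicE; case: (boolP (w \in B)) => wB.
  by rewrite mul1r le_max fK ?orbT//; apply: BA; rewrite inE in wB.
by rewrite mul0r normr0 le_max lexx.
Qed.

End bounded_measurable.

Section mean.
Context {R : realType} {d} {T : measurableType d} (P : probability T R).

(** Integrability travels with the value, so that linear combinations and comparisons carry no
    separate side conditions. *)
Definition has_mean (f : T -> R) (a : R) :=
  P.-integrable setT (EFin \o f) /\ \int[P]_w f w = a.

Lemma has_meanD f g a b : has_mean f a -> has_mean g b ->
  has_mean (fun w => f w + g w) (a + b).
Proof.
move=> [intf <-] [intg <-]; split; last by rewrite RintegralD.
by have := integrableD measurableT intf intg.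
Qed.

Lemma has_meanZ f a c : has_mean f a -> has_mean (fun w => c * f w) (c * a).
Proof.
move=> [intf <-]; split; last by rewrite RintegralZl.
by have := integrableZl measurableT c intf.
Qed.

Lemma has_mean0 : has_mean (fun=> 0) 0.
Proof.
split; first exact: (integrable0 P).
by rewrite Rintegral_cst// mul0r.
Qed.

Lemma has_mean_sum (J : finType) (F : J -> T -> R) (a : J -> R) :
  (forall j, has_mean (F j) (a j)) ->
  has_mean (fun w => \sum_j F j w) (\sum_j a j).
Proof.
move=> h; elim: (index_enum J) => [|j js ih].
  by rewrite big_nil; under eq_fun do rewrite big_nil; exact: has_mean0.
by rewrite big_cons; under eq_fun do rewrite big_cons; exact: has_meanD.
Qed.

Lemma has_mean_bmeas f : bmeas setT f -> has_mean f (\int[P]_w f w).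
Proof.
move=> [mf [K fK]]; split => //.
apply: measurable_bounded_integrable => //.
  by apply: le_lt_trans (probability_le1 _ _) (ltry _).
exists K; split; first exact: num_real.
by move=> x Kx w _; apply: le_trans (ltW Kx); exact: fK.
Qed.

Lemma has_mean_le f g a b : has_mean f a -> has_mean g b ->
  (forall w, f w <= g w) -> a <= b.
Proof. by move=> [intf <-] [intg <-] fg; apply: le_Rintegral. Qed.

Lemma has_mean_indic A : measurable A -> has_mean (\1_A) (fine (P A)).
Proof.
move=> mA; split; last by rewrite /Rintegral integral_indic// setIT.
have : bmeas setT (fun w => \1_A w * 1 : R).
  by apply: (bmeas_indic (A := setT)) => //; exact: bmeas_cst.
by under eq_fun do rewrite mulr1; case/has_mean_bmeas.
Qed.

End mean.

(** * Arrays of independent Gaussian increments *)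

Section gaussian_grid.
Context {R : realType} {d} {T : measurableType d} (P : probability T R).
Context {n N : nat}.
Let I := ('I_n * 'I_N)%type.
Variables (X : 'I_n -> 'I_N -> T -> R) (s : R).

Definition gaussian_grid := [/\ 0 < s, forall i j, measurable_fun setT (X i j) &
  forall A : 'I_n -> 'I_N -> set R, (forall i j, measurable (A i j)) ->
  P [set w | forall i j, A i j (X i j w)] =
  (\prod_(ij : 'I_n * 'I_N) normal_prob 0 s (A ij.1 ij.2))%E].

Let Xp (ij : I) := X ij.1 ij.2.

Definition grid_sigma (J : pred I) := <<s cylinders Xp J >>.

Hypothesis HX : gaussian_grid.
Let s0 : 0 < s. Proof. by case: HX. Qed.
Let mX (ij : I) : measurable_fun setT (Xp ij).
Proof. by case: HX => _ + _; exact. Qed.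
Let XE (A : I -> set R) : (forall ij, measurable (A ij)) ->
  P [set w | forall ij, A ij (Xp ij w)] = (\prod_ij normal_prob 0 s (A ij))%E.
Proof.
move=> mA; case: HX => _ _ /(_ (fun i j => A (i, j))) H.
transitivity (P [set w | forall i j, A (i, j) (X i j w)]).
  congr (P _); apply/seteqP; split=> w /= h; first by move=> i j; exact: (h (i, j)).
  by case=> i j; exact: h.
by rewrite H//; apply: eq_bigr => -[].
Qed.
Let muT (ij : I) : normal_prob 0 s setT = 1%E :> \bar R.
Proof. by rewrite /normal_prob integral_normal_pdf. Qed.

Lemma grid_law (ij : I) A : measurable A -> P (Xp ij @^-1` A) = normal_prob 0 s A.
Proof.
move=> mA.
rewrite (_ : _ @^-1` _ = [set w | forall ij', pred1 ij ij' -> A (Xp ij' w)]).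
  apply: (eq_trans (cylinderE (mu := fun=> normal_prob 0 s) muT XE (pred1 ij) (A := fun=> A) (fun=> mA))).
  by rewrite big_pred1_eq.
by apply/seteqP; split => w /= h; [move=> ij' /eqP ->|exact: h].
Qed.

Lemma grid_indep (J1 J2 : pred I) : (forall ij, J1 ij -> ~~ J2 ij) ->
  forall E F, grid_sigma J1 E -> grid_sigma J2 F -> P (E `&` F) = (P E * P F)%E.
Proof. by move=> J12; exact: (indep_cylinders (mu := fun=> normal_prob 0 s) muT mX XE). Qed.

Let T_ (J : pred I) := g_sigma_algebraType (cylinders Xp J).

Lemma grid_sigma_measurable J E : grid_sigma J E -> measurable E.
Proof. by apply: (g_sigma_cylinders_measurable mX). Qed.

Lemma measurable_fun_grid (J : pred I) (f : T -> R) :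
  measurable_fun setT (f : T_ J -> R) -> measurable_fun setT f.
Proof. by apply: (measurable_fun_cylinders mX). Qed.

Lemma grid_indep_mul (J1 J2 : pred I) (f g : T -> R) a b :
  (forall ij, J1 ij -> ~~ J2 ij) ->
  measurable_fun setT (f : T_ J1 -> R) -> measurable_fun setT (g : T_ J2 -> R) ->
  has_mean P f a -> has_mean P g b -> has_mean P (fun w => f w * g w) (a * b).
Proof.
move=> J12 mf mg [intf <-] [intg <-].
pose f' : {RV P >-> R} := HB.pack f (isMeasurableFun.Build _ _ _ _ f (measurable_fun_grid mf)).
pose g' : {RV P >-> R} := HB.pack g (isMeasurableFun.Build _ _ _ _ g (measurable_fun_grid mg)).
have fg : forall A B, measurable A -> measurable B ->
    P (f' @^-1` A `&` g' @^-1` B) = (P (f' @^-1` A) * P (g' @^-1` B))%E.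
  move=> A B mA mB; apply: (grid_indep J12).
    by have := mf measurableT A mA; rewrite setTI.
  by have := mg measurableT B mB; rewrite setTI.
split; first exact: (integrable_indep_mul fg intf intg).
exact: (Rintegral_indep_mul fg intf intg).
Qed.

(** Both moments stay unevaluated integrals; the estimates rest on a lower bound for this one and an
    upper bound for the fourth. *)
Definition grid_var : R := fine (\int[normal_prob 0 s]_x (x ^+ 2)%:E)%E.
Definition grid_quartic : R := fine (\int[normal_prob 0 s]_x (x ^+ 4)%:E)%E.

Lemma grid_mean1 ij : has_mean P (Xp ij) 0.
Proof.
have lawX := grid_law ij; split; first exact: integrable_normal_law_id lawX.
exact: Rintegral_normal_law_id lawX.
Qed.

Lemma grid_mean2 ij : has_mean P (fun w => Xp ij w ^+ 2) grid_var.
Proof.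
have lawX := grid_law ij; split; first exact: (integrable_normal_law_even s0 _ lawX 1).
exact: Rintegral_normal_law_sqrE lawX.
Qed.

Lemma grid_mean4 ij : has_mean P (fun w => Xp ij w ^+ 4) grid_quartic.
Proof.
have lawX := grid_law ij; split; first exact: (integrable_normal_law_even s0 _ lawX 2).
exact: Rintegral_normal_law_quarticE lawX.
Qed.

End gaussian_grid.

(** * Measurability and boundedness of the expansion coefficients *)

Section bmeas_lyapunov.
Context {R : realType} {d} {T : measurableType d} {n : nat}.
Variables (A : set T) (Y : T -> 'rV[R]_n) (u v : 'rV[R]_n).
Hypothesis bY : forall i, bmeas A (fun w => Y w ord0 i).

Lemma bmeas_dotv x : bmeas A (fun w => dotv x (Y w)).
Proof. by apply: bmeas_sum => i; apply: bmeasM; [exact: bmeas_cst|exact: bY]. Qed.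

Lemma bmeas_sqr_norm : bmeas A (fun w => dotv (Y w) (Y w)).
Proof. by apply: bmeas_sum => i; apply: bmeasM; exact: bY. Qed.

Variables (k del r sg : R).
Hypotheses (k0 : 0 < k) (k1 : k <= 1) (del0 : 0 <= del) (r0 : 0 < r).
Hypothesis AY : forall w, A w -> near_wedge u v (k / 16) (3 * r) (Y w).

Lemma bmeas_lyap_s : bmeas A (fun w => lyap_s u v r (Y w)).
Proof.
apply: bmeas_sqrt; apply: bmeasD; last exact: bmeas_cst.
by apply: bmeasD; apply: bmeasM; exact: bmeas_dotv.
Qed.

Lemma bmeas_lyap_sV : bmeas A (fun w => (lyap_s u v r (Y w))^-1).
Proof.
apply: (bmeas_inv r0); last exact: bmeas_lyap_s.
by move=> w; exact: lyap_s_ge (ltW r0).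
Qed.

Lemma bmeas_lyap_rho : bmeas A (fun w => lyap_rho k r (Y w)).
Proof. by apply: bmeas_sqrt; apply: bmeasD; [exact: bmeas_sqr_norm|exact: bmeas_cst]. Qed.

Lemma bmeas_lyap_rhoV : bmeas A (fun w => (lyap_rho k r (Y w))^-1).
Proof.
apply: (@bmeas_inv _ _ _ _ _ (52 / k * r)); last exact: bmeas_lyap_rho.
  by apply: mulr_gt0 => //; apply: divr_gt0.
by move=> w; exact: lyap_rho_ge (ltW r0).
Qed.

Lemma bmeas_lyap_w : bmeas A (fun w => lyap_w u v k r (Y w)).
Proof.
apply: bmeasD.
  apply: bmeasD.
    by apply: bmeasN; apply: bmeasD; exact: bmeas_dotv.
  by apply: bmeasN; apply: bmeasM; [exact: bmeas_lyap_s|exact: bmeas_cst].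
by apply: bmeasM; [exact: bmeas_cst|exact: bmeas_lyap_rho].
Qed.

Lemma lyap_w_near_ge0 w : A w -> 0 <= lyap_w u v k r (Y w).
Proof.
move=> Aw; apply: le_trans (lyap_w_ge k0 k1 (ltW r0) (AY Aw)).
by rewrite divr_ge0// mulr_ge0 ?sqrtr_ge0// ltW.
Qed.

Lemma bmeas_lyap_wX : bmeas A (fun w => lyap_w u v k r (Y w) `^ del).
Proof. by apply: bmeas_powR => //; [exact: bmeas_lyap_w|exact: lyap_w_near_ge0]. Qed.

Lemma bmeas_lyap : bmeas A (fun w => lyap u v k del r (Y w)).
Proof.
apply: bmeas_powR; first by rewrite addr_ge0.
- by apply: bmeas_max; exact: bmeas_lyap_w.
- by move=> w Aw; rewrite le_max lexx orbT.
Qed.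

Lemma bmeas_lyap_p i : bmeas A (fun w => lyap_p u v r (Y w) i).
Proof.
apply: bmeasM; last exact: bmeas_lyap_sV.
by apply: bmeasD; apply: bmeasM; [exact: bmeas_dotv|exact: bmeas_cst|exact: bmeas_dotv|exact: bmeas_cst].
Qed.

Lemma bmeas_lyap_lin i : bmeas A (fun w => lyap_lin u v k del r (Y w) i).
Proof.
apply: bmeasM; first exact: bmeas_lyap_wX.
apply: bmeasM; first exact: bmeas_cst.
apply: bmeasD.
  apply: bmeasD; first exact: bmeas_cst.
  by apply: bmeasN; apply: bmeasM; [exact: bmeas_lyap_p|exact: bmeas_cst].
apply: bmeasM; last exact: bmeas_lyap_rhoV.
by apply: bmeasM; [exact: bmeas_cst|exact: bY].
Qed.

Lemma bmeas_lyap_quad i j : bmeas A (fun w => lyap_quad u v k del r sg (Y w) i j).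
Proof.
apply: bmeasM; first exact: bmeas_lyap_wX.
apply: bmeasM; first exact: bmeas_lyap_sV.
apply: bmeasD; last exact: bmeas_cst.
apply: bmeasM; last exact: bmeas_cst.
apply: bmeasM; first exact: bmeas_cst.
apply: bmeasD; first exact: bmeas_cst.
by apply: bmeasN; apply: bmeasM; exact: bmeas_lyap_p.
Qed.

Lemma bmeas_lyap_quartic : bmeas A (fun w => lyap_quartic u v k del r sg (Y w)).
Proof.
apply: bmeasM; first exact: bmeas_lyap_wX.
by apply: bmeasM; [exact: bmeas_lyap_sV|exact: bmeas_cst].
Qed.

End bmeas_lyapunov.

(** * Random walks along the grid and their past *)

Section walk.
Context {R : realType} {d} {T : measurableType d} (P : probability T R).
Context {n N : nat}.
Let I := ('I_n * 'I_N)%type.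
Variables (X : 'I_n -> 'I_N -> T -> R) (s : R).
Hypothesis HX : gaussian_grid P X s.
Variables (phi : nat -> 'I_N) (K : nat) (eps : R).
Hypothesis phi_inj : {in [pred l | (l < K)%N] &, injective phi}.
Hypothesis eps2 : eps ^+ 2 = 1.

(* eps = 1 and phi increasing follow the path forward in time, eps = -1 and phi
   decreasing follow it backward. *)
Definition walk (l : nat) (w : T) : 'rV[R]_n :=
  \sum_(m < l) eps *: \row_i X i (phi m) w.

Definition walk_past (l : nat) : pred I := [pred ij | [exists m : 'I_l, ij.2 == phi m]].

Variables (u v : 'rV[R]_n) (eta h M : R).

Definition survive (l : nat) : set T := [set w | forall m, (m <= l)%N ->
  near_wedge u v eta h (walk m w) /\ Num.sqrt (dotv (walk m w) (walk m w)) <= M].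

(** The sample space with the sigma-algebra of the past, so that being adapted is ordinary
    measurability on this type. *)
Let T_ (l : nat) := g_sigma_algebraType (cylinders (fun ij : I => X ij.1 ij.2) (walk_past l)).

Lemma walk_coordE l w i : walk l w ord0 i = \sum_(m < l) eps * X i (phi m) w.
Proof. by rewrite /walk summxE; apply: eq_bigr => m _; rewrite !mxE. Qed.

Lemma measurable_walk_coord l m i : (m <= l)%N ->
  measurable_fun setT ((fun w => walk m w ord0 i) : T_ l -> R).
Proof.
move=> ml.
rewrite (_ : (fun w => _) = (fun w => \sum_(j < m) eps * X i (phi j) w) :> (T_ l -> R)); last first.
  by apply/funext => w; exact: walk_coordE.
apply: measurable_sum => j; apply: measurable_funM; first exact: measurable_cst.
have := @measurable_cylinder_coord _ _ _ _ (fun ij : I => X ij.1 ij.2) (walk_past l) (i, phi j).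
apply.
by apply/existsP; exists (widen_ord ml j).
Qed.

Lemma measurable_survive l : measurable (survive l : set (T_ l)).
Proof.
rewrite (_ : survive l = \bigcap_(m in [set m | (m <= l)%N])
  [set w | near_wedge u v eta h (walk m w) /\
     Num.sqrt (dotv (walk m w) (walk m w)) <= M]); last by [].
apply: bigcap_measurable => [|m /= ml]; first by exists 0%N.
(* On [set0] the bound in [bmeas] is vacuous, so its closure lemmas deliver plain measurability for
   the past. *)
have bY i : bmeas (set0 : set (T_ l)) (fun w => walk m w ord0 i).
  by split; [exact: measurable_walk_coord|exists 0].
have bN : bmeas (set0 : set (T_ l)) (fun w => Num.sqrt (dotv (walk m w) (walk m w))).
  by apply: bmeas_sqrt; exact: bmeas_sqr_norm.
have mle (f g : T_ l -> R) : bmeas set0 f -> bmeas set0 g ->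
    measurable [set w | f w <= g w].
  move=> [mf _] [mg _]; rewrite -[X in measurable X]setTI.
  by have := measurable_fun_ler mf mg measurableT (Y := [set true]) Logic.I.
have bR : bmeas (set0 : set (T_ l)) (fun w => eta * Num.sqrt (dotv (walk m w) (walk m w)) + h).
  by apply: bmeasD; [apply: bmeasM => //; exact: bmeas_cst|exact: bmeas_cst].
have m1 := mle _ _ (bmeas_dotv bY u) bR.
have m2 := mle _ _ (bmeas_dotv bY v) bR.
have m3 := mle _ _ bN (bmeas_cst _ M).
by have := measurableI _ _ (measurableI _ _ m1 m2) m3.
Qed.

Lemma walk0 w : walk 0 w = 0.
Proof. by rewrite /walk big_ord0. Qed.

Lemma walkS l w : walk l.+1 w = walk l w + eps *: \row_i X i (phi l) w.
Proof. by rewrite /walk big_ord_recr. Qed.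

Lemma survive_anti l m : (m <= l)%N -> survive l `<=` survive m.
Proof. by move=> ml w h' j jm; apply: h'; exact: leq_trans ml. Qed.

Lemma walk_past_fresh l i : (l < K)%N -> forall ij, walk_past l ij -> ij != (i, phi l).
Proof.
move=> lK ij /existsP[m /eqP e]; apply: contraTneq isT => eij; move: e; rewrite eij/=.
move=> /phi_inj; rewrite !inE => /(_ lK (ltn_trans (ltn_ord m) lK)) e.
by have := ltn_ord m; rewrite -e ltnn.
Qed.

Section past_means.
Variables (l : nat) (f : T -> R).
Hypotheses (lK : (l < K)%N) (bf : bmeas setT (f : T_ l -> R)).
Let Y i w := X i (phi l) w.
Let J i : pred I := pred1 (i, phi l).

Lemma past_bmeas : bmeas setT f.
Proof. by case: bf => mf bdf; split => //; exact: (measurable_fun_grid HX mf). Qed.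

Let mean_f : has_mean P f (\int[P]_w f w).
Proof. exact: has_mean_bmeas past_bmeas. Qed.

Let mY i : measurable_fun setT (Y i : g_sigma_algebraType (cylinders (fun ij : I => X ij.1 ij.2) (J i)) -> R).
Proof. by apply: (@measurable_cylinder_coord _ _ _ _ (fun ij : I => X ij.1 ij.2) (J i) (i, phi l)); rewrite /J/=. Qed.

Let fresh i : forall ij, walk_past l ij -> ~~ J i ij.
Proof. by move=> ij /(walk_past_fresh i lK). Qed.

Lemma past_mean1 i : has_mean P (fun w => f w * Y i w) 0.
Proof.
rewrite -(mulr0 (\int[P]_w f w)).
exact: (grid_indep_mul HX (fresh i) bf.1 (@mY i) mean_f (grid_mean1 HX (i, phi l))).
Qed.

Lemma past_mean4 i : has_mean P (fun w => f w * Y i w ^+ 4) ((\int[P]_w f w) * grid_quartic s).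
Proof.
apply: (grid_indep_mul HX (fresh i) bf.1 _ mean_f (grid_mean4 HX (i, phi l))).
by apply: measurable_funX; exact: mY.
Qed.

(** The increment of index [phi l] is new because [phi] is injective. For distinct coordinates,
    [f * Y i] is measurable for the past enlarged by coordinate [i], hence independent of the
    centred [Y j]. *)
Lemma past_mean2 i j : has_mean P (fun w => f w * (Y i w * Y j w))
  ((\int[P]_w f w) * (grid_var s * (i == j)%:R)).
Proof.
have [<-|ij] := eqVneq i j.
  rewrite mulr1.
  apply: (grid_indep_mul HX (fresh i) bf.1 _ mean_f (grid_mean2 HX (i, phi l))).
  by apply: measurable_funX; exact: mY.
rewrite !mulr0; under eq_fun do rewrite mulrA.
pose J' : pred I := [predU walk_past l & J i].
have J'j kl : J' kl -> ~~ J j kl.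
  move=> /orP[/fresh//|/eqP -> /=].
  by apply: contra_neqN ij => /eqP[].
have m1 := past_mean1 i.
rewrite -(mul0r (0 : R)).
apply: (grid_indep_mul HX J'j _ (@mY j) m1 (grid_mean1 HX (j, phi l))).
have sub1 : <<s cylinders (fun ij : I => X ij.1 ij.2) (walk_past l) >> `<=`
    <<s cylinders (fun ij : I => X ij.1 ij.2) J' >>.
  by apply: sub_cylinders => kl h'; apply/orP; left.
apply: measurable_funM.
  by move=> _ B mB; apply: sub1; exact: (bf.1 measurableT B mB).
apply: (@measurable_cylinder_coord _ _ _ _ (fun ij : I => X ij.1 ij.2) J' (i, phi l)).
by apply/orP; right; exact: eqxx.
Qed.

End past_means.

End walk.

Lemma ler_telescope (R : realType) (x y I I' Q z : R) :
  x <= Q - I -> I' <= I - z -> y <= z -> x + y <= Q - I'.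
Proof. by move=> *; lra. Qed.

(** * Survival probability of a walk near the wedge *)

Section walk_estimate.
Context {R : realType} {d} {T : measurableType d} (P : probability T R).
Context {n N : nat}.
Variables (X : 'I_n -> 'I_N -> T -> R) (s : R).
Hypothesis HX : gaussian_grid P X s.
Variables (phi : nat -> 'I_N) (K : nat) (eps : R).
Hypothesis phi_inj : {in [pred l | (l < K)%N] &, injective phi}.
Hypothesis eps2 : eps ^+ 2 = 1.
Variables (u v : 'rV[R]_n) (c0 k del r M : R).
Hypotheses (k0 : 0 < k) (k1 : k <= 1) (d01 : 0 <= del <= 1) (r0 : 0 < r) (r1 : r <= 1).
Hypotheses (M0 : 0 <= M) (c00 : 0 <= c0).
Hypotheses (u2 : dotv u u <= 2 ^+ 2) (v2 : dotv v v <= 2 ^+ 2).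
Hypotheses (cu : c0 <= dotv u u - `|dotv u v|) (cv : c0 <= dotv v v - `|dotv u v|).
Hypothesis h1 : n%:R * (3 * k + 294 * del / k) <= c0 / 16.
Hypothesis h2 : (1 + 172 * (6 / k) ^+ 2) * (s / r) *
  (2 * n%:R + 128 * n%:R ^+ 2 * normal_moment_cst 2) <= c0 / 16.

Local Notation S := (walk X phi eps).
Local Notation A := (survive X phi eps u v (k / 16) (3 * r) M).
Local Notation V := (lyap u v k del r).
Local Notation T_ l := (g_sigma_algebraType
  (cylinders (fun ij : 'I_n * 'I_N => X ij.1 ij.2) (walk_past phi l))).

Let s0 : 0 < s. Proof. by case: HX. Qed.
Let del0 : 0 <= del. Proof. by case/andP: d01. Qed.

(** The factor [c0 / 8] is what [lyap_trace_le] leaves. On survival s^2 <= 8 M^2 + r^2 <= (3 M +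
    1)^2, hence the bound [3 * M + 1] fed to [lyap_ratio_ge]. *)
Definition survive_rate := c0 / 8 * Num.min (k / 6) (3 * M + 1)^-1.

Let bS l m i : (m <= l)%N -> bmeas (A l : set (T_ l)) (fun w => S m w ord0 i).
Proof.
move=> ml; split; first exact: measurable_walk_coord.
exists M => w /(_ m ml)[_]; apply: le_trans.
rewrite -sqrtr_sqr; apply: ler_wsqrtr.
by rewrite expr2 /dotv (bigD1 i)//= lerDl sumr_ge0// => j _; rewrite -expr2 sqr_ge0.
Qed.

Let nearA l w : A l w -> near_wedge u v (k / 16) (3 * r) (S l w).
Proof. by move=> /(_ l (leqnn l))[]. Qed.

Let mA l : measurable (A l : set (T_ l)).
Proof. exact: measurable_survive. Qed.

Let mAP l : measurable (A l).
Proof. by apply: (grid_sigma_measurable HX (J := walk_past phi l)); exact: mA. Qed.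

Let moments : [/\ s ^+ 2 <= 8 * grid_var s, 0 <= grid_quartic s &
  grid_quartic s <= normal_moment_cst 2 * s ^+ 4].
Proof.
rewrite /grid_var /grid_quartic; have i1 := normal_even_moment_le 1 s0.
have i2 := normal_even_moment_le 2 s0; have i3 := normal_sqr_ge s0.
have fin q : (\int[normal_prob 0 s]_x (x ^+ q.*2)%:E)%E \is a fin_num.
  rewrite ge0_fin_numE; last by apply: integral_ge0 => x _; rewrite lee_fin normal_even_ge0.
  exact: le_lt_trans (normal_even_moment_le q s0) (ltry _).
split.
- move: i3; rewrite -(fineK (fin 1)) lee_fin /=; lra.
- by apply: fine_ge0; apply: integral_ge0 => x _; rewrite lee_fin; exact: (normal_even_ge0 x 2).
- by move: i2; rewrite -(fineK (fin 2)) lee_fin.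
Qed.

(** Survival up to [l.+1] implies survival up to [l] and the Lyapunov function is nonnegative, so
    the indicator of the past event may replace that of the later one. Then [lyap_increment] applies
    pointwise and averages termwise. *)
Lemma survive_step l : (l < K)%N ->
  \int[P]_w (\1_(A l.+1) w * V (S l.+1 w)) <=
  \int[P]_w (\1_(A l) w * V (S l w)) - survive_rate * grid_var s * fine (P (A l)).
Proof.
move=> lK.
have mean f : bmeas (A l : set (T_ l)) f -> bmeas setT ((fun w => \1_(A l) w * f w) : T_ l -> R).
  by move=> bf; exact: (bmeas_indic (@subset_refl _ _) (@mA l) bf).
have bV m : bmeas (A m : set (T_ m)) (fun w => V (S m w)).
  by apply: bmeas_lyap => // i; exact: bS.
have meanV m : has_mean P (fun w => \1_(A m) w * V (S m w)) (\int[P]_w (\1_(A m) w * V (S m w))).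
  apply: has_mean_bmeas; have : bmeas setT ((fun w => \1_(A m) w * V (S m w)) : T_ m -> R).
    exact: (bmeas_indic (@subset_refl _ _) (@mA m) (bV m)).
  exact: (past_bmeas HX).
pose E f := \int[P]_w (\1_(A l) w * f w).
pose lin i w := lyap_lin u v k del r (S l w) i.
pose quad i j w := lyap_quad u v k del r s (S l w) i j.
pose quart w := lyap_quartic u v k del r s (S l w).
pose Y i w := X i (phi l) w.
have blin i : bmeas setT ((fun w => \1_(A l) w * lin i w) : T_ l -> R).
  by apply: mean; apply: bmeas_lyap_lin => //; [by move=> i'; exact: bS|exact: nearA].
have bquad i j : bmeas setT ((fun w => \1_(A l) w * quad i j w) : T_ l -> R).
  by apply: mean; apply: bmeas_lyap_quad => //; [by move=> i'; exact: bS|exact: nearA].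
have bquart : bmeas setT ((fun w => \1_(A l) w * quart w) : T_ l -> R).
  by apply: mean; apply: bmeas_lyap_quartic => //; [by move=> i'; exact: bS|exact: nearA].
have mlin : has_mean P (fun w => \sum_i (eps * ((\1_(A l) w * lin i w) * Y i w))) (\sum_(i < n) 0).
  apply: has_mean_sum => i; rewrite -(mulr0 eps); apply: has_meanZ.
  exact: (past_mean1 HX phi_inj lK (blin i)).
have mquad : has_mean P (fun w => \sum_i \sum_j ((\1_(A l) w * quad i j w) * (Y i w * Y j w)))
    (\sum_i \sum_j (E (quad i j) * (grid_var s * (i == j)%:R))).
  apply: has_mean_sum => i; apply: has_mean_sum => j.
  exact: (past_mean2 HX phi_inj lK (bquad i j)).
have mquart : has_mean P (fun w => \sum_i ((\1_(A l) w * quart w) * Y i w ^+ 4))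
    (\sum_(i < n) E quart * grid_quartic s).
  by apply: has_mean_sum => i; exact: (past_mean4 HX phi_inj lK bquart).
have mstep := has_meanD (has_meanD (has_meanD (meanV l) mlin) mquad) mquart.
have le1 := has_mean_le (meanV l.+1) mstep.
apply: (le_trans (le1 _)) => {le1}.
  move=> w; case: (boolP (w \in A l)) => [wA|wA]; last first.
    have wA1 : w \notin A l.+1.
      by apply: contraNN wA; rewrite !inE; apply: survive_anti.
    rewrite !indicE (negbTE wA) (negbTE wA1) !mul0r add0r.
    rewrite !big1 ?addr0// => i _; rewrite ?mul0r ?mulr0//.
    by rewrite big1// => j _; rewrite !mul0r.
  rewrite !indicE wA mul1r.
  apply: (@le_trans _ _ (V (S l.+1 w))).
    by rewrite ler_piMl ?lyap_ge0//; case: (_ \in _).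
  rewrite walkS; set g := eps *: _.
  have gE i : g ord0 i = eps * Y i w by rewrite !mxE.
  have := lyap_increment u2 v2 g k0 d01 k1 s0 r0 (nearA (set_mem wA)).
  move=> /le_trans; apply; rewrite le_eqVlt; apply/orP; left; apply/eqP.
  congr (_ + _ + _ + _).
  - by apply: eq_bigr => i _; rewrite gE mul1r mulrCA.
  - apply: eq_bigr => i _; apply: eq_bigr => j _; rewrite !gE mul1r.
    by congr (_ * _); rewrite mulrACA -expr2 eps2 mul1r.
  - apply: eq_bigr => i _; rewrite gE mul1r exprMn.
    by rewrite (exprM eps 2 2) eps2 expr1n mul1r.
have [m1 m2 m3] := moments.
have mE f : bmeas setT ((fun w => \1_(A l) w * f w) : T_ l -> R) ->
    has_mean P (fun w => \1_(A l) w * f w) (E f).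
  by move=> bf; apply: has_mean_bmeas; exact: (past_bmeas HX bf).
have mfin := has_meanD (meanV l) (has_meanD
  (has_meanZ (grid_var s) (has_mean_sum (fun i => mE _ (bquad i i))))
  (has_meanZ (n%:R * grid_quartic s) (mE _ bquart))).
(* After averaging over the step only the diagonal quadratic and the quartic coefficients remain;
   their pointwise bound by the negative drift is integrated over the survival event. *)
have le2 := has_mean_le mfin (has_meanD (meanV l)
  (has_meanZ (- (survive_rate * grid_var s)) (has_mean_indic P (@mAP l)))).
apply: (le_trans _ (le_trans (le2 _) _)) => {le2}.
- rewrite sumr_const mul0rn addr0 -addrA lerD2l; apply: lerD.
    rewrite mulr_sumr le_eqVlt; apply/orP; left; apply/eqP; apply: eq_bigr => i _.
    rewrite (bigD1 i)//= eqxx mulr1 big1 ?addr0 1?mulrC// => j ji.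
    by rewrite eq_sym (negbTE ji) !mulr0.
  rewrite sumr_const card_ord -mulr_natl le_eqVlt; apply/orP; left; apply/eqP; ring.
- move=> w; rewrite lerD2l !indicE; case: (boolP (w \in A l)) => wA; last first.
    by rewrite !mul0r big1 ?mulr0 ?addr0// => i _; rewrite mul0r.
  rewrite !mul1r mulr1.
  have near := nearA (set_mem wA).
  have tr := lyap_trace_le (S l w) k0 d01 s0 r0 c00 cu cv erefl h1 h2 m2 m3 m1.
  have sle : lyap_s u v r (S l w) <= 3 * M + 1.
    have [_ yM] := set_mem wA l (leqnn l).
    have ub := dotv_norm_le (S l w) (ler0n _ _) u2; have vb := dotv_norm_le (S l w) (ler0n _ _) v2.
    have q0 : 0 <= Num.sqrt (dotv (S l w) (S l w)) by exact: sqrtr_ge0.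
    have ub' := sqr_le_of_norm (le_trans ub (ler_wpM2l (ler0n _ 2) yM)).
    have vb' := sqr_le_of_norm (le_trans vb (ler_wpM2l (ler0n _ 2) yM)).
    rewrite -(ler_pXn2r (ltn0Sn 1)) ?nnegrE ?sqrtr_ge0 ?addr_ge0 ?mulr_ge0//.
    rewrite lyap_s_sqr; move: ub' vb'; rewrite !exprMn; have := r0; have := r1; have := M0.
    by move=> ? ? ?; nra.
  have ratio := lyap_ratio_ge u2 v2 k0 k1 d01 r0 near sle.
  have m10 : 0 <= grid_var s by have := exprn_gt0 2 s0; lra.
  move: tr; rewrite /quad /quart.
  set Z := _ `^ del / _ in ratio *; move=> tr.
  rewrite [X in _ * X + _](eq_bigr (fun i => lyap_quad u v k del r s (S l w) i i)); last first.
    by move=> i _; rewrite mul1r.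
  apply: (@le_trans _ _ (- (c0 / 8 * grid_var s * Z))).
    by apply: le_trans tr; rewrite lerD2l -[leLHS]mulrA (mulrC (grid_quartic s)).
  rewrite lerN2 /survive_rate [leLHS]mulrAC; apply: ler_wpM2l ratio.
  by apply: mulr_ge0 => //; rewrite divr_ge0.
by rewrite mulNr.
Qed.

(** Telescoping of [survive_step]: each drop is at least the one computed with the final, smallest
    survival probability, and the total drop cannot exceed the value at the apex. *)
Lemma survive_le : 0 <= survive_rate ->
  K%:R * (survive_rate * grid_var s) * fine (P (A K)) <= (52 * r) `^ (1 + del).
Proof.
move=> rate0.
have [m1 _ _] := moments.
have m10 : 0 <= grid_var s by have := exprn_gt0 2 s0; lra.
have P0 l : 0 <= fine (P (A l)) by exact: fine_ge0.
have PK l : (l <= K)%N -> fine (P (A K)) <= fine (P (A l)).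
  move=> lK; apply: fine_le; rewrite ?fin_num_measure//.
  by apply: le_measure; rewrite ?inE//; exact: survive_anti.
have ind l : (l <= K)%N ->
    l%:R * (survive_rate * grid_var s) * fine (P (A K)) <=
    (52 * r) `^ (1 + del) - \int[P]_w (\1_(A l) w * V (S l w)).
  elim: l => [_|l ih lK].
    rewrite !mul0r subr_ge0.
    have V0 := lyap0_le u v k0 del0 (ltW r0).
    have -> : \int[P]_w (\1_(A 0) w * V (S 0 w)) = \int[P]_w (V 0 * \1_(A 0) w).
      by apply: eq_Rintegral => w _; rewrite walk0 mulrC.
    have [_ ->] := has_meanZ (V 0) (has_mean_indic P (@mAP 0)).
    apply: le_trans V0; rewrite -[leRHS]mulr1; apply: ler_wpM2l; first exact: lyap_ge0.
    by rewrite -lee_fin fineK ?fin_num_measure//; exact: probability_le1.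
  rewrite -natr1 (mulrDl l%:R) mul1r (mulrDl (l%:R * _)); apply: (ler_telescope (ih (ltnW lK)) (survive_step lK)).
  by apply: ler_wpM2l (PK l (ltnW lK)); exact: mulr_ge0.
apply: (le_trans (ind K (leqnn K))); rewrite gerBl.
apply: Rintegral_ge0 => w _; apply: mulr_ge0 (lyap_ge0 _ _ _ _ _ _).
by rewrite indicE.
Qed.

End walk_estimate.

(** * Borel-Cantelli and dyadic chaining *)

Lemma borel_cantelli_geometric (R : realType) d (T : measurableType d)
  (P : probability T R) (F : nat -> set T) (c x : R) :
  (forall n, measurable (F n)) -> 0 <= c -> 0 < x -> x < 1 ->
  (forall n, P (F n) <= (c * x ^+ n)%:E)%E -> P (lim_sup_set F) = 0%E.
Proof.
move=> mF c0 x0 x1 PF; apply: lim_sup_set_cvg0 => //.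
apply: (@le_lt_trans _ _ (c / (1 - x))%:E); last exact: ltry.
apply: lime_le; first by apply: is_cvg_nneseries => n _ _; exact: measure_ge0.
apply: nearW => n; apply: (@le_trans _ _ (\sum_(0 <= i < n) (c * x ^+ i)%:E)%E).
  by apply: lee_sum => i _; exact: PF.
rewrite sumEFin lee_fin; apply: le_trans (geometric_le_lim n c0 x0 _).
  by rewrite /series/=.
by rewrite gtr0_norm.
Qed.

Section chaining.
Context {R : realType}.

Definition grid_time (N j : nat) : R := j%:R / N%:R.

Lemma grid_time_double l j : grid_time (2 ^ l.+1) j.*2 = grid_time (2 ^ l) j.
Proof.
rewrite /grid_time -muln2 expnS mulnC !natrM -mulf_div mulfV ?mul1r//.
Qed.

Lemma truncn_grid (x : R) N : (0 < N)%N -> 0 <= x ->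
  grid_time N (Num.truncn (x * N%:R)) <= x < grid_time N (Num.truncn (x * N%:R)).+1.
Proof.
move=> N0 x0; have N0' : 0 < N%:R :> R by rewrite ltr0n.
have := truncn_itv (mulr_ge0 x0 (ltW N0')) => /andP[a b].
by rewrite /grid_time ler_pdivrMr// ltr_pdivlMr// a b.
Qed.

(** The dyadic points below [x] at levels l and l + 1 are equal or neighbours at level l + 1, so the
    increments along the chain are bounded by a geometric series; continuity at [x] closes the
    chain. *)
Lemma dyadic_chaining (f : R -> R) (z : R) (m : nat) (x : R) :
  0 < z -> z < 1 ->
  (forall l, (m <= l)%N -> forall j, (j < 2 ^ l)%N ->
    `|f (grid_time (2 ^ l) j.+1) - f (grid_time (2 ^ l) j)| <= z ^+ l) ->
  0 <= x <= 1 ->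
  (forall e, 0 < e -> exists2 del, 0 < del & forall y, 0 <= y -> `|y - x| < del ->
    `|f y - f x| < e) ->
  `|f x - f (grid_time (2 ^ m) (Num.truncn (x * (2 ^ m)%:R)))| <= z ^+ m / (1 - z).
Proof.
move=> z0 z1 fz /andP[x0 x1] fc.
pose a l := Num.truncn (x * (2 ^ l)%:R).
pose xl l := grid_time (2 ^ l) (a l).
have p0 l : (0 < 2 ^ l)%N by rewrite expn_gt0.
have p0' l : 0 < (2 ^ l)%:R :> R by rewrite ltr0n.
have step l : (m <= l)%N -> `|f (xl l.+1) - f (xl l)| <= z ^+ l.+1.
  move=> ml.
  have e0 : 0 <= x * (2 ^ l)%:R by rewrite mulr_ge0// ltW.
  have e1 : 0 <= x * (2 ^ l.+1)%:R by rewrite mulr_ge0// ltW.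
  have /andP[la ua] := truncn_itv e0.
  have xE : x * (2 ^ l.+1)%:R = x * (2 ^ l)%:R * 2 by rewrite expnS natrM; ring.
  have le1 : ((a l).*2 <= a l.+1)%N.
    by rewrite truncn_ge_nat// xE -muln2 natrM ler_pM2r.
  have le2 : (a l.+1 < (a l).*2.+2)%N.
    by rewrite truncn_lt_nat// xE -doubleS -muln2 natrM ltr_pM2r.
  have le3 : (a l.+1 <= 2 ^ l.+1)%N.
    rewrite -(ler_nat R); have /andP[h _] := truncn_itv e1.
    by apply: (le_trans h); rewrite ler_piMl// ltW.
  have [e|ne] := eqVneq (a l.+1) (a l).*2.
    by rewrite /xl e grid_time_double subrr normr0 exprn_ge0// ltW.
  have e : a l.+1 = (a l).*2.+1.
    by apply/eqP; rewrite eqn_leq -ltnS le2/= ltn_neqAle eq_sym ne le1.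
  rewrite /xl e -(grid_time_double l); apply: fz; first exact: leqW.
  by rewrite -e.
have tele k : `|f (xl (m + k)%N) - f (xl m)| <= \sum_(i < k) z ^+ (m + i).+1.
  elim: k => [|k ih]; first by rewrite addn0 subrr normr0 big_ord0.
  rewrite big_ord_recr/= addnS.
  have -> : f (xl (m + k).+1) - f (xl m) =
    (f (xl (m + k)%N) - f (xl m)) + (f (xl (m + k).+1) - f (xl (m + k)%N)) by ring.
  apply: (le_trans (ler_normD _ _)); apply: lerD => //.
  by apply: step; exact: leq_addr.
have geo k : \sum_(i < k) z ^+ (m + i).+1 <= z ^+ m / (1 - z).
  apply: (@le_trans _ _ (series (geometric (z ^+ m) z) k)).
    rewrite /series/= big_mkord; apply: ler_sum => i _.
    rewrite -exprD; apply: ler_wiXn2l => //; [exact: ltW|exact: ltW].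
  by apply: geometric_le_lim => //; [rewrite exprn_ge0// ltW|rewrite gtr0_norm].
rewrite leNgt; apply/negP => lt.
set e := `|_| in lt; pose ep := e - z ^+ m / (1 - z).
have ep0 : 0 < ep by rewrite subr_gt0.
have [del del0 fdel] := fc _ ep0.
pose l := Num.Def.archi_bound del^-1.
have ll : del^-1 < 2 ^+ (m + l).
  by apply: upper_nthrootP; exact: leq_addl.
have xlx : `|xl (m + l)%N - x| < del.
  have /andP[h1 h2] := truncn_grid (p0 (m + l)%N) x0.
  rewrite distrC ger0_norm ?subr_ge0// ltrBlDl.
  apply: (lt_le_trans h2); rewrite /xl /a {1}/grid_time -natr1 mulrDl.
  rewrite lerD2l mul1r natrX -[leRHS]invrK lef_pV2 ?posrE ?invr_gt0 ?exprn_gt0//.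
  exact: ltW.
have xl0 : 0 <= xl (m + l)%N by rewrite divr_ge0// ltW.
have h := fdel _ xl0 xlx.
have := le_trans (tele l) (geo l).
have : e <= `|f (xl (m + l)%N) - f x| + `|f (xl (m + l)%N) - f (xl m)|.
  rewrite /e -/(a m) -/(xl m) [`|f (xl (m + l)%N) - f x|]distrC.
  by apply: (le_trans _ (ler_normD _ _)); rewrite le_eqVlt; apply/orP; left; apply/eqP; congr `|_|; ring.
by move: h; rewrite /ep; lra.
Qed.

End chaining.

(** * Brownian increments on dyadic grids *)

Section brownian_grid.
Context {R : realType} {n : nat} {d} {T : measurableType d} (P : probability T R).
Variable B : R -> T -> 'rV[R]_n.
Hypothesis HB : standard_brownian_motion P B.

Definition grid_incr (N : nat) (i : 'I_n) (j : nat) (w : T) : R :=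
  B (grid_time N j.+1) w ord0 i - B (grid_time N j) w ord0 i.

Lemma grid_time_ge0 N j : 0 <= grid_time N j :> R.
Proof. by rewrite divr_ge0. Qed.

Lemma grid_timeS N j : grid_time N j.+1 - grid_time N j = N%:R^-1 :> R.
Proof. by rewrite /grid_time -mulrBl -natr1 addrAC subrr add0r mul1r. Qed.

Lemma brownian_gaussian_grid N : (0 < N)%N ->
  gaussian_grid P (fun i (j : 'I_N) => grid_incr N i j) (Num.sqrt N%:R^-1).
Proof.
move=> N0; have N0' : 0 < N%:R^-1 :> R by rewrite invr_gt0 ltr0n.
have [_ _ mB HP] := HB; split.
- by rewrite sqrtr_gt0.
- by move=> i j; apply: measurable_funB; apply: mB; exact: grid_time_ge0.
move=> A mA.
(* The law of [B] is given for constraints indexed by all naturals, hence the extension by [setT]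
   off the grid. *)
pose A' i j := if insub j is Some j' then A i (j' : 'I_N) else setT.
have t0 : grid_time N 0 = 0 :> R by rewrite /grid_time mul0r.
have tlt j : (j < N)%N -> grid_time N j < grid_time N j.+1 :> R.
  by move=> _; rewrite -subr_gt0 grid_timeS.
have mA' i j : measurable (A' i j) by rewrite /A'; case: insub.
have := HP N (grid_time N) t0 tlt A' mA'.
rewrite (_ : [set w | _] = [set w | forall i (j : 'I_N), A i j (grid_incr N i j w)]); last first.
  apply/seteqP; split => w /= h i j; first by have := h i j (ltn_ord j); rewrite /A' valK.
  by move=> jN; rewrite /A' insubT; exact: (h i (Ordinal jN)).
move=> ->; rewrite (pair_bigA _ (fun i (j : 'I_N) => normal_prob 0
  (Num.sqrt (grid_time N j.+1 - grid_time N j)) (A' i j)))/=.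
by apply: eq_bigr => -[i j] _; rewrite /= grid_timeS /A' valK.
Qed.

Definition coarse_incr (z : R) (l : nat) : set T :=
  [set w | exists i, exists2 j, (j < 2 ^ l)%N & z ^+ l < `|grid_incr (2 ^ l) i j w|].

Lemma measurable_coarse_incr z l : measurable (coarse_incr z l).
Proof.
rewrite (_ : coarse_incr z l = \bigcup_(i in [set: 'I_n]) \bigcup_(j in [set j | (j < 2 ^ l)%N])
  [set w | z ^+ l < `|grid_incr (2 ^ l) i j w|]); last first.
  apply/seteqP; split=> w /=; first by move=> [i [j jl h]]; exists i => //; exists j.
  by move=> [i _ [j jl h]]; exists i, j.
apply: fin_bigcup_measurable; first exact: finite_finset.
move=> i _; apply: bigcup_measurable => j _.
have [_ _ mB _] := HB.
rewrite -[X in measurable X]setTI.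
apply: (measurable_fun_ltr (f := cst (z ^+ l)) (g := fun w => `|grid_incr (2 ^ l) i j w|)
  _ _ measurableT (Y := [set true]) Logic.I).
  exact: measurable_cst.
apply: measurableT_comp; first exact: normr_measurable.
by apply: measurable_funB; apply: mB; exact: grid_time_ge0.
Qed.

(** Markov's inequality for the moment of order 2q, summed over the n 2^l increments. When 2 z^2 > 1
    a large [q] brings the ratio below one. *)
Lemma coarse_incr_le z q l : 0 < z ->
  (P (coarse_incr z l) <= (n%:R * normal_moment_cst q * (2 / (2 * z ^+ 2) ^+ q) ^+ l)%:E)%E.
Proof.
move=> z0; set N := (2 ^ l)%N.
have N0 : (0 < N)%N by rewrite expn_gt0.
have HX := brownian_gaussian_grid N0.
have [s0 mX _] := HX; set s := Num.sqrt _ in HX s0.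
have zl0 : 0 < z ^+ l by exact: exprn_gt0.
pose X (ij : 'I_n * 'I_N) w := grid_incr N ij.1 ij.2 w.
have mean ij : has_mean P (fun w => (z ^+ l) ^- q.*2 * X ij w ^+ q.*2)
   ((z ^+ l) ^- q.*2 * \int[P]_w X ij w ^+ q.*2).
  apply: has_meanZ; split => //.
  exact: (integrable_normal_law_even s0 (mX ij.1 ij.2) (grid_law HX ij)).
have msum := has_mean_sum mean.
have mcoarse := measurable_coarse_incr z l.
rewrite -(fineK (fin_num_measure P _ mcoarse)) lee_fin.
apply: (le_trans (has_mean_le (has_mean_indic P mcoarse) msum _)).
  move=> w; rewrite indicE.
  have ge0 ij : 0 <= (z ^+ l) ^- q.*2 * X ij w ^+ q.*2.
    by apply: mulr_ge0 (normal_even_ge0 _ _); rewrite invr_ge0 exprn_ge0// ltW.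
  case: (boolP (w \in coarse_incr z l)) => [|_]; last by apply: sumr_ge0 => ij _; exact: ge0.
  rewrite inE => -[i [j jN h]].
  rewrite (bigD1 (i, Ordinal jN))//=; apply: (@le_trans _ _ ((z ^+ l) ^- q.*2 * X (i, Ordinal jN) w ^+ q.*2)); last first.
    by rewrite lerDl; apply: sumr_ge0 => ij _; exact: ge0.
  have evenE (x : R) : x ^+ q.*2 = `|x| ^+ q.*2.
    by rewrite -mul2n !exprM real_normK ?num_real.
  rewrite [X in _ * X]evenE mulrC ler_pdivlMr ?exprn_gt0// mul1r.
  by apply: lerXn2r; rewrite ?nnegrE ?normr_ge0 ?(ltW zl0)// ltW.
apply: (@le_trans _ _ (\sum_(ij : 'I_n * 'I_N) (z ^+ l) ^- q.*2 * (normal_moment_cst q * s ^+ q.*2))).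
  apply: ler_sum => ij _; apply: ler_wpM2l.
    by rewrite invr_ge0 exprn_ge0// ltW.
  exact: (Rintegral_normal_law_even_le s0 (mX ij.1 ij.2) (grid_law HX ij)).
rewrite sumr_const card_prod !card_ord -[X in X <= _]mulr_natl natrM.
have sE : s ^+ q.*2 = (2 ^- l) ^+ q.
  by rewrite -mul2n exprM sqr_sqrtr ?invr_ge0// natrX.
have -> : (2 / (2 * z ^+ 2) ^+ q) ^+ l = 2 ^+ l / ((2 ^+ l) ^+ q * (z ^+ l) ^+ q.*2).
  rewrite expr_div_n; congr (_ / _).
  rewrite -exprM mulnC exprM !exprMn; congr (_ * _).
  by rewrite -!exprM -exprD addnn mulnC doubleMr.
rewrite sE natrX exprVn invfM le_eqVlt; apply/orP; left; apply/eqP.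
move: ((z ^+ l) ^- q.*2) ((2 ^+ l) ^- q) => x y; ring.
Qed.

End brownian_grid.

(** * Forward and backward walks from a grid time *)

Section two_sided.
Context {R : realType} {n : nat} {d} {T : measurableType d} (P : probability T R).
Variable B : R -> T -> 'rV[R]_n.
Hypothesis HB : standard_brownian_motion P B.
Variable N : nat.
Hypothesis N0 : (0 < N)%N.

Local Notation X := (fun i (j : 'I_N) => grid_incr B N i j).
Let HX : gaussian_grid P X (Num.sqrt N%:R^-1) := brownian_gaussian_grid HB N0.
Let o : 'I_N := Ordinal N0.

(** Step [l] forward uses increment j0 + l; step [l] backward uses the increment that ends at j0 -
    l, whose index is [j0 - l.+1]. The value [o] is a default for indices off the grid. *)
Definition forward (j0 l : nat) : 'I_N := insubd o (j0 + l)%N.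
Definition backward (j0 l : nat) : 'I_N := insubd o (j0 - l.+1)%N.

Lemma forward_inj j0 : {in [pred l | (l < N - j0)%N] &, injective (forward j0)}.
Proof.
move=> a b; rewrite !inE !ltn_subRL => aN bN /(congr1 val); rewrite !val_insubd aN bN.
by move=> /eqP; rewrite eqn_add2l => /eqP.
Qed.

Lemma backward_lt j0 l : (j0 <= N)%N -> (l < j0)%N -> (j0 - l.+1 < N)%N.
Proof. by move=> jN lj; apply: leq_trans jN; rewrite ltn_subrL (leq_ltn_trans _ lj). Qed.

Lemma backward_inj j0 : (j0 <= N)%N -> {in [pred l | (l < j0)%N] &, injective (backward j0)}.
Proof.
move=> jN a b; rewrite !inE => aj bj /(congr1 val).
rewrite !val_insubd !backward_lt// => e.
have := congr1 (fun x => j0 - x)%N e; rewrite !subKn//.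
by case.
Qed.

Lemma forward_walk j0 l w : (j0 + l <= N)%N ->
  walk X (forward j0) 1 l w = B (grid_time N (j0 + l)) w - B (grid_time N j0) w.
Proof.
elim: l => [_|l ih jl]; first by rewrite walk0 addn0 subrr.
rewrite walkS ih; last by apply: leq_trans jl; rewrite addnS.
apply/rowP => i; rewrite !mxE mul1r /grid_incr val_insubd.
by rewrite -addnS jl addnS; ring.
Qed.

Lemma backward_walk j0 l w : (j0 <= N)%N -> (l <= j0)%N ->
  walk X (backward j0) (-1) l w = B (grid_time N (j0 - l)) w - B (grid_time N j0) w.
Proof.
move=> jN; elim: l => [_|l ih jl]; first by rewrite walk0 subn0 subrr.
rewrite walkS ih; last exact: ltnW.
apply/rowP => i; rewrite !mxE /grid_incr val_insubd backward_lt//.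
by rewrite -subSn// subSS; ring.
Qed.

Variables (u v : 'rV[R]_n) (eta h M : R).

Definition near_increment (w : T) (j0 j : nat) :=
  let y := B (grid_time N j) w - B (grid_time N j0) w in
  near_wedge u v eta h y /\ Num.sqrt (dotv y y) <= M.

Definition near_future j0 : set T :=
  [set w | forall j, (j0 <= j <= N)%N -> near_increment w j0 j].
Definition near_past j0 : set T :=
  [set w | forall j, (j <= j0)%N -> near_increment w j0 j].

Lemma near_futureE j0 : (j0 <= N)%N ->
  near_future j0 = survive X (forward j0) 1 u v eta h M (N - j0).
Proof.
move=> jN; apply/seteqP; split=> w h' /=.
  move=> l lN; have jl : (j0 + l <= N)%N by rewrite -leq_subRL.
  by rewrite forward_walk//; apply: h'; rewrite leq_addr.
move=> j /andP[j0j jN']; have := h' (j - j0)%N (leq_sub2r _ jN').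
by rewrite forward_walk subnKC.
Qed.

Lemma near_pastE j0 : (j0 <= N)%N ->
  near_past j0 = survive X (backward j0) (-1) u v eta h M j0.
Proof.
move=> jN; apply/seteqP; split=> w h' /=.
  by move=> l lj; rewrite backward_walk//; apply: h'; exact: leq_subr.
move=> j jj0; have := h' (j0 - j)%N (leq_subr _ _).
by rewrite backward_walk ?leq_subr// subKn.
Qed.

(** The forward walk uses increments of index at least [j0], the backward walk those below [j0]. *)
Lemma near_future_past_indep j0 : (j0 <= N)%N ->
  P (near_future j0 `&` near_past j0) = (P (near_future j0) * P (near_past j0))%E.
Proof.
move=> jN; rewrite near_futureE// near_pastE//.
apply: (grid_indep HX (J1 := walk_past (forward j0) (N - j0)) (J2 := walk_past (backward j0) j0)).
- move=> ij /existsP[a /eqP ea]; apply/negP => /existsP[b /eqP eb].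
  have := congr1 val (etrans (esym ea) eb); rewrite !val_insubd backward_lt//.
  have aN : (j0 + a < N)%N by rewrite -ltn_subRL.
  rewrite aN => e; have : (j0 + a < j0)%N.
    by rewrite e ltn_subrL (leq_ltn_trans _ (ltn_ord b)).
  by rewrite ltnNge leq_addr.
- exact: measurable_survive.
- exact: measurable_survive.
Qed.

Lemma measurable_near_future j0 : (j0 <= N)%N -> measurable (near_future j0).
Proof.
move=> jN; rewrite near_futureE//.
by apply: (grid_sigma_measurable HX (J := walk_past (forward j0) (N - j0))); exact: measurable_survive.
Qed.

Lemma measurable_near_past j0 : (j0 <= N)%N -> measurable (near_past j0).
Proof.
move=> jN; rewrite near_pastE//.
by apply: (grid_sigma_measurable HX (J := walk_past (backward j0) j0)); exact: measurable_survive.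
Qed.

End two_sided.

(** * Choice of the constants *)

Section constants.
Context {R : realType} (n : nat) (c0 : R).

(** Chosen together with [wedge_del] so that [3 * k] and [294 * del / k] each equal c0 / (32 (n +
    1)); [n.+1] keeps the denominators positive. *)
Definition wedge_k : R := c0 / (96 * n.+1%:R).
Definition wedge_del : R := wedge_k * c0 / (294 * 32 * n.+1%:R).

Hypotheses (c00 : 0 < c0) (c04 : c0 <= 4).

Lemma wedge_k_gt0 : 0 < wedge_k.
Proof. by rewrite divr_gt0// mulr_gt0// ltr0n. Qed.

Lemma wedge_k_le1 : wedge_k <= 1.
Proof.
rewrite ler_pdivrMr ?mulr_gt0 ?ltr0n// mul1r.
apply: (le_trans c04); have : 1 <= n.+1%:R :> R by rewrite ler1n.
move=> ?; lra.
Qed.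

Lemma wedge_del_gt0 : 0 < wedge_del.
Proof.
by apply: divr_gt0; apply: mulr_gt0 => //; exact: wedge_k_gt0.
Qed.

Lemma wedge_del_le1 : wedge_del <= 1.
Proof.
have n1 : 1 <= n.+1%:R :> R by rewrite ler1n.
rewrite ler_pdivrMr; last by apply: mulr_gt0; [exact: mulr_gt0|rewrite ltr0n].
rewrite mul1r; apply: (@le_trans _ _ (1 * 4)).
  by apply: ler_pM => //; [exact: ltW wedge_k_gt0|exact: ltW|exact: wedge_k_le1].
lra.
Qed.

Lemma wedge_constants_le :
  n%:R * (3 * wedge_k + 294 * wedge_del / wedge_k) <= c0 / 16.
Proof.
have n1 : 0 < n.+1%:R :> R by rewrite ltr0n.
have k0 := wedge_k_gt0.
have -> : 3 * wedge_k + 294 * wedge_del / wedge_k = c0 / 16 / n.+1%:R.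
  rewrite /wedge_del {1}/wedge_k; field; rewrite !gt_eqF//.
rewrite mulrA ler_pdivrMr// mulrC; apply: ler_wpM2l; first by rewrite divr_ge0// ltW.
by rewrite ler_nat.
Qed.

End constants.

Lemma geometric_small (R : realType) (c x e : R) : 0 < x -> x < 1 -> 0 < e ->
  exists m0, forall m, (m0 <= m)%N -> c * x ^+ m <= e.
Proof.
move=> x0 x1 e0; have x1' : `|x| < 1 by rewrite gtr0_norm.
have /cvgrPdist_lt /(_ _ e0) [m0 _ hm] := cvg_geometric c x1'.
exists m0 => m m0m; have := hm m m0m; rewrite /= sub0r normrN => h.
by apply: ltW; apply: le_lt_trans h; exact: ler_norm.
Qed.

Lemma grid_var_ge (R : realType) (s : R) : 0 < s -> s ^+ 2 <= 8 * grid_var s.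
Proof.
move=> s0; have := normal_sqr_ge s0.
have fin : (\int[normal_prob 0 s]_x (x ^+ 2)%:E)%E \is a fin_num.
  rewrite ge0_fin_numE; last by apply: integral_ge0 => x _; rewrite lee_fin sqr_ge0.
  exact: le_lt_trans (normal_even_moment_le 1 s0) (ltry _).
rewrite -(fineK fin) lee_fin -/(grid_var s); lra.
Qed.

(** * Decay of the survival probabilities and null events *)

Section decay.
Context {R : realType} {n : nat} {d} {T : measurableType d} (P : probability T R).
Variable B : R -> T -> 'rV[R]_n.
Hypothesis HB : standard_brownian_motion P B.
Variables (u v : 'rV[R]_n) (c0 M C1 : R).
Hypotheses (c00 : 0 < c0) (M0 : 0 <= M) (C10 : 0 < C1).
Hypotheses (u2 : dotv u u <= 2 ^+ 2) (v2 : dotv v v <= 2 ^+ 2).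
Hypotheses (cu : c0 <= dotv u u - `|dotv u v|) (cv : c0 <= dotv v v - `|dotv u v|).

Let k : R := wedge_k n c0.
Let del : R := wedge_del n c0.
Let rate := survive_rate c0 k M.

Let c04 : c0 <= 4.
Proof.
apply: (le_trans cu); rewrite lerBlDr; apply: (le_trans u2).
by rewrite -natrX lerDl.
Qed.

Let k0 : 0 < k. Proof. exact: wedge_k_gt0. Qed.
Let k1 : k <= 1. Proof. exact: wedge_k_le1. Qed.
Let del0 : 0 < del. Proof. exact: wedge_del_gt0. Qed.
Let del01 : 0 <= del <= 1. Proof. by rewrite ltW//=; exact: wedge_del_le1. Qed.

Let rate0 : 0 < rate.
Proof.
apply: mulr_gt0; first exact: divr_gt0.
by rewrite lt_min divr_gt0//= invr_gt0 ltr_wpDl// mulr_ge0.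
Qed.

(** Collects the constants of the third- and fourth-order errors. The condition on [D] times step
    over [r] asks for steps much shorter than the smoothing scale. *)
Let D : R := (1 + 172 * (6 / k) ^+ 2) * (2 * n%:R + 128 * n%:R ^+ 2 * normal_moment_cst 2).

(** At least a N steps, each of variance at least 1 / (8 N), have total variance at least a / 8;
    hence the factor [8 / (a * rate)]. *)
Lemma survive_grid_le (N K : nat) (r : R) (phi : nat -> 'I_N) (eps a : R) : (0 < N)%N ->
  {in [pred l | (l < K)%N] &, injective phi} -> eps ^+ 2 = 1 ->
  0 < r -> r <= 1 -> D * (Num.sqrt N%:R^-1 / r) <= c0 / 16 ->
  0 < a -> a * N%:R <= K%:R ->
  fine (P (survive (fun i (j : 'I_N) => grid_incr B N i j) phi eps u v (k / 16) (3 * r) M K)) <=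
  8 / (a * rate) * (52 * r) `^ (1 + del).
Proof.
move=> N0 phi_inj eps2 r0 r1 hD a0 aN.
have HX := brownian_gaussian_grid HB N0.
have h2 : (1 + 172 * (6 / k) ^+ 2) * (Num.sqrt N%:R^-1 / r) *
    (2 * n%:R + 128 * n%:R ^+ 2 * normal_moment_cst 2) <= c0 / 16.
  by rewrite mulrAC.
have := survive_le HX phi_inj eps2 k0 k1 del01 r0 r1 M0 (ltW c00) u2 v2 cu cv
  (wedge_constants_le n c00) h2 (ltW rate0).
set p := fine _; set Q := _ `^ _; set s := Num.sqrt _ => h.
have N0' : 0 < N%:R :> R by rewrite ltr0n.
have s0 : 0 < s by rewrite sqrtr_gt0 invr_gt0.
have p0 : 0 <= p by exact: fine_ge0.
have sv := grid_var_ge s0.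
have s2 : s ^+ 2 = N%:R^-1 by rewrite sqr_sqrtr// invr_ge0 ltW.
have ar0 : 0 < a * rate by exact: mulr_gt0.
rewrite mulrAC ler_pdivlMr//.
have h3 : a * N%:R * (rate * (N%:R^-1 / 8)) * p <= Q.
  apply: le_trans h; apply: ler_wpM2r => //; apply: ler_pM => //.
  - by apply: mulr_ge0; exact: ltW.
  - by apply: mulr_ge0; [exact: ltW|rewrite divr_ge0// invr_ge0 ltW].
  - apply: ler_wpM2l; first exact: ltW.
    by rewrite ler_pdivrMr// mulrC -s2.
have -> : p * (a * rate) = 8 * (a * N%:R * (rate * (N%:R^-1 / 8)) * p).
  by field; rewrite gt_eqF.
exact: ler_wpM2l.
Qed.

Lemma near_future_le (N j0 : nat) (r a : R) : (0 < N)%N -> (j0 <= N)%N ->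
  0 < r -> r <= 1 -> D * (Num.sqrt N%:R^-1 / r) <= c0 / 16 ->
  0 < a -> a * N%:R <= (N - j0)%:R ->
  fine (P (near_future B N u v (k / 16) (3 * r) M j0)) <= 8 / (a * rate) * (52 * r) `^ (1 + del).
Proof.
move=> N0 jN r0 r1 hD a0 aN; rewrite near_futureE//.
by apply: survive_grid_le => //; [exact: forward_inj|rewrite expr1n].
Qed.

Lemma near_past_le (N j0 : nat) (r a : R) : (0 < N)%N -> (j0 <= N)%N ->
  0 < r -> r <= 1 -> D * (Num.sqrt N%:R^-1 / r) <= c0 / 16 ->
  0 < a -> a * N%:R <= j0%:R ->
  fine (P (near_past B N u v (k / 16) (3 * r) M j0)) <= 8 / (a * rate) * (52 * r) `^ (1 + del).
Proof.
move=> N0 jN r0 r1 hD a0 aN; rewrite near_pastE//.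
by apply: survive_grid_le => //; [exact: backward_inj|rewrite sqrrN expr1n].
Qed.

(* Any z with 2^(-1/2) < z < 2^(-1/(2 + 2 del)) would do: below the first bound the
   oscillation on a grid step would exceed z^m, above the second the first moment bound
   2^m z^(2 m (1 + del)) would not be summable. *)
Definition wedge_z : R := expR (- (ln 2 / (2 + del))).

Let z := wedge_z.
Let r m := C1 * z ^+ m.
Let ev m := [/\ 0 < r m, r m <= 1 & D * (Num.sqrt (2 ^ m)%:R^-1 / r m) <= c0 / 16].

Let ln2 : 0 < ln 2 :> R. Proof. by rewrite ln_gt0// ltr1n. Qed.

Lemma wedge_z_gt0 : 0 < z. Proof. exact: expR_gt0. Qed.

Lemma wedge_z_lt1 : z < 1.
Proof. by rewrite expR_lt1 oppr_lt0 divr_gt0// addr_gt0. Qed.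

Let two : 2 = expR (ln 2) :> R. Proof. by rewrite lnK// posrE. Qed.

Lemma wedge_z_sqr : 1 < 2 * z ^+ 2.
Proof.
rewrite [X in X * _]two -expRM_natl -expRD expR_gt1.
have h : 0 < 2 + del by rewrite addr_gt0.
rewrite (_ : ln 2 + _ = ln 2 * (del / (2 + del))); first by rewrite mulr_gt0// divr_gt0.
by field; rewrite gt_eqF.
Qed.

Lemma wedge_z_pow : 2 * (z `^ (1 + del)) ^+ 2 < 1.
Proof.
rewrite [X in X * _]two /powR gt_eqF ?wedge_z_gt0// expRK.
rewrite -expRM_natl -expRD expR_lt1.
have h : 0 < 2 + del by rewrite addr_gt0.
rewrite (_ : ln 2 + _ = - (ln 2 * (del / (2 + del)))).
  by rewrite oppr_lt0 mulr_gt0// divr_gt0.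
by field; rewrite gt_eqF.
Qed.

(** The quotient of the step size 2^(-m/2) by z^m decays geometrically because 2 z^2 > 1. *)
Let eventually : exists m0, forall m, (m0 <= m)%N -> ev m.
Proof.
have z0 := wedge_z_gt0; have z1 := wedge_z_lt1.
pose y : R := Num.sqrt 2^-1 / z.
have y0 : 0 < y by rewrite divr_gt0// sqrtr_gt0 invr_gt0.
have y1 : y < 1.
  rewrite ltr_pdivrMr// mul1r -(ltr_pXn2r (ltn0Sn 1)) ?nnegrE ?sqrtr_ge0 ?(ltW z0)//.
  rewrite sqr_sqrtr ?invr_ge0// -[X in X < _]mul1r ltr_pdivrMr// mulrC.
  exact: wedge_z_sqr.
have [m1 h1] := geometric_small C1 z0 z1 ltr01.
have c16 : 0 < c0 / 16 by exact: divr_gt0.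
have [m2 h2] := geometric_small (D / C1) y0 y1 c16.
exists (maxn m1 m2) => m; rewrite geq_max => /andP[m1m m2m]; split.
- by rewrite mulr_gt0// exprn_gt0.
- exact: h1.
apply: le_trans (h2 m m2m); rewrite le_eqVlt; apply/orP; left; apply/eqP.
rewrite /r /y expr_div_n natrX -exprVn.
have -> : Num.sqrt (2^-1 ^+ m) = Num.sqrt 2^-1 ^+ m :> R.
  by elim: m {m1m m2m} => [|m ih]; rewrite ?sqrtr1// !exprS sqrtrM ?invr_ge0// ih.
by field; rewrite !gt_eqF ?exprn_gt0.
Qed.

Let powE m : (52 * r m) `^ (1 + del) = (52 * C1) `^ (1 + del) * (z `^ (1 + del)) ^+ m.
Proof.
have z0 := wedge_z_gt0.
have c1 : 0 <= 52 * C1 by exact: mulr_ge0 (ler0n _ _) (ltW C10).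
have c2 : 0 <= z ^+ m by rewrite exprn_ge0// ltW.
rewrite /r (mulrA 52 C1) (powRM _ c1 c2).
congr (_ * _).
rewrite -(powR_mulrn m (ltW z0)) -(powR_mulrn m (powR_ge0 _ _)).
by rewrite -!powRrM mulrC.
Qed.

Let zg0 : 0 < z `^ (1 + del). Proof. by rewrite powR_gt0// wedge_z_gt0. Qed.

Let zg1 : z `^ (1 + del) < 1.
Proof.
have h := wedge_z_pow; rewrite ltNge; apply/negP => le1.
have : 1 <= (z `^ (1 + del)) ^+ 2 by rewrite exprn_ege1.
by move: h; set t := (_ ^+ 2) => h1 h2; lra.
Qed.

Definition wedge_future m := near_future B (2 ^ m) u v (k / 16) (3 * r m) M.
Definition wedge_past m := near_past B (2 ^ m) u v (k / 16) (3 * r m) M.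

(** With the grid time fixed there is no sum over grid times, and the bound for one walk is already
    geometric in [m]. *)
Lemma wedge_start_negligible (S : set T) m1 :
  (forall m, (m1 <= m)%N -> S `<=` wedge_future m 0) -> P.-negligible S.
Proof.
move=> SE; have [m0 hm0] := eventually.
pose F m := wedge_future (maxn m0 m1 + m) 0.
have p0 m : (0 < 2 ^ m)%N by rewrite expn_gt0.
have mF m : measurable (F m) by exact: (measurable_near_future HB).
exists (lim_sup_set F); split.
- by apply: bigcap_measurable => // n' _; apply: bigcup_measurable => j _.
- pose c := 8 / (1 * rate) * (52 * C1) `^ (1 + del) * (z `^ (1 + del)) ^+ maxn m0 m1.
  apply: (borel_cantelli_geometric (c := c) mF _ zg0 zg1).
    apply: mulr_ge0; last by rewrite exprn_ge0// ltW.
    apply: mulr_ge0; last exact: powR_ge0.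
    by rewrite divr_ge0// mulr_ge0// ltW.
  move=> m; rewrite -(fineK (fin_num_measure P _ (mF m))) lee_fin.
  have [e1 e2 e3] := hm0 (maxn m0 m1 + m)%N (leq_trans (leq_maxl _ _) (leq_addr _ _)).
  apply: (le_trans (near_future_le (a := 1) (p0 _) (leq0n _) e1 e2 e3 ltr01 _)).
    by rewrite mul1r subn0.
  by rewrite powE exprD /c [leLHS]mulrA [leLHS]mulrA.
- move=> w Sw n' _; exists n' => //=.
  by apply: SE => //; exact: leq_trans (leq_maxr _ _) (leq_addr _ _).
Qed.

Lemma wedge_end_negligible (S : set T) m1 :
  (forall m, (m1 <= m)%N -> S `<=` wedge_past m (2 ^ m)) -> P.-negligible S.
Proof.
move=> SE; have [m0 hm0] := eventually.
pose F m := wedge_past (maxn m0 m1 + m) (2 ^ (maxn m0 m1 + m)).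
have p0 m : (0 < 2 ^ m)%N by rewrite expn_gt0.
have mF m : measurable (F m) by exact: (measurable_near_past HB).
exists (lim_sup_set F); split.
- by apply: bigcap_measurable => // n' _; apply: bigcup_measurable => j _.
- pose c := 8 / (1 * rate) * (52 * C1) `^ (1 + del) * (z `^ (1 + del)) ^+ maxn m0 m1.
  apply: (borel_cantelli_geometric (c := c) mF _ zg0 zg1).
    apply: mulr_ge0; last by rewrite exprn_ge0// ltW.
    apply: mulr_ge0; last exact: powR_ge0.
    by rewrite divr_ge0// mulr_ge0// ltW.
  move=> m; rewrite -(fineK (fin_num_measure P _ (mF m))) lee_fin.
  have [e1 e2 e3] := hm0 (maxn m0 m1 + m)%N (leq_trans (leq_maxl _ _) (leq_addr _ _)).
  apply: (le_trans (near_past_le (a := 1) (p0 _) (leqnn _) e1 e2 e3 ltr01 _)).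
    by rewrite mul1r.
  by rewrite powE exprD /c [leLHS]mulrA [leLHS]mulrA.
- move=> w Sw n' _; exists n' => //=.
  by apply: SE => //; exact: leq_trans (leq_maxr _ _) (leq_addr _ _).
Qed.

(** The cutoff [a] leaves both walks a time of at least [a], so one bound G serves all admissible
    grid times. At most 2^m + 1 <= 2 * 2^m of them contribute G^2 each, by independence of the two
    walks, and the resulting ratio is the one in [wedge_z_pow]. *)
Lemma wedge_middle_negligible (S : set T) (a : R) m1 : 0 < a ->
  (forall m, (m1 <= m)%N -> forall w, S w -> exists j0,
    [/\ (j0 <= 2 ^ m)%N, a * (2 ^ m)%:R <= j0%:R, a * (2 ^ m)%:R <= (2 ^ m - j0)%:R,
      wedge_future m j0 w & wedge_past m j0 w]) -> P.-negligible S.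
Proof.
move=> a0 SE; have [m0 hm0] := eventually.
have p0 m : (0 < 2 ^ m)%N by rewrite expn_gt0.
pose good m (j : 'I_(2 ^ m).+1) := (a * (2 ^ m)%:R <= j%:R) && (a * (2 ^ m)%:R <= (2 ^ m - j)%:R).
pose E m (j : 'I_(2 ^ m).+1) := wedge_future m j `&` wedge_past m j.
have mE m j : measurable (E m j).
  by apply: measurableI; [apply: (measurable_near_future HB)|apply: (measurable_near_past HB)] => //; rewrite -ltnS.
pose U m := \bigcup_(j in [set j | good m j]) E m j.
pose F m := U (maxn m0 m1 + m)%N.
have mU m : measurable (U m).
  by apply: fin_bigcup_measurable => [|j _]; [exact: finite_finset|exact: mE].
pose G m : R := 8 / (a * rate) * (52 * r m) `^ (1 + del).
have G0 m : 0 <= G m.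
  by apply: mulr_ge0; [rewrite divr_ge0// mulr_ge0// ltW|exact: powR_ge0].
have PU m : (m0 <= m)%N -> (P (U m) <= ((2 * 2 ^+ m) * G m ^+ 2)%:E)%E.
  move=> m0m; have [e1 e2 e3] := hm0 m m0m.
  rewrite -(fineK (fin_num_measure P _ (mU m))) lee_fin.
  pose f (j : 'I_(2 ^ m).+1) : T -> R := fun w => (good m j)%:R * \1_(E m j) w.
  have mf j : has_mean P (f j) ((good m j)%:R * fine (P (E m j))).
    by apply: has_meanZ; exact: has_mean_indic.
  apply: (le_trans (has_mean_le (has_mean_indic P (mU m)) (has_mean_sum mf) _)).
    have f0 j w : 0 <= f j w by rewrite mulr_ge0// indicE.
    move=> w; rewrite indicE; case: (boolP (w \in U m)) => [|_]; last first.
      by apply: sumr_ge0 => j _; exact: f0.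
    rewrite inE => -[j gj Ej]; rewrite (bigD1 j)//= /f gj indicE mem_set// mulr1.
    by rewrite lerDl; apply: sumr_ge0 => i _; exact: f0.
  apply: (@le_trans _ _ (\sum_(j < (2 ^ m).+1) G m ^+ 2)).
    apply: ler_sum => j _; case: (boolP (good m j)) => [/andP[g1 g2]|_]; last first.
      by rewrite mul0r exprn_ge0.
    have jN : (j <= 2 ^ m)%N by rewrite -ltnS.
    rewrite mul1r near_future_past_indep// fineM; last 2 first.
    + by apply: fin_num_measure; exact: (measurable_near_future HB).
    + by apply: fin_num_measure; exact: (measurable_near_past HB).
    rewrite expr2; apply: ler_pM; try exact: fine_ge0.
    + exact: (near_future_le (p0 _) jN e1 e2 e3 a0 g2).
    + exact: (near_past_le (p0 _) jN e1 e2 e3 a0 g1).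
  rewrite sumr_const card_ord -[leLHS]mulr_natl; apply: ler_wpM2r; first exact: exprn_ge0.
  rewrite -natrX -natrM ler_nat mul2n -addnn -addn1 leq_add2l.
  exact: p0.
exists (lim_sup_set F); split.
- by apply: bigcap_measurable => // n' _; apply: bigcup_measurable => j _; exact: mU.
- pose c := 2 * (8 / (a * rate) * (52 * C1) `^ (1 + del)) ^+ 2 *
    (2 * (z `^ (1 + del)) ^+ 2) ^+ maxn m0 m1.
  have x0 : 0 < 2 * (z `^ (1 + del)) ^+ 2 by rewrite mulr_gt0// exprn_gt0.
  apply: (borel_cantelli_geometric (c := c) (fun m => mU _) _ x0 wedge_z_pow).
    by apply: mulr_ge0; [exact: mulr_ge0 (ler0n _ _) (sqr_ge0 _)|exact: exprn_ge0 _ (ltW x0)].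
  move=> m; have := PU (maxn m0 m1 + m)%N (leq_trans (leq_maxl _ _) (leq_addr _ _)).
  move=> /le_trans; apply; rewrite lee_fin /G powE /c.
  have alg (A1 B1 Z : R) l : 2 * 2 ^+ l * (A1 * (B1 * Z ^+ l)) ^+ 2 =
      2 * (A1 * B1) ^+ 2 * (2 * Z ^+ 2) ^+ l.
    have e : (Z ^+ 2) ^+ l = (Z ^+ l) ^+ 2 by rewrite -!exprM mulnC.
    by rewrite (exprMn _ 2) e; move: (Z ^+ l) (2 ^+ l) => x y; ring.
  by rewrite alg -[leRHS]mulrA -exprD.
- move=> w Sw n' _; exists n' => //=.
  have [j0 [j1 j2 j3 j4 j5]] := SE _ (leq_trans (leq_maxr m0 m1) (leq_addr n' _)) w Sw.
  have jl : (j0 < (2 ^ (maxn m0 m1 + n')).+1)%N by rewrite ltnS.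
  by exists (Ordinal jl) => //=; rewrite /good j2 j3.
Qed.

End decay.

(** * Norm estimates, convex hulls and supporting half-spaces *)

Section norm.
Context {R : realType} {n : nat}.
Implicit Types x y u v : 'rV[R]_n.

Lemma dotv_triangle x y :
  Num.sqrt (dotv (x + y) (x + y)) <= Num.sqrt (dotv x x) + Num.sqrt (dotv y y).
Proof.
rewrite -(ler_pXn2r (ltn0Sn 1)) ?nnegrE ?addr_ge0 ?sqrtr_ge0//.
rewrite sqrrD !sqr_sqrtr ?dotv_ge0// dotvDr !dotvDl (dotvC y x).
have := dotv_norm x y; have := ler_norm (dotv x y).
move: (Num.sqrt _ * Num.sqrt _) (dotv x y) => a b h1 h2.
rewrite -mulr_natl; lra.
Qed.

Lemma dotv_opp x : dotv (- x) (- x) = dotv x x.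
Proof. by rewrite dotvNr dotvC dotvNr opprK. Qed.

Lemma sqrt_dotv_le_sum x (b : R) : 0 <= b -> (forall i, `|x ord0 i| <= b) ->
  Num.sqrt (dotv x x) <= n.+1%:R * b.
Proof.
move=> b0 xb; rewrite -[leRHS]ger0_norm ?mulr_ge0// -sqrtr_sqr; apply: ler_wsqrtr.
apply: (@le_trans _ _ (\sum_(i < n) b ^+ 2)).
  apply: ler_sum => i _; rewrite -expr2; exact: sqr_le_of_norm.
rewrite sumr_const card_ord exprMn -natrX.
have -> : b ^+ 2 *+ n = n%:R * b ^+ 2 by rewrite mulr_natl.
apply: ler_wpM2r; first exact: sqr_ge0.
by rewrite ler_nat expnS expn1 (leq_trans (leqnSn n))// leq_pmulr.
Qed.

Lemma continuous_dotv u : continuous (dotv u).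
Proof.
rewrite /dotv; elim: (index_enum _) => [|i s ih] y.
  have -> : (fun v : 'rV[R]_n => \sum_(i <- [::]) u ord0 i * v ord0 i) = fun=> 0.
    by apply/funext => v; rewrite big_nil.
  exact: cst_continuous.
have -> : (fun v : 'rV[R]_n => \sum_(j <- i :: s) u ord0 j * v ord0 j) =
    (fun v => u ord0 i * v ord0 i + \sum_(j <- s) u ord0 j * v ord0 j).
  by apply/funext => v; rewrite big_cons.
have h1 : {for y, continuous (fun v : 'rV[R]_n => v ord0 i)} by exact: coord_continuous.
have h2 : {for y, continuous (fun=> u ord0 i : R)} by exact: cst_continuous.
exact: (continuousD (continuousM h2 h1) (ih y)).
Qed.

Lemma conv_hull_sub (S : set 'rV[R]_n) x : S x -> conv_hull S x.
Proof.
move=> Sx; exists 1%N, (fun=> x), (fun=> 1); split => //.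
  by rewrite big_ord1.
by rewrite big_ord1 scale1r.
Qed.

Lemma conv_hull_dotv_le (S : set 'rV[R]_n) u (m : R) :
  (forall y, S y -> dotv u y <= m) -> forall y, conv_hull S y -> dotv u y <= m.
Proof.
move=> Sm y [l [p [w [Sp w0 w1 ->]]]].
have -> : dotv u (\sum_(i < l) w i *: p i) = \sum_(i < l) w i * dotv u (p i).
  elim/big_rec2: _ => [|i a b _ <-]; first by rewrite dotv0r.
  by rewrite dotvDr dotvZr.
rewrite -[m]mul1r -w1 mulr_suml; apply: ler_sum => i _.
by apply: ler_wpM2l; [exact: w0|exact: Sm].
Qed.

(** A boundary point is only known to lie in the closure of the hull, so linear bounds have to pass
    to the closure. *)
Lemma closure_dotv_le (K : set 'rV[R]_n) u (m : R) x :
  (forall y, K y -> dotv u y <= m) -> closure K x -> dotv u x <= m.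
Proof.
move=> Km clx; pose F := dotv u @^-1` [set z | z <= m].
have clF : closed F.
  by apply: closed_comp; [move=> y _; exact: continuous_dotv|exact: closed_le].
suff : closure K `<=` F by apply.
have -> : F = closure F by exact/closure_id.
by apply: closureS => y Ky; exact: Km.
Qed.

End norm.

Lemma dotv_unit_lt1 (R : realType) n (x y : 'rV[R]_n) :
  dotv x x = 1 -> dotv y y = 1 -> x != y -> x != - y -> `|dotv x y| < 1.
Proof.
move=> x1 y1 xy xNy.
have p1 : 0 < dotv (x - y) (x - y).
  by rewrite lt_neqAle eq_sym dotv_eq0 subr_eq0 xy dotv_ge0.
have p2 : 0 < dotv (x + y) (x + y).
  by rewrite lt_neqAle eq_sym dotv_eq0 addr_eq0 xNy dotv_ge0.
move: p1 p2; rewrite dotvBr dotvDr !dotvBl !dotvDl (dotvC y x) x1 y1 ltr_norml => p1 p2.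
by apply/andP; split; lra.
Qed.

(** * From a singular boundary point to a time on the path *)

Section singular.
Context {R : realType} {n : nat}.
Variable f : R -> 'rV[R]_n.
Hypothesis fc : {within [set t : R | 0 <= t], continuous f}.

Lemma path_dotv_continuous u : {within `[0, 1], continuous (fun t => dotv u (f t))}.
Proof.
have sub : `[0, 1]%classic `<=` [set t : R | 0 <= t].
  by move=> t /=; rewrite in_itv/= => /andP[].
have fc' := continuous_subspaceW sub fc.
move=> t; apply: (@continuous_comp _ _ _ (f : subspace `[0, 1] -> 'rV[R]_n) (dotv u)).
  exact: fc'.
exact: continuous_dotv.
Qed.

Lemma path_bounded : exists M, forall t, 0 <= t <= 1 -> Num.sqrt (dotv (f t) (f t)) <= M.
Proof.
have hb i : exists b, forall t, 0 <= t <= 1 -> `|f t ord0 i| <= b.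
  pose e : 'rV[R]_n := delta_mx ord0 i.
  have eE (x : 'rV[R]_n) : dotv e x = x ord0 i.
    rewrite /dotv (bigD1 i)//= mxE !eqxx mul1r big1 ?addr0// => j ji.
    by rewrite mxE (negbTE ji) andbF mul0r.
  have [c1 _ h1] := EVT_max ler01 (@path_dotv_continuous e).
  have [c2 _ h2] := EVT_max ler01 (@path_dotv_continuous (- e)).
  exists (Num.max (dotv e (f c1)) (dotv (- e) (f c2))) => t t01.
  have tI : t \in `[0, 1] by rewrite in_itv.
  have := h1 t tI; have := h2 t tI; rewrite (dotvC (- e) (f t)) dotvNr (dotvC (f t)) !eE.
  by move=> a b; rewrite ler_norml lerNl le_max a orbT/= le_max b.
have [b hb'] := choice hb.
exists (n.+1%:R * \sum_i `|b i|) => t t01.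
apply: sqrt_dotv_le_sum; first exact: sumr_ge0.
move=> i; apply: (le_trans (hb' i t t01)); apply: (le_trans (ler_norm _)).
by rewrite (bigD1 i)//= lerDl sumr_ge0.
Qed.

Lemma path_coord_epsilon i t : 0 <= t -> forall e, 0 < e ->
  exists2 del, 0 < del & forall y, 0 <= y -> `|y - t| < del ->
    `|f y ord0 i - f t ord0 i| < e.
Proof.
move=> t0 e e0.
have /subspace_continuousP /(_ t t0) ft := fc.
have cc : (f y ord0 i) @[y --> within [set t : R | 0 <= t] (nbhs t)] --> f t ord0 i.
  have ci : {for f t, continuous (fun v : 'rV[R]_n => v ord0 i)} by exact: coord_continuous.
  exact: (cvg_comp f (fun v : 'rV[R]_n => v ord0 i) ft ci).
have /cvgrPdist_lt /(_ e e0) := cc.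
rewrite near_withinE => /nbhs_ballP[del del0 H]; exists del => // y y0 yt.
by rewrite distrC; apply: H => //; rewrite /ball/= distrC.
Qed.

Lemma singular_time x H1 H2 :
  boundary (conv_hull [set f t | t in `[0, 1]]) x ->
  supporting_hyperplane (conv_hull [set f t | t in `[0, 1]]) x H1 ->
  supporting_hyperplane (conv_hull [set f t | t in `[0, 1]]) x H2 -> H1 <> H2 ->
  exists u v t, [/\ dotv u u = 1, dotv v v = 1, `|dotv u v| < 1, 0 <= t <= 1 &
    forall s, 0 <= s <= 1 -> dotv u (f s - f t) <= 0 /\ dotv v (f s - f t) <= 0].
Proof.
set K := conv_hull _ => -[clx _] [u1 [u10 H1E u1K]] [u2 [u20 H2E u2K]] H12.
have norm (u : 'rV[R]_n) : u != 0 -> 0 < Num.sqrt (dotv u u).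
  by move=> u0; rewrite sqrtr_gt0 lt_neqAle eq_sym dotv_eq0 u0 dotv_ge0.
pose nu (u : 'rV[R]_n) := (Num.sqrt (dotv u u))^-1 *: u.
have nu1 u : u != 0 -> dotv (nu u) (nu u) = 1.
  move=> u0; rewrite /nu dotvZr dotvZl mulrA -expr2 exprVn sqr_sqrtr ?dotv_ge0//.
  by rewrite mulVf// dotv_eq0.
have nuE u y : u != 0 -> (dotv u y = dotv u x) <-> (dotv (nu u) y = dotv (nu u) x).
  move=> u0; rewrite /nu !dotvZl; split=> [->//|].
  by apply: mulfI; rewrite invr_eq0 gt_eqF ?norm.
have nule u y : u != 0 -> dotv u y <= dotv u x -> dotv (nu u) y <= dotv (nu u) x.
  by move=> u0; rewrite /nu !dotvZl ler_pM2l// invr_gt0 norm.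
set u := nu u1; set v := nu u2.
have H1E' : H1 = [set y | dotv u y = dotv u x].
  by rewrite H1E; apply/seteqP; split=> y /=; [move/(nuE _ _ u10)|move=> h; apply/(nuE _ _ u10)].
have H2E' : H2 = [set y | dotv v y = dotv v x].
  by rewrite H2E; apply/seteqP; split=> y /=; [move/(nuE _ _ u20)|move=> h; apply/(nuE _ _ u20)].
have uv : u != v by apply/eqP => e; apply: H12; rewrite H1E' H2E' e.
(* Opposite normals define the same hyperplane, so [H1 <> H2] excludes this case too. *)
have uNv : u != - v.
  apply/eqP => e; apply: H12; rewrite H1E' H2E' e; apply/seteqP; split=> y /=;
    rewrite !(dotvC (- v)) !dotvNr !(dotvC _ v); first exact: oppr_inj.
  by move=> ->.
have Kf s : 0 <= s <= 1 -> K (f s).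
  by move=> s01; apply: conv_hull_sub; exists s => //=; rewrite in_itv.
have [t tI tmax] := EVT_max ler01 (@path_dotv_continuous (u + v)).
have t01 : 0 <= t <= 1 by move: tI; rewrite in_itv.
have xle : dotv (u + v) x <= dotv (u + v) (f t).
  apply: closure_dotv_le clx; apply: conv_hull_dotv_le => _ [s s01 <-].
  by apply: tmax; rewrite inE.
have ul s : 0 <= s <= 1 -> dotv u (f s) <= dotv u x.
  by move=> s01; apply: nule u10 (u1K _ (Kf _ s01)).
have vl s : 0 <= s <= 1 -> dotv v (f s) <= dotv v x.
  by move=> s01; apply: nule u20 (u2K _ (Kf _ s01)).
exists u, v, t; split => //; [exact: nu1|exact: nu1|apply: dotv_unit_lt1 => //; exact: nu1|].
(* Each of [u] and [v] is at most its value at [x] on [f t], while [xle] reverses the inequality for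
   the sum. Both are therefore equalities, and the supporting inequalities at [x] carry over to
   [f t]. *)
move=> s s01; rewrite !dotvBr; move: xle; rewrite !dotvDl.
have := ul s s01; have := vl s s01; have := ul t t01; have := vl t t01.
by move=> *; split; lra.
Qed.

End singular.

Lemma invr_truncnS_le (R : realType) (x : R) : 0 < x ->
  (Num.truncn x^-1).+1%:R^-1 <= x.
Proof.
move=> x0; rewrite -[leRHS]invrK lef_pV2 ?posrE ?invr_gt0//.
by rewrite ltW// truncnS_gt.
Qed.

(** * Perturbation to rational directions *)

Section rational_directions.
Context {R : realType} {n : nat}.
Implicit Types u v a b y e : 'rV[R]_n.

Lemma rational_row u (tau : R) : 0 < tau -> exists p : 'rV[rat]_n,
  Num.sqrt (dotv (map_mx ratr p - u) (map_mx ratr p - u)) <= tau.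
Proof.
move=> tau0; pose b := tau / n.+1%:R.
have b0 : 0 < b by rewrite divr_gt0.
have /choice[q hq] i : exists r : rat, `|ratr r - u ord0 i| <= b.
  have lt : u ord0 i - b < u ord0 i + b by lra.
  have [r] := rat_in_itvoo lt; rewrite in_itv/= => /andP[h1 h2].
  by exists r; rewrite ler_norml; apply/andP; split; lra.
exists (\row_i q i); apply: (le_trans (sqrt_dotv_le_sum (ltW b0) _)).
  by move=> i; rewrite !mxE.
by rewrite /b mulrC divfK.
Qed.

Lemma perturbed_dotv u v a b (t : R) : dotv u u = 1 -> dotv v v = 1 ->
  Num.sqrt (dotv a a) <= t -> Num.sqrt (dotv b b) <= t ->
  `|dotv (u + a) (v + b) - dotv u v| <= 2 * t + t ^+ 2.
Proof.
move=> u1 v1 ha hb.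
have t0 : 0 <= t by apply: le_trans ha; exact: sqrtr_ge0.
have h1 : `|dotv u b| <= t.
  by apply: (le_trans (dotv_norm _ _)); rewrite u1 sqrtr1 mul1r.
have h2 : `|dotv a v| <= t.
  by apply: (le_trans (dotv_norm _ _)); rewrite v1 sqrtr1 mulr1.
have h3 : `|dotv a b| <= t ^+ 2.
  by apply: (le_trans (dotv_norm _ _)); rewrite expr2; apply: ler_pM => //; exact: sqrtr_ge0.
have -> : dotv (u + a) (v + b) - dotv u v = dotv u b + dotv a v + dotv a b.
  by rewrite dotvDr !dotvDl; ring.
apply: (le_trans (ler_normD _ _)); apply: lerD h3.
by apply: (le_trans (ler_normD _ _)); lra.
Qed.

(** Each of the two inner products moves by at most 2t + t^2 <= 3t <= 3c, so a margin of 7c leaves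
    c. *)
Lemma perturbed_wedge u v a b (c t : R) : dotv u u = 1 -> dotv v v = 1 ->
  Num.sqrt (dotv a a) <= t -> Num.sqrt (dotv b b) <= t ->
  t <= 1 -> t <= c -> 7 * c <= 1 - `|dotv u v| ->
  dotv (u + a) (u + a) <= 2 ^+ 2 /\
  c <= dotv (u + a) (u + a) - `|dotv (u + a) (v + b)|.
Proof.
move=> u1 v1 ha hb t1 tc uv.
have t0 : 0 <= t by apply: le_trans ha; exact: sqrtr_ge0.
have tt : t ^+ 2 <= t by rewrite expr2 ler_piMr.
have := perturbed_dotv u1 u1 ha ha; rewrite u1 ler_norml => /andP[h1 h2].
have h3 := perturbed_dotv u1 v1 ha hb.
have h4 : `|dotv (u + a) (v + b)| <= `|dotv u v| + (2 * t + t ^+ 2).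
  rewrite -[dotv (u + a) (v + b)](subrK (dotv u v)).
  by apply: (le_trans (ler_normD _ _)); lra.
by split; lra.
Qed.

(** The error [a] in the direction costs a multiple of the length of [y + e], the error [e] in the
    base point a constant: the two slacks of [near_wedge]. *)
Lemma perturbed_halfspace u a y e (t r : R) : dotv u u = 1 ->
  Num.sqrt (dotv a a) <= t -> Num.sqrt (dotv e e) <= r -> dotv u y <= 0 ->
  dotv (u + a) (y + e) <= t * Num.sqrt (dotv (y + e) (y + e)) + r.
Proof.
move=> u1 ha he uy.
have h1 : dotv u e <= r.
  apply: (le_trans (ler_norm _)); apply: (le_trans (dotv_norm _ _)).
  by rewrite u1 sqrtr1 mul1r.
have h2 : dotv a (y + e) <= t * Num.sqrt (dotv (y + e) (y + e)).
  apply: (le_trans (ler_norm _)); apply: (le_trans (dotv_norm _ _)).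
  by apply: ler_wpM2r ha; exact: sqrtr_ge0.
by rewrite dotvDl dotvDr; lra.
Qed.

End rational_directions.

(** * Discretization and conclusion *)

Section discretization.
Context {R : realType} {n : nat} {d} {T : measurableType d} (P : probability T R).
Variable B : R -> T -> 'rV[R]_n.
Hypothesis HB : standard_brownian_motion P B.

Lemma coarse_incr_negligible (z : R) : 0 < z -> 1 < 2 * z ^+ 2 ->
  P.-negligible (lim_sup_set (coarse_incr B z)).
Proof.
move=> z0 z2.
have y0 : 0 < (2 * z ^+ 2)^-1 by rewrite invr_gt0; lra.
have y1 : (2 * z ^+ 2)^-1 < 1 by rewrite invf_lt1//; lra.
(* The moment order depends on [z]: it makes 2 / (2 z^2)^q at most 1/2. *)
have [q hq] := geometric_small 2 y0 y1 (ltac:(lra) : 0 < 2^-1 :> R).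
have mF l : measurable (coarse_incr B z l) by exact: (measurable_coarse_incr HB).
exists (lim_sup_set (coarse_incr B z)); split => //.
  by apply: bigcap_measurable => // m _; apply: bigcup_measurable => j _.
have := hq q (leqnn q); rewrite exprVn => hq'.
apply: (borel_cantelli_geometric (c := n%:R * normal_moment_cst q)
  (x := 2 / (2 * z ^+ 2) ^+ q) mF) => //.
- by rewrite mulr_ge0// normal_moment_cst_ge0.
- by rewrite divr_gt0// exprn_gt0//; lra.
- by apply: (le_lt_trans hq'); lra.
- by move=> l; exact: (coarse_incr_le HB).
Qed.

Lemma path_grid_close (z : R) w m1 m (t : R) : 0 < z -> z < 1 ->
  (forall l, (m1 <= l)%N -> ~ coarse_incr B z l w) -> (m1 <= m)%N -> 0 <= t <= 1 ->
  Num.sqrt (dotv (B t w - B (grid_time (2 ^ m) (Num.truncn (t * (2 ^ m)%:R))) w)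
    (B t w - B (grid_time (2 ^ m) (Num.truncn (t * (2 ^ m)%:R))) w))
  <= n.+1%:R / (1 - z) * z ^+ m.
Proof.
move=> z0 z1 hw mm t01; have [_ Bc _ _] := HB.
rewrite -mulrA; apply: sqrt_dotv_le_sum.
  by rewrite mulr_ge0 ?invr_ge0 ?exprn_ge0//; lra.
move=> i; rewrite !mxE [leRHS]mulrC.
apply: (dyadic_chaining (f := fun s => B s w ord0 i)) => //.
- move=> l ml j jl; rewrite leNgt; apply/negP => h.
  by apply: (hw l (leq_trans mm ml)); exists i; exists j.
- by move=> e e0; apply: (path_coord_epsilon (Bc w)) => //; case/andP: t01.
Qed.

Lemma near_increment_halfspaces u v a b w (t : R) N j0 j (tau r eta h M : R) :
  dotv u u = 1 -> dotv v v = 1 ->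
  Num.sqrt (dotv a a) <= tau -> Num.sqrt (dotv b b) <= tau -> tau <= eta -> r <= h ->
  (forall s, 0 <= s <= 1 ->
    dotv u (B s w - B t w) <= 0 /\ dotv v (B s w - B t w) <= 0) ->
  (forall s, 0 <= s <= 1 -> Num.sqrt (dotv (B s w) (B s w)) <= M / 2) ->
  Num.sqrt (dotv (B t w - B (grid_time N j0) w) (B t w - B (grid_time N j0) w)) <= r ->
  (0 < N)%N -> (j0 <= N)%N -> (j <= N)%N ->
  near_increment B N (u + a) (v + b) eta h M w j0 j.
Proof.
move=> u1 v1 ha hb te rh hs hM hr N0 j0N jN.
have grid01 i : (i <= N)%N -> 0 <= (grid_time N i : R) <= 1.
  move=> iN; rewrite /grid_time divr_ge0//= ler_pdivrMr ?ltr0n// mul1r.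
  by rewrite ler_nat.
rewrite /near_increment; set e := _ - _ in hr.
set y := B (grid_time N j) w - B t w.
have -> : B (grid_time N j) w - B (grid_time N j0) w = y + e.
  by rewrite /y /e addrA subrK.
have [uy vy] := hs _ (grid01 _ jN).
have eta_le : tau * Num.sqrt (dotv (y + e) (y + e)) <= eta * Num.sqrt (dotv (y + e) (y + e)).
  by apply: ler_wpM2r te; exact: sqrtr_ge0.
split; first split.
- by have := perturbed_halfspace u1 ha hr uy; lra.
- by have := perturbed_halfspace v1 hb hr vy; lra.
- have -> : y + e = B (grid_time N j) w - B (grid_time N j0) w.
    by rewrite /y /e addrA subrK.
  apply: (le_trans (dotv_triangle _ _)); rewrite dotv_opp.
  by have := hM _ (grid01 _ jN); have := hM _ (grid01 _ j0N); lra.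
Qed.

Definition chaining_cst (c : R) : R := n.+1%:R / (1 - @wedge_z R n c).

(** Quantitative linear independence, as diagonal dominance of the Gram matrix with margin [c]. *)
Definition wedge_condition (u v : 'rV[R]_n) (c : R) :=
  [/\ dotv u u <= 2 ^+ 2, dotv v v <= 2 ^+ 2, c <= dotv u u - `|dotv u v|
    & c <= dotv v v - `|dotv u v|].

(* The three alternatives correspond to t = 0, t = 1 and 0 < t < 1. *)
Definition corner (u v : 'rV[R]_n) (c M a : R) m1 : set T :=
  [set w | forall m, (m1 <= m)%N -> wedge_future B u v c M (chaining_cst c) m 0 w] `|`
  [set w | forall m, (m1 <= m)%N -> wedge_past B u v c M (chaining_cst c) m (2 ^ m) w] `|`
  [set w | forall m, (m1 <= m)%N -> exists j0, [/\ (j0 <= 2 ^ m)%N,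
     a * (2 ^ m)%:R <= j0%:R, a * (2 ^ m)%:R <= (2 ^ m - j0)%:R,
     wedge_future B u v c M (chaining_cst c) m j0 w
     & wedge_past B u v c M (chaining_cst c) m j0 w]].

Lemma chaining_cst_gt0 c : 0 < c -> 0 < chaining_cst c.
Proof. by move=> c0; rewrite divr_gt0// subr_gt0 wedge_z_lt1. Qed.

Lemma corner_negligible u v c M a m1 : 0 < c -> 0 <= M -> 0 < a ->
  wedge_condition u v c -> P.-negligible (corner u v c M a m1).
Proof.
move=> c0 M0 a0 [u2 v2 cu cv]; have C0 := chaining_cst_gt0 c0.
apply: negligibleU; first apply: negligibleU.
- apply: (wedge_start_negligible HB c0 M0 C0 u2 v2 cu cv (m1 := m1)).
  by move=> m mm w; apply.
- apply: (wedge_end_negligible HB c0 M0 C0 u2 v2 cu cv (m1 := m1)).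
  by move=> m mm w; apply.
- apply: (wedge_middle_negligible HB c0 M0 C0 u2 v2 cu cv (m1 := m1) a0).
  by move=> m mm w; apply.
Qed.

(** All parameters of the conclusion are rational or natural, hence countably many. The chaining
    exponent depends on the angle found at [w], so the hypothesis on coarse increments is made for
    every [k] at once. *)
Lemma singular_corner w :
  (forall k, exists m1, forall l, (m1 <= l)%N ->
     ~ coarse_incr B (@wedge_z R n k.+1%:R^-1) l w) ->
  ~ smooth_convex (conv_hull [set B t w | t in `[0, 1]]) ->
  exists (p q : 'rV[rat]_n) (k M a m1 : nat),
    wedge_condition (map_mx ratr p) (map_mx ratr q) k.+1%:R^-1 /\
    corner (map_mx ratr p) (map_mx ratr q) k.+1%:R^-1 M%:R a.+1%:R^-1 m1 w.
Proof.
have [B0 Bc _ _] := HB; move=> hold nsm.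
have [u [v [t [u1 v1 uv t01 hs]]]] : exists u v t,
    [/\ dotv u u = 1, dotv v v = 1, `|dotv u v| < 1, 0 <= t <= 1 &
    forall s, 0 <= s <= 1 ->
      dotv u (B s w - B t w) <= 0 /\ dotv v (B s w - B t w) <= 0].
  apply: contrapT => none; apply: nsm => x xK H1 H2 s1 s2.
  by apply: contrapT => H12; apply: none; exact: (singular_time (Bc w) xK s1 s2 H12).
have [M0 hM0] := path_bounded (Bc w).
have [k hk] : exists k : nat, 7 * k.+1%:R^-1 <= 1 - `|dotv u v|.
  have g0 : 0 < (1 - `|dotv u v|) / 7 by lra.
  exists (Num.truncn ((1 - `|dotv u v|) / 7)^-1).
  by rewrite mulrC -ler_pdivlMr// invr_truncnS_le.
set c : R := k.+1%:R^-1 in hk; have c0 : 0 < c by rewrite invr_gt0.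
have c1 : c <= 1 by rewrite invf_le1// ler1n.
have kpos := wedge_k_gt0 n c0.
have kle1 : wedge_k n c <= 1 by apply: wedge_k_le1; lra.
(* The bound [c] preserves the margin in [wedge_condition]; [wedge_k n c / 16] is the angular slack
   of the survival event. *)
pose tau := Num.min c (wedge_k n c / 16).
have tau0 : 0 < tau by rewrite lt_min c0/= divr_gt0.
have tc : tau <= c by rewrite ge_min lexx.
have tk : tau <= wedge_k n c / 16 by rewrite ge_min lexx orbT.
have [p hp] := rational_row u tau0; have [q hq] := rational_row v tau0.
have pE : map_mx ratr p = u + (map_mx ratr p - u) by rewrite addrC subrK.
have qE : map_mx ratr q = v + (map_mx ratr q - v) by rewrite addrC subrK.
set a := _ - u in hp pE; set b := _ - v in hq qE.
pose M := (Num.truncn (2 * M0)).+1.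
have hM s : 0 <= s <= 1 -> Num.sqrt (dotv (B s w) (B s w)) <= M%:R / 2.
  move=> s01; apply: (le_trans (hM0 s s01)); rewrite ler_pdivlMr// mulrC.
  by apply: ltW; exact: truncnS_gt.
have [m1 hm1] := hold k.
have z0 : 0 < @wedge_z R n c by exact: wedge_z_gt0.
have z1 : @wedge_z R n c < 1 by exact: wedge_z_lt1.
have C0 := chaining_cst_gt0 c0.
have near m j0 j : (m1 <= m)%N -> j0 = Num.truncn (t * (2 ^ m)%:R) -> (j0 <= 2 ^ m)%N ->
    (j <= 2 ^ m)%N ->
    near_increment B (2 ^ m) (map_mx ratr p) (map_mx ratr q) (wedge_k n c / 16)
      (3 * (chaining_cst c * @wedge_z R n c ^+ m)) M%:R w j0 j.
  move=> mm j0E j0N jN; rewrite pE qE.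
  apply: (near_increment_halfspaces (t := t) (tau := tau)
    (r := chaining_cst c * @wedge_z R n c ^+ m)) => //.
  - have : 0 <= chaining_cst c * @wedge_z R n c ^+ m by rewrite mulr_ge0 ?exprn_ge0// ltW.
    by move: (_ * _) => r r0; lra.
  - by rewrite j0E; exact: (path_grid_close (m1 := m1)).
  - by rewrite expn_gt0.
have cond : wedge_condition (map_mx ratr p) (map_mx ratr q) c.
  have t1 : tau <= 1 by lra.
  have [h1 h2] := perturbed_wedge u1 v1 hp hq t1 tc hk.
  have vu : 7 * c <= 1 - `|dotv v u| by rewrite dotvC.
  have [h3 h4] := perturbed_wedge v1 u1 hq hp t1 tc vu.
  by rewrite pE qE; split=> //; rewrite (dotvC (u + a)).
have [t0|t0] := eqVneq t 0.
  (* At an endpoint the cutoff plays no part in the alternative chosen, and 0 fills its slot. *)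
  exists p, q, k, M, 0%N, m1; split=> //; left; left => m mm j /andP[_ jN].
  by apply: near => //; rewrite t0 mul0r truncn0.
have [t1|t1] := eqVneq t 1.
  exists p, q, k, M, 0%N, m1; split=> //; left; right => m mm j jN.
  by apply: near => //; rewrite t1 mul1r natrK.
have {t0}t0 : 0 < t by rewrite lt_neqAle eq_sym t0; case/andP: t01.
have {t1}t1 : t < 1 by rewrite lt_neqAle t1; case/andP: t01.
(* The factor 2 absorbs the rounding down of t 2^m to [j0]: it costs at most 1, which is at most 2^m
   / (l + 1) once m > l. Rounding down only helps on the other side. *)
have [l [lt lt1]] : exists l : nat, 2 * l.+1%:R^-1 <= t /\ l.+1%:R^-1 <= 1 - t.
  pose g := Num.min (t / 2) (1 - t).
  have g0 : 0 < g by rewrite lt_min divr_gt0//= subr_gt0.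
  have gt : g <= t / 2 by rewrite ge_min lexx.
  have gt1 : g <= 1 - t by rewrite ge_min lexx orbT.
  exists (Num.truncn g^-1).
  move: (invr_truncnS_le g0); move: (_.+1%:R^-1) => y yg; split; lra.
exists p, q, k, M, l, (maxn m1 l.+1); split=> //; right => m.
rewrite geq_max => /andP[mm lm].
have N0 : (0 < 2 ^ m)%N by rewrite expn_gt0.
have lN : 1 <= l.+1%:R^-1 * (2 ^ m)%:R :> R.
  rewrite mulrC ler_pdivlMr// mul1r ler_nat.
  by apply: (leq_trans lm); apply: ltnW; exact: ltn_expl.
pose j0 := Num.truncn (t * (2 ^ m)%:R); exists j0.
have N0' : 0 < (2 ^ m)%:R :> R by rewrite ltr0n.
have tN0 : 0 <= t * (2 ^ m)%:R by rewrite mulr_ge0// ltW.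
have /andP[j0t tj0] := truncn_itv tN0; rewrite -/j0 in j0t tj0.
have tN : t * (2 ^ m)%:R <= (2 ^ m)%:R by rewrite ler_piMl// ltW.
have j0N : (j0 <= 2 ^ m)%N by rewrite -(ler_nat R); exact: le_trans tN.
have l1 : 2 * l.+1%:R^-1 * (2 ^ m)%:R <= t * (2 ^ m)%:R by rewrite ler_pM2r.
have l2 : l.+1%:R^-1 * (2 ^ m)%:R <= (1 - t) * (2 ^ m)%:R by rewrite ler_pM2r.
split => //.
- have e : j0.+1%:R = j0%:R + 1 :> R by rewrite natr1.
  by move: l1 lN tj0; rewrite e; move: (l.+1%:R^-1) => y *; lra.
- by move: l2; rewrite natrB//; move: (l.+1%:R^-1) => y *; lra.
- by move=> j /andP[_ jN]; exact: near.
- by move=> j jj0; apply: near => //; exact: leq_trans j0N.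
Qed.

Lemma almost_surely_smooth :
  {ae P, forall w, smooth_convex (conv_hull [set B t w | t in `[0, 1]])}.
Proof.
pose I := ('rV[rat]_n * 'rV[rat]_n * (nat * nat * nat * nat))%type.
pose E (i : I) : set T := let: (p, q, (k, M, a, m1)) := i in
  [set w | wedge_condition (map_mx ratr p) (map_mx ratr q) k.+1%:R^-1 /\
    corner (map_mx ratr p) (map_mx ratr q) k.+1%:R^-1 M%:R a.+1%:R^-1 m1 w].
(* Parameters that violate [wedge_condition] give an empty set, so the index type needs no
   restriction. *)
have Enegl i : P.-negligible (E i).
  move: i => [[p q] [[[k M] a] m1]] /=.
  have [h|h] := pselect (wedge_condition (map_mx ratr p) (map_mx ratr q) k.+1%:R^-1).
    apply: negligibleS (corner_negligible (c := k.+1%:R^-1) (M := M%:R) (a := a.+1%:R^-1) m1 _ _ _ h) => //.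
    by move=> w [].
  apply: (@negligibleS _ _ _ P set0); last exact: negligible_set0.
  by move=> w [].
pose F l : set T := if unpickle l is Some i then E i else set0.
pose G k : set T := lim_sup_set (coarse_incr B (@wedge_z R n k.+1%:R^-1)).
have FG : P.-negligible (\bigcup_l F l `|` \bigcup_k G k).
  apply: negligibleU; apply: negligible_bigcup => l.
    by rewrite /F; case: unpickle => [i|]; [exact: Enegl|exact: negligible_set0].
  by apply: coarse_incr_negligible; [exact: wedge_z_gt0|exact: wedge_z_sqr].
apply: negligibleS FG => w nsm.
have [h|h] := pselect ((\bigcup_k G k) w); [by right|left].
have [k|p [q [k [M [a [m1 hE]]]]]] := @singular_corner w _ nsm.
  apply: contrapT => none; apply: h; exists k => // m _.
  apply: contrapT => nm; apply: none; exists m => l ml hl.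
  by apply: nm; exists l.
by exists (pickle ((p, q, (k, M, a, m1)) : I)) => //; rewrite /F pickleK.
Qed.

End discretization.

Unset Implicit Arguments.

Theorem theorem1 (R : realType) (n : nat) (hn : (2 <= n)%N)
  (d : measure_display) (Omega : measurableType d) (P : probability Omega R)
  (B : R -> Omega -> 'rV[R]_n) :
  standard_brownian_motion P B ->
  {ae P, forall w : Omega,
     smooth_convex (conv_hull [set B t w | t in `[0, 1]])}.
Proof. exact: almost_surely_smooth. Qed.
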